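(* Let $M$ be a simple matroid. Let $(h_0,\ldots,h_s)$ be the $h$-vector of broken circuit complexes of $M$, where $h_s\neq 0$. Then the following conditions are equivalent: (i) there exists a linear ordering $<$ of the ground set of $M$ such that the broken circuit complex $BC(M,<)$ is a complete intersection; (ii) the $h$-vector $(h_0,\ldots,h_s)$ satisfies the Dehn--Sommerville equations: $h_i=h_{s-i}$ for $i=0,\ldots,s$; (iii) $h_0=h_s$ and $h_1=h_{s-1}$; (iv) each connected component of $M$ is either a coloop or isomorphic to an iterated parallel connection of uniform matroids of the form $U_{m,m+1}$ ($m\geq 2$).
   Context: Matroids are on finite ground sets. A matroid is simple if it has no loops and no two-element circuits. For a matroid $M$ on $E$ and a linear order $<$ on $E$, a broken circuit is a set $C\setminus\{\min_< C\}$ with $C$ a circuit of $M$; the broken circuit complex $BC(M,<)$ is the simplicial complex of all subsets of $E$ containing no broken circuit. A simplicial complex $\Delta$ is a complete intersection if its Stanley--Reisner ring $K[\Delta]=K[x_v: v\text{ a vertex of }\Delta]/I_\Delta$ is a complete intersection, where $I_\Delta$ is generated by the squarefree monomials $x_{i_1}\cdots x_{i_p}$ with $\{i_1,\dots,i_p\}\notin\Delta$ (this is independent of the field $K$: it means that the minimal non-faces of $\Delta$ are pairwise disjoint). If $\dim\Delta=r-1$ and $f_i$ is the number of faces of $\Delta$ of cardinality $i$, the $h$-vector $(h_0,\ldots,h_r)$ is given by $h_i=\sum_{j=0}^i(-1)^{i-j}\binom{r-j}{i-j}f_j$ for $i=0,\dots,r$. The $h$-vector of $BC(M,<)$ does not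 depend on the order $<$; zero entries at the end are removed, so $s$ is the largest index with $h_s\ne0$. Entries $h_i$ with $i<0$ or $i>s$ are understood to be $0$. The uniform matroid $U_{m,n}$ is the matroid on an $n$-element set whose independent sets are the subsets of cardinality at most $m$. A coloop is an element contained in every basis; a connected component that is a single coloop is called a coloop. The connected components of $M$ are the matroids in its unique decomposition as a direct sum of connected (non-separable) matroids. Let $M_1,M_2$ be matroids on $E_1,E_2$ with $E_1\cap E_2=\{e\}$, where $e$ is neither a loop nor a coloop in $M_1$ or $M_2$. Writing $\mathcal{C}(N)$ for the set of circuits of $N$, the parallel connection $P(M_1,M_2)$ relative to $e$ is the matroid on $E_1\cup E_2$ with set of circuits $\mathcal{C}(M_1)\cup\mathcal{C}(M_2)\cup\{(C_1\cup C_2)\setminus\{e\}: e\in C_i\in\mathcal{C}(M_i),\ i=1,2\}$. An iterated parallel connection of matroids $N_1,\dots,N_k$ ($k\ge1$) is a matroid obtained by starting with $N_1$ and successively forming the parallel connection of the current matroid with $N_2,\dots,N_k$, each time relative to some single common element (for $k=1$ it is $N_1$ itself). *)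

(* Defs.v *)
From HB Require Import structures.
From mathcomp Require Import all_boot all_order all_algebra.
From mathcomp Require Import mpoly.

Set Implicit Arguments.
Unset Strict Implicit.
Unset Printing Implicit Defensive.

Import Order.TTheory GRing.Theory Num.Theory.

Local Open Scope nat_scope.

(** * Matroids *)

(* A matroid on T has as ground set a subset of T, not all of T: parallel
   connections and components involve several matroids with different ground
   sets in the same ambient type. *)
Definition is_matroid (T : finType) (EI : {set T} * {set {set T}}) : bool :=
  [&& [forall A in EI.2, A \subset EI.1],
      set0 \in EI.2,
      [forall A in EI.2, forall B : {set T}, (B \subset A) ==> (B \in EI.2)]
    & [forall A in EI.2, forall B in EI.2,
        (#|A| < #|B|) ==> [exists x in B :\: A, x |: A \in EI.2]]].

Record matroid (T : finType) := Matroid {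
  matroid_data : {set T} * {set {set T}};
  _ : is_matroid matroid_data }.

HB.instance Definition _ (T : finType) := [isSub for @matroid_data T].
HB.instance Definition _ (T : finType) := [Finite of matroid T by <:].

Definition ground (T : finType) (M : matroid T) : {set T} := (matroid_data M).1.
Definition indep (T : finType) (M : matroid T) : {set {set T}} :=
  (matroid_data M).2.

Definition circuits (T : finType) (M : matroid T) : {set {set T}} :=
  [set C | minset (fun A => (A \subset ground M) && (A \notin indep M)) C].

Definition bases (T : finType) (M : matroid T) : {set {set T}} :=
  [set B | maxset (fun A => A \in indep M) B].

Definition loop (T : finType) (M : matroid T) (e : T) : bool :=
  [set e] \in circuits M.

Definition coloop (T : finType) (M : matroid T) (e : T) : bool :=
  (e \in ground M) && [forall B in bases M, e \in B].

Definition simple_matroid (T : finType) (M : matroid T) : Prop :=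
  (forall e : T, ~~ loop M e) /\
  (forall C, C \in circuits M -> #|C| != 2).

Definition isomorphic (T U : finType) (M : matroid T) (N : matroid U) : Prop :=
  exists f : T -> U,
    [/\ {in ground M &, injective f},
        f @: ground M = ground N
      & forall A : {set T}, A \subset ground M ->
          (A \in indep M) = (f @: A \in indep N)].

Definition is_uniform (T : finType) (m n : nat) (M : matroid T) : Prop :=
  #|ground M| = n /\
  indep M =
    [set A : {set T} | (A \subset ground M) && (#|A| <= m)].

(** * Direct sums and connected components *)

Definition direct_sum (T : finType) (D : {set matroid T}) (M : matroid T) : Prop :=
  [/\ {in D &, forall N1 N2, N1 != N2 -> [disjoint ground N1 & ground N2]},
      ground M = \bigcup_(N in D) ground N
    & forall A : {set T}, (A \in indep M) =
        (A \subset ground M) && [forall N in D, A :&: ground N \in indep N]].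

(* The condition N1 != N2 only prevents [set N1; N2] from collapsing to a
   single summand; it holds for any two summands with nonempty ground sets. *)
Definition connected_matroid (T : finType) (M : matroid T) : Prop :=
  ~ exists N1 N2 : matroid T,
      [/\ ground N1 != set0, ground N2 != set0, N1 != N2
        & direct_sum [set N1; N2] M].

Definition connected_component (T : finType) (M N : matroid T) : Prop :=
  exists D : {set matroid T},
    [/\ direct_sum D M,
        {in D, forall Q, ground Q != set0 /\ connected_matroid Q}
      & N \in D].

Definition single_coloop (T : finType) (N : matroid T) : Prop :=
  exists2 e : T, ground N = [set e] & coloop N e.

(** * Parallel connections *)

(* [parallel_connection e M1 M2 P] says that P is the matroid P(M1, M2)
   relative to e; a matroid is determined by its ground set and circuits. *)
Definition parallel_connection (T : finType) (e : T) (M1 M2 P : matroid T) : Prop :=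
  [/\ ground M1 :&: ground M2 = [set e],
      [/\ ~~ loop M1 e, ~~ coloop M1 e, ~~ loop M2 e & ~~ coloop M2 e],
      ground P = ground M1 :|: ground M2
    & circuits P = circuits M1 :|: circuits M2 :|:
        [set (C1 :|: C2) :\ e | C1 in circuits M1, C2 in circuits M2
                                & (e \in C1) && (e \in C2)]].

Inductive iterated_parallel_connection (T : finType) :
    seq (matroid T) -> matroid T -> Prop :=
| ipc_one (N : matroid T) : iterated_parallel_connection [:: N] N
| ipc_step (s : seq (matroid T)) (P N Q : matroid T) (e : T) :
    iterated_parallel_connection s P -> parallel_connection e P N Q ->
    iterated_parallel_connection (rcons s N) Q.

(** * Broken circuit complexes *)

(* Only the restriction of [lt] to E matters. *)
Definition linear_order_on (T : finType) (E : {set T}) (lt : rel T) : Prop :=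
  [/\ {in E, irreflexive lt}, {in E & &, transitive lt}
    & {in E &, forall x y, x != y -> lt x y || lt y x}].

Definition broken_circuits (T : finType) (M : matroid T) (lt : rel T) :
    {set {set T}} :=
  [set C :\ x | C in circuits M, x in C
                & [forall y in C, (y != x) ==> lt x y]].

Definition broken_circuit_complex (T : finType) (M : matroid T) (lt : rel T) :
    {set {set T}} :=
  [set F : {set T} | (F \subset ground M) &&
           [forall B in broken_circuits M lt, ~~ (B \subset F)]].

(** * h-vectors of simplicial complexes (given by their sets of faces) *)

Definition complex_rank (T : finType) (Delta : {set {set T}}) : nat :=
  \max_(F in Delta) #|F|.

Definition f_vector (T : finType) (Delta : {set {set T}}) (j : nat) : nat :=
  #|[set F in Delta | #|F| == j]|.

(* Indexed by int, so that entries of negative index are 0. *)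
Definition h_vector (T : finType) (Delta : {set {set T}}) (i : int) : int :=
  let r := complex_rank Delta in
  match i with
  | Posz n => if n <= r then
      (\sum_(j < n.+1)
         (-1) ^+ (n - j) * ('C(r - j, n - j))%:R * (f_vector Delta j)%:R)%R
      else 0%R
  | Negz _ => 0%R
  end.

(** * Stanley-Reisner rings and complete intersections *)

Definition in_ideal (R : comNzRingType) (s : seq R) (p : R) : Prop :=
  exists c : 'I_(size s) -> R, p = (\sum_(i < size s) c i * s`_i)%R.

Definition regular_sequence (R : comNzRingType) (s : seq R) : Prop :=
  (forall i : nat, i < size s -> forall g : R,
     in_ideal (take i s) (g * s`_i)%R -> in_ideal (take i s) g) /\
  ~ in_ideal s 1%R.

Definition vertices (T : finType) (Delta : {set {set T}}) : {set T} :=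
  [set v | [set v] \in Delta].

(* The variable 'X_i of {mpoly K[#|vertices Delta|]} stands for x_v, where
   v = enum_val i is the i-th vertex. *)
Definition vertex_monomial (K : fieldType) (T : finType)
    (Delta : {set {set T}}) (A : {set T}) : {mpoly K[#|vertices Delta|]} :=
  (\prod_(i < #|vertices Delta| | enum_val i \in A) 'X_i)%R.

Definition stanley_reisner_generators (K : fieldType) (T : finType)
    (Delta : {set {set T}}) : seq {mpoly K[#|vertices Delta|]} :=
  [seq vertex_monomial K Delta A
     | A <- enum [set A : {set T} | (A \subset vertices Delta) && (A \notin Delta)]].

(* The quotient K[x_v] / I_Delta is a complete intersection when I_Delta is
   generated by a regular sequence. *)
Definition complete_intersection (K : fieldType) (T : finType)
    (Delta : {set {set T}}) : Prop :=
  exists2 s : seq {mpoly K[#|vertices Delta|]}, regular_sequence s &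
    forall p, in_ideal s p <-> in_ideal (stanley_reisner_generators K Delta) p.

(* Main.v *)
(* The h-vector of BC(M, <) consists of the coefficients of T(M; x, 0), by
   Whitney's broken circuit theorem; in particular it does not depend on <.

   (i) -> (ii). If the Stanley-Reisner ideal I is generated by a regular sequence,
   then I / I^2 is free over R / I, so every relation among the minimal monomial
   generators of I has its coefficients in I. Two generators with a common factor
   have a relation violating this, so the minimal non-faces are disjoint. Counting
   faces, T(M; x, 0) is a product of powers of x and of factors 1 + x + ... + x^d.

   (iii) -> (iv). Splitting off components, one may take M connected with beta
   invariant h_s = 1. By deletion-contraction and induction, h_(s-1) >= h_1: if M / e
   is disconnected, then M is a parallel connection at e and the h-polynomial
   factors; otherwise M \ e is disconnected, M / e is connected, and contracting e
   creates at most one parallel pair. In case of equality, M is a circuit or some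
   M / e is disconnected; the latter splits M as a parallel connection, and the
   resulting tree of circuits can be rearranged so that circuits are attached one
   at a time.

   (iv) -> (i). Order each new circuit N_i after the matroid to which it is attached
   at e_i; the minimal broken circuits are then the disjoint sets N_i \ e_i. *)

Require Import Defs.
From mathcomp Require Import all_boot all_order all_algebra.
From mathcomp Require Import mpoly zify ring.
From Stdlib Require Import Classical.

Set Implicit Arguments.
Unset Strict Implicit.
Unset Printing Implicit Defensive.

Import Order.TTheory GRing.Theory Num.Theory.

Local Open Scope ring_scope.

(** * Rank functions *)

(** The induction behind h_(s-1) >= h_1 must stay among simple matroids, but a contraction may
    create parallel elements. Write gamma for the coefficient next to beta. If beta(E) = 1 and E / e
    is connected, then beta(E / e) >= 1 leaves beta(E \ e) = 0, so E \ e is a direct sum of some A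
    and B, and gamma(E \ e) = beta(A) beta(B). A parallel pair of E / e has one element on each side
    and is unique, so simplifying costs one element; its presence also forces A and B to be
    connected, and beta(A) beta(B) >= 1 pays for that element. For equality, the induction yields a
    separation of a minor, which is brought back to E by Tutte's theorem that deletion or
    contraction of an element preserves connectedness. Condition (iii) does not assume M connected:
    the lowest nonzero coefficient of T(X, 0) is the product of the beta invariants of the
    components, so h_s = 1 makes each of them 1, and equality in the sum of their inequalities is
    equality in each. For (i), a regular sequence generating a monomial ideal has as many members as
    there are minimal monomials; this is read off from the constant terms of the two transition
    matrices. *)

Ltac finset_bool z :=
  repeat match goal with
  | H : is_true (_ \subset _) |- _ => move/subsetP/(_ z): H => H
  | H : is_true [disjoint _ & _] |- _ =>
      let H' := fresh in have H' := @disjointFr _ _ _ z H; clear H; rename H' into H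
  end;
  repeat match goal with
  | H : _ |- _ => progress rewrite !inE in H
  end;
  rewrite ?inE;
  repeat match goal with
  | H : context [_ \in _] |- _ => move: H
  | H : context [_ == _] |- _ => move: H
  end;
  repeat match goal with
  | |- context [?a == ?b] => case: (a =P b) => [?|_]; subst
  end;
  repeat match goal with
  | |- context [?a \in ?A] => case: (a \in A)
  end;
  intros; simpl in *;
  repeat match goal with
  | H : is_true true -> _ |- _ => specialize (H isT); simpl in H
  end;
  done.

(** The frequent [clear] before this tactic limits its case analysis, in which every membership
    hypothesis takes part. *)
Ltac finset :=
  let z := fresh "z" in
  match goal with
  | |- is_true (_ \subset _) => apply/subsetP => z; finset_bool z
  | |- is_true [disjoint _ & _] =>
      rewrite disjoint_subset; apply/subsetP => z; finset_bool z
  | |- @eq bool (?a \in _) _ => finset_bool a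
  | |- is_true (?a \in _) => finset_bool a
  | |- is_true (?a \notin _) => finset_bool a
  | |- _ = _ => apply/setP => z; finset_bool z
  end.

(* [lia] after dropping everything but linear facts on nat: its preprocessing is
   exponential in the boolean hypotheses. *)
Ltac rlia :=
  repeat match goal with
  | H : is_true (leq _ _) |- _ => revert H
  | H : @eq ?X _ _ |- _ => unify X nat; change X with nat in H; revert H
  end;
  clear; intros; lia.

(* A matroid is represented by a rank function on all of {set T} together with a
   ground set E, so that a deletion changes only E, and a contraction only r and E. *)
Record rank_fun (T : finType) (r : {set T} -> nat) : Prop := RankFun {
  rank0 : r set0 = 0%N;
  rankU1_le : forall x A, (r (x |: A) <= (r A).+1)%N;
  rankS : forall A B : {set T}, A \subset B -> (r A <= r B)%N;
  rank_submod : forall A B, (r (A :|: B) + r (A :&: B) <= r A + r B)%N }.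

Definition contract (T : finType) (r : {set T} -> nat) (e : T) (A : {set T}) : nat :=
  (r (e |: A) - r [set e])%N.

(** Both sides are nonempty, so the empty set and singletons, even a single loop, are not separated;
    hence conditions such as [0 < r E] in [conn_beta]. *)
Definition separated (T : finType) (r : {set T} -> nat) (E : {set T}) : bool :=
  [exists A : {set T}, [&& A \subset E, A != set0, A != E & r A + r (E :\: A) == r E]%N].

(** The case x = y excludes loops, the case x != y parallel pairs. *)
Definition simple_rank (T : finType) (r : {set T} -> nat) (E : {set T}) : Prop :=
  {in E &, forall x y, r [set x; y] = (x != y).+1}.

(* The Tutte polynomial T(X, 0); the coefficient of X^(r - i) is h_i. *)
Definition char_poly0 (T : finType) (r : {set T} -> nat) (E : {set T}) : {poly int} :=
  \sum_(S : {set T} | S \subset E)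
     (-1) ^+ (#|S| + r S) * ('X - 1) ^+ (r E - r S).

Section RankFunctions.

Variable T : finType.
Implicit Types (r : {set T} -> nat) (A B E S : {set T}) (e x y : T).

Lemma cardsU_disjoint A B : [disjoint A & B] -> #|A :|: B| = (#|A| + #|B|)%N.
Proof. by move=> dAB; rewrite cardsU (disjoint_setI0 dAB) cards0 subn0. Qed.

Lemma rank1_le r x : rank_fun r -> (r [set x] <= 1)%N.
Proof. by move=> R; have := rankU1_le R x set0; rewrite setU0 (rank0 R). Qed.

(** With U and I free, an application of submodularity leaves inclusions to check instead of
    computations of unions and intersections. *)
Lemma rank_submod_sub r A B (U I : {set T}) : rank_fun r -> U \subset A :|: B ->
  I \subset A :&: B -> (r U + r I <= r A + r B)%N.
Proof.
move=> R sU sI; apply: leq_trans (rank_submod R A B).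
by rewrite leq_add ?(rankS R).
Qed.

Lemma rankU_le r A B : rank_fun r -> (r (A :|: B) <= r A + r B)%N.
Proof.
by move=> R; have := rank_submod R A B; lia.
Qed.

Lemma contractE r e A : rank_fun r -> (contract r e A + r [set e] = r (e |: A))%N.
Proof.
by move=> R; rewrite /contract subnK // (rankS R) // subsetUl.
Qed.

Lemma contract_rank r e : rank_fun r -> rank_fun (contract r e).
Proof.
move=> R; have cE A := contractE e A R.
split.
- by rewrite /contract setU0 subnn.
- move=> x A; have := cE A; have := cE (x |: A).
  have := rankU1_le R x (e |: A).
  by rewrite setUCA; lia.
- move=> A B AB; have := cE A; have := cE B.
  by have := rankS R (setUS [set e] AB); lia.
- move=> A B; have := cE A; have := cE B; have := cE (A :|: B); have := cE (A :&: B).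
  have := rank_submod R (e |: A) (e |: B).
  by rewrite -setUIr setUACA setUid; lia.
Qed.

Lemma contractC r e f A : rank_fun r ->
  contract (contract r e) f A = contract (contract r f) e A.
Proof.
move=> R; rewrite /contract setUCA [e |: [set f]]setUC.
have := rankS R (subsetUl [set e] [set f]).
have := rankS R (subsetUr [set e] [set f]).
have := rankS R (_ : [set f; e] \subset f |: (e |: A)).
rewrite [f |: [set e]]setUC.
have -> : [set e; f] \subset f |: (e |: A) by finset.
by move/(_ isT); lia.
Qed.

Lemma separatedP r E :
  reflect (exists A B, [/\ A != set0, B != set0, [disjoint A & B], E = A :|: B
                         & r A + r B = r E]%N)
          (separated r E).
Proof.
apply: (iffP existsP) => [[A /and4P [sA A0 AE /eqP rA]]|[A [B [A0 B0 dAB -> rE]]]].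
  exists A, (E :\: A); split=> //; last by finset.
    apply: contra AE; rewrite setD_eq0 => sEA.
    by rewrite eqEsubset sA.
  by rewrite disjoint_sym disjoints_subset; finset.
exists A; rewrite subsetUl A0 /=.
have -> : (A :|: B) :\: A = B by finset.
rewrite rE eqxx andbT.
apply: contra B0 => /eqP eA; apply/eqP.
have sB : B \subset A by rewrite eA subsetUr.
by finset.
Qed.

Lemma separatedI r A B : A != set0 -> B != set0 -> [disjoint A & B] ->
  rank_fun r -> (r A + r B <= r (A :|: B))%N -> separated r (A :|: B).
Proof.
move=> A0 B0 dAB R le_r; apply/separatedP; exists A, B; split=> //.
by have := rankU_le A B R; lia.
Qed.

(** A defect of additivity on S would survive joining A and then B to S, by submodularity at each
    stage. *)
Lemma rank_sepS r A B S : rank_fun r -> [disjoint A & B] ->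
  (r A + r B <= r (A :|: B))%N -> S \subset A :|: B ->
  r S = (r (S :&: A) + r (S :&: B))%N.
Proof.
move=> R dAB rAB sS.
apply/eqP; rewrite eqn_leq; apply/andP; split.
  apply: leq_trans (rankU_le _ _ R); apply: (rankS R).
  by rewrite -setIUr subsetI subxx.
have h1 := @rank_submod_sub r S A (S :|: A) (S :&: A) R (subxx _) (subxx _).
have h2 : (r (A :|: B) + r (S :&: B) <= r (S :|: A) + r B)%N.
  by apply: rank_submod_sub R _ _; finset.
by lia.
Qed.

Lemma rank_sepU r A B A' B' : rank_fun r -> [disjoint A & B] ->
  (r A + r B <= r (A :|: B))%N -> A' \subset A -> B' \subset B ->
  r (A' :|: B') = (r A' + r B')%N.
Proof.
move=> R dAB rAB sA sB; rewrite (rank_sepS R dAB rAB) ?setUSS //.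
have -> : (A' :|: B') :&: A = A' by finset.
by have -> : (A' :|: B') :&: B = B' by finset.
Qed.

(* Tutte: the two separations of E :\ e are uncrossed by submodularity. *)
Lemma conn_del_or_contract r E e : rank_fun r -> e \in E -> ~~ separated r E ->
  ~~ separated r (E :\ e) \/ ~~ separated (contract r e) (E :\ e).
Proof.
move=> R eE nsE.
have [/separatedP [A [B [A0 B0 dAB eAB rAB]]]|nsA] := boolP (separated r (E :\ e)); last by left.
have [/separatedP [C [D [C0 D0 dCD eCD rCD]]]|nsA] := boolP (separated _ _); last by right.
case/negP: nsE.
(* If e is a coloop or a loop, it splits off and separates E. *)
have [h|h] := ltnP (r (E :\ e)) (r E).
  have EE : E = [set e] :|: (E :\ e) by rewrite setD1K.
  rewrite EE; apply: separatedI => //.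
  - by apply/set0Pn; exists e; rewrite inE.
  - by apply: contra A0; rewrite eAB setU_eq0 => /andP[].
  - by rewrite disjoints1 !inE eqxx.
  - by rewrite setD1K //; have := rank1_le e R; lia.
have [h1|h1] := eqVneq (r [set e]) 0%N.
  have EE : E = [set e] :|: (E :\ e) by rewrite setD1K.
  rewrite EE; apply: separatedI => //.
  - by apply/set0Pn; exists e; rewrite inE.
  - by apply: contra A0; rewrite eAB setU_eq0 => /andP[].
  - by rewrite disjoints1 !inE eqxx.
  - rewrite setD1K // h1; apply: (rankS R); exact: subD1set.
have {}h1 : r [set e] = 1%N by have := rank1_le e R; lia.
have hC := contractE e C R; have hD := contractE e D R.
have hE := contractE e (E :\ e) R.
rewrite setD1K // in hE.
(* A nonempty cell X ∩ X' and its complement in E separate E unless their ranks add up to more than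
   r E. *)
have key (X Y X' Y' : {set T}) : X != set0 -> E :\ e = X :|: Y -> E :\ e = X' :|: Y' ->
    [disjoint X & Y] -> [disjoint X' & Y'] ->
    X :&: X' != set0 ->
    (r E < r (X :&: X') + r (Y :|: (e |: Y')))%N || separated r E.
  move=> X0 eXY eXY' d d' XX'0.
  rewrite orbC -implyNb; apply/implyP; rewrite ltnNge; apply: contra => le.
  have EE : E = (X :&: X') :|: (Y :|: (e |: Y')).
    rewrite -(setD1K eE).
    apply/setP=> z; move/setP/(_ z): eXY; move/setP/(_ z): eXY'.
    rewrite !inE; have := disjointFr d (x := z); have := disjointFr d' (x := z).
    case: (z =P e) => [->|_] //=; first by rewrite !orbT.
    case: (z \in E) => /=;
    by case: (z \in X); case: (z \in X'); case: (z \in Y); case: (z \in Y') => //= H1 H2;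
      try (by have := H1 isT); try (by have := H2 isT).
  rewrite [in separated _ _]EE; apply: separatedI => //; last by rewrite -EE.
    by apply/set0Pn; exists e; rewrite !inE eqxx orbT.
  have eX : e \notin X by have := setD11 e E; rewrite eXY inE => /negbT; rewrite negb_or => /andP[].
  by clear -d d' eX; finset.
have subm X X' : (r (X :&: X') + r (X :|: (e |: X')) <= r X + r (e |: X'))%N.
  by rewrite addnC; apply: rank_submod_sub R _ _; clear; finset.
have [eAB' eCD'] : E :\ e = B :|: A /\ E :\ e = D :|: C.
  by split; rewrite setUC.
have [dBA dDC] : [disjoint B & A] /\ [disjoint D & C] by split; rewrite disjoint_sym.
apply: contraT => /negPf nsE.
have K1 := key A B C D A0 eAB eCD dAB dCD.
have K2 := key B A D C B0 eAB' eCD' dBA dDC.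
have K3 := key A B D C A0 eAB eCD' dAB dDC.
have K4 := key B A C D B0 eAB' eCD dBA dCD.
rewrite nsE !orbF in K1 K2 K3 K4.
have hdel := rankS R (subD1set E e).
have S1 := subm A C; have S2 := subm B D.
have S3 := subm A D; have S4 := subm B C.
(* Since [r A + r B] is r E and [r (e |: C) + r (e |: D)] is r E + 1, the four uncrossed ranks add
   up to at most 2 r E + 1, whereas two opposite nonempty cells would require 2 r E + 2. *)
have cAC : A :&: C != set0 -> B :&: D != set0 -> False.
  by move=> /K1 k1 /K2 k2; clear -k1 k2 S1 S2 hC hD hE h1 h hdel rAB rCD; lia.
have cAD : A :&: D != set0 -> B :&: C != set0 -> False.
  by move=> /K3 k3 /K4 k4; clear -k3 k4 S3 S4 hC hD hE h1 h hdel rAB rCD; lia.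
have sAC : A \subset C :|: D by rewrite -eCD eAB subsetUl.
have sBC : B \subset C :|: D by rewrite -eCD eAB subsetUr.
have sCA : C \subset A :|: B by rewrite -eAB eCD subsetUl.
have sDA : D \subset A :|: B by rewrite -eAB eCD subsetUr.
(* An empty cell makes both cells of the other diagonal nonempty. *)
have nz (X Y Z : {set T}) : X != set0 -> X \subset Y :|: Z -> X :&: Y = set0 -> X :&: Z != set0.
  move=> X0 sX XC; apply: contra X0 => /eqP XD.
  by rewrite -(setIidPl sX) setIUr XC XD setU0.
have [AC|AC] := eqVneq (A :&: C) set0.
  have AD := nz _ _ _ A0 sAC AC.
  have CB : C :&: B != set0 by apply: nz C0 sCA _; rewrite setIC.
  by case: cAD => //; rewrite setIC.
have [BD|BD] := eqVneq (B :&: D) set0; last by case: cAC.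
have BC : B :&: C != set0 by apply: nz B0 _ BD; rewrite setUC.
have AD : D :&: A != set0 by apply: (nz _ B) D0 _ _; rewrite 1?setUC // setIC.
by case: cAD => //; rewrite setIC.
Qed.

End RankFunctions.

(** * The polynomial T(X, 0) *)

Lemma sum_subsetsD1 (V : nmodType) (T : finType) (E : {set T}) (e : T) (F : {set T} -> V) :
  e \in E ->
  \sum_(S : {set T} | S \subset E) F S
    = \sum_(S : {set T} | S \subset E :\ e) (F S + F (e |: S)).
Proof.
move=> eE; rewrite big_split /= (bigID (fun S : {set T} => e \in S)) /= addrC.
congr (_ + _).
  by apply: eq_bigl => S; rewrite subsetD1.
rewrite (reindex_onto (fun S : {set T} => e |: S) (fun S : {set T} => S :\ e)) /=.
  apply: eq_bigl => S; rewrite setU11 andbT subUset sub1set eE /= subsetD1.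
  have [eS|eS] := boolP (e \in S).
    by rewrite andbF; apply/negbTE; rewrite negb_and; apply/orP; right;
       apply: contraL eS => /eqP <-; rewrite !inE eqxx.
  by rewrite setU1K // eqxx.
by move=> S /andP[_ eS]; rewrite setD1K.
Qed.

Lemma sum_subsetsU (V : nmodType) (T : finType) (A B : {set T}) (F : {set T} -> V) :
  [disjoint A & B] ->
  \sum_(S : {set T} | S \subset A :|: B) F S
    = \sum_(S1 : {set T} | S1 \subset A) \sum_(S2 : {set T} | S2 \subset B) F (S1 :|: S2).
Proof.
move=> dAB; rewrite pair_big /=.
rewrite (reindex_onto (fun p : {set T} * {set T} => p.1 :|: p.2)
          (fun S => (S :&: A, S :&: B))) /=; last first.
  by move=> S sS; rewrite -setIUr (setIidPl sS).
apply: eq_bigl => -[S1 S2] /=.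
apply/andP/andP => [[sS /eqP [<- <-]]|[s1 s2]]; first by rewrite !subsetIr.
split; first by rewrite setUSS.
have -> : (S1 :|: S2) :&: A = S1 by finset.
by have -> : (S1 :|: S2) :&: B = S2 by finset.
Qed.

Section CharPoly.

Variable T : finType.
Implicit Types (r : {set T} -> nat) (A B E S : {set T}) (e f g : T).

Local Notation y := ('X - 1 : {poly int}).

(** This is T(X, 0) / X, whatever e is: the terms of S and [e |: S] cancel when S spans e, and
    otherwise add up to a multiple of (X - 1) + 1. *)
Definition reduced_char_poly r E e : {poly int} :=
  \sum_(S : {set T} | (S \subset E :\ e) && (r (e |: S) != r S))
     (-1) ^+ (#|S| + r S) * y ^+ (r E - (r S).+1).

Lemma char_poly0_reduced r E e : rank_fun r -> e \in E ->
  char_poly0 r E = 'X * reduced_char_poly r E e.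
Proof.
move=> R eE; rewrite /char_poly0 (sum_subsetsD1 _ eE) /reduced_char_poly.
rewrite (bigID (fun S => r (e |: S) == r S)) /= big1 ?add0r.
  rewrite big_distrr /=; apply: eq_bigr => S /andP[sS neq].
  have eS : e \notin S by move: sS; rewrite subsetD1 => /andP[].
  have rS : r (e |: S) = (r S).+1.
    by have := rankU1_le R e S; have := rankS R (subsetUr [set e] S); lia.
  have rE : (r S < r E)%N.
    by rewrite -rS; apply: (rankS R); rewrite subUset sub1set eE (subset_trans sS) ?subD1set.
  rewrite cardsU1 eS rS -(subnSK rE) /= add1n addSn addnS.
  by rewrite !exprS; ring.
move=> S /andP[sS /eqP ->].
have eS : e \notin S by move: sS; rewrite subsetD1 => /andP[].
by rewrite cardsU1 eS add1n addSn exprS mulN1r mulNr subrr.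
Qed.

Lemma char_poly0_set0 r : rank_fun r -> char_poly0 r set0 = 1.
Proof.
move=> R; rewrite /char_poly0 (big_pred1 set0) => [|S]; last by rewrite subset0.
by rewrite (rank0 R) subnn cards0 mulr1 expr0.
Qed.

Lemma char_poly0_loop r E e : rank_fun r -> e \in E -> r [set e] = 0%N ->
  char_poly0 r E = 0.
Proof.
move=> R eE e0; rewrite (char_poly0_reduced R eE) /reduced_char_poly big1 ?mulr0 // => S.
case/andP => _; have := rankU_le [set e] S R; have := rankS R (subsetUr [set e] S).
by rewrite e0; lia.
Qed.

Lemma char_poly0_set1 r e : rank_fun r -> r [set e] = 1%N -> char_poly0 r [set e] = 'X.
Proof.
move=> R e1; rewrite (char_poly0_reduced R (set11 e)) /reduced_char_poly.
rewrite (big_pred1 set0) => [|S].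
  by rewrite (rank0 R) e1 cards0 !mulr1.
rewrite setDv subset0 /=; have [->|//] := eqVneq S set0.
by rewrite setU0 e1 (rank0 R).
Qed.

Lemma char_poly0_del_contract r E e : rank_fun r -> e \in E -> r [set e] = 1%N ->
  r (E :\ e) = r E ->
  char_poly0 r E = char_poly0 r (E :\ e) + char_poly0 (contract r e) (E :\ e).
Proof.
move=> R eE e1 rE; rewrite /char_poly0 (sum_subsetsD1 _ eE) big_split rE /=.
congr (_ + _); apply: eq_bigr => S sS.
have eS : e \notin S by move: sS; rewrite subsetD1 => /andP[].
rewrite cardsU1 eS add1n.
have := contractE e S R; have := contractE e (E :\ e) R; rewrite setD1K // e1 !addn1 => <- <-.
by rewrite subSS addSn addnS !exprS; ring.
Qed.

Lemma char_poly0_dsum r A B : rank_fun r -> [disjoint A & B] ->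
  (r A + r B <= r (A :|: B))%N ->
  char_poly0 r (A :|: B) = char_poly0 r A * char_poly0 r B.
Proof.
move=> R dAB rAB; rewrite /char_poly0 (sum_subsetsU _ dAB) big_distrl /=.
apply: eq_bigr => S1 s1; rewrite big_distrr /=; apply: eq_bigr => S2 s2.
have -> : #|S1 :|: S2| = (#|S1| + #|S2|)%N.
  rewrite cardsU; have -> : S1 :&: S2 = set0 by finset.
  by rewrite cards0 subn0.
rewrite (rank_sepU R dAB rAB s1 s2).
rewrite (rank_sepU R dAB rAB (subxx _) (subxx _)).
have -> : (r A + r B - (r S1 + r S2) = (r A - r S1) + (r B - r S2))%N.
  by have := rankS R s1; have := rankS R s2; lia.
by rewrite !exprD; ring.
Qed.

(* A parallel connection at e: S spans e iff one of its two parts does. *)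
Lemma char_poly0_parallel r A B e : rank_fun r -> A :&: B = [set e] ->
  r [set e] = 1%N -> (r A + r B <= (r (A :|: B)).+1)%N ->
  'X * char_poly0 r (A :|: B) = char_poly0 r A * char_poly0 r B.
Proof.
move=> R AB e1 rAB.
have eA : e \in A by move/setP/(_ e): AB; rewrite !inE eqxx => /andP[].
have eB : e \in B by move/setP/(_ e): AB; rewrite !inE eqxx => /andP[].
have eAB : e \in A :|: B by rewrite inE eA.
rewrite (char_poly0_reduced R eA) (char_poly0_reduced R eB) (char_poly0_reduced R eAB).
rewrite -mulrA; congr (_ * _); rewrite mulrCA; congr (_ * _); rewrite /reduced_char_poly.
have EE : (A :|: B) :\ e = (A :\ e) :|: (B :\ e) by finset.
have dAB : [disjoint A :\ e & B :\ e].
  rewrite disjoint_subset; apply/subsetP=> z; move/setP/(_ z): AB; rewrite !inE.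
  by case: eqP => //= _; case: (z \in A) => //= ->.
have cE S := contractE e S R.
(* Contracting the base point turns the parallel connection into a direct sum, which makes the ranks
   of [e |: S] additive. *)
have rABc : (contract r e (A :\ e) + contract r e (B :\ e)
     <= contract r e ((A :\ e) :|: (B :\ e)))%N.
  have := cE (A :\ e); have := cE (B :\ e); have := cE ((A :\ e) :|: (B :\ e)).
  by rewrite -EE !setD1K // e1; lia.
rewrite EE big_mkcondr /= (sum_subsetsU _ dAB) [in RHS]big_mkcondr big_distrl /=.
apply: eq_bigr => S1 s1; rewrite [in RHS]big_mkcondr big_distrr /=; apply: eq_bigr => S2 s2.
have rAB' : (r (A :|: B)).+1 = (r A + r B)%N.
  have := rank_submod R A B; rewrite AB e1; lia.
have cU := rank_sepU (contract_rank e R) dAB rABc s1 s2.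
have h := cE (S1 :|: S2); have h1 := cE S1; have h2 := cE S2.
rewrite e1 in h h1 h2.
have u1 := rankU1_le R e S1; have u2 := rankU1_le R e S2; have u := rankU1_le R e (S1 :|: S2).
have v1 := rankS R (subsetUr [set e] S1); have v2 := rankS R (subsetUr [set e] S2).
have v := rankS R (subsetUr [set e] (S1 :|: S2)).
have w := rankU_le S1 S2 R.
have [eq1|ne1] := eqVneq (r (e |: S1)) (r S1).
  rewrite mul0r; have [//|] := eqVneq (r (e |: (S1 :|: S2))) (r (S1 :|: S2)).
  have := @rank_submod_sub _ r (e |: S1) (S1 :|: S2) (e |: (S1 :|: S2)) S1 R.
  have -> : e |: (S1 :|: S2) \subset e |: S1 :|: (S1 :|: S2) by finset.
  have -> : S1 \subset (e |: S1) :&: (S1 :|: S2) by finset.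
  by move/(_ isT isT); lia.
have [eq2|ne2] := eqVneq (r (e |: S2)) (r S2).
  rewrite mulr0; have [//|] := eqVneq (r (e |: (S1 :|: S2))) (r (S1 :|: S2)).
  have := @rank_submod_sub _ r (e |: S2) (S1 :|: S2) (e |: (S1 :|: S2)) S2 R.
  have -> : e |: (S1 :|: S2) \subset e |: S2 :|: (S1 :|: S2) by finset.
  have -> : S2 \subset (e |: S2) :&: (S1 :|: S2) by finset.
  by move/(_ isT isT); lia.
have rS : r (S1 :|: S2) = (r S1 + r S2)%N by lia.
have -> /= : r (e |: (S1 :|: S2)) != r (S1 :|: S2) by lia.
have -> : #|S1 :|: S2| = (#|S1| + #|S2|)%N.
  rewrite cardsU; have -> : S1 :&: S2 = set0 by clear -s1 s2 dAB; finset.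
  by rewrite cards0 subn0.
have l1 : (r (e |: S1) <= r A)%N by apply: (rankS R); clear -s1 eA; finset.
have l2 : (r (e |: S2) <= r B)%N by apply: (rankS R); clear -s2 eB; finset.
have -> : (r (A :|: B) - (r (S1 :|: S2)).+1 = (r A - (r S1).+1) + (r B - (r S2).+1))%N.
  by lia.
by rewrite rS !exprD; ring.
Qed.

End CharPoly.

(** * The beta invariant and the coefficient next to it *)

Section Beta.

Variable T : finType.
Implicit Types (r : {set T} -> nat) (A B E S : {set T}) (e f g x : T).

(* When E is connected, beta = h_s (Crapo's invariant) and gamma = h_(s-1). *)
Definition beta r E : int := (char_poly0 r E)`_1.
Definition gamma r E : int := (char_poly0 r E)`_2.

Lemma coef1M (R : nzSemiRingType) (p q : {poly R}) :
  (p * q)`_1 = p`_0 * q`_1 + p`_1 * q`_0.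
Proof. by rewrite coefM !big_ord_recl big_ord0 addr0. Qed.

Lemma char_poly0_divX r E : rank_fun r -> E != set0 ->
  exists p, [/\ char_poly0 r E = 'X * p, beta r E = p`_0 & gamma r E = p`_1].
Proof.
move=> R /set0Pn[e eE]; exists (reduced_char_poly r E e).
by rewrite /beta /gamma (char_poly0_reduced R eE) !coefXM.
Qed.

(** Each factor is divisible by X, so the product starts in degree 2, with the product of the two
    linear coefficients. *)
Lemma beta_gamma_dsum r A B : rank_fun r -> A != set0 -> B != set0 ->
  [disjoint A & B] -> (r A + r B <= r (A :|: B))%N ->
  beta r (A :|: B) = 0 /\ gamma r (A :|: B) = beta r A * beta r B.
Proof.
move=> R A0 B0 dAB rAB; rewrite /beta /gamma (char_poly0_dsum R dAB rAB).
have [p [-> _ _]] := char_poly0_divX R A0; have [q [-> _ _]] := char_poly0_divX R B0.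
by rewrite -mulrA !coefXM /= mulrCA !coefXM /= coef0M.
Qed.

Lemma beta_separated r E : rank_fun r -> separated r E -> beta r E = 0.
Proof.
move=> R /separatedP [A [B [A0 B0 dAB -> rAB]]].
by case: (beta_gamma_dsum R A0 B0 dAB); rewrite ?rAB.
Qed.

Lemma beta_gamma_parallel r A B e : rank_fun r -> A :&: B = [set e] ->
  r [set e] = 1%N -> (r A + r B <= (r (A :|: B)).+1)%N ->
  beta r (A :|: B) = beta r A * beta r B /\
  gamma r (A :|: B) = beta r A * gamma r B + gamma r A * beta r B.
Proof.
move=> R AB e1 rAB.
have A0 : A != set0 by apply: contra_eq_neq AB => ->; rewrite set0I eq_sym -cards_eq0 cards1.
have B0 : B != set0 by apply: contra_eq_neq AB => ->; rewrite setI0 eq_sym -cards_eq0 cards1.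
have AB0 : A :|: B != set0 by rewrite setU_eq0 negb_and A0.
have := char_poly0_parallel R AB e1 rAB.
have [p [-> -> ->]] := char_poly0_divX R A0; have [q [-> -> ->]] := char_poly0_divX R B0.
have [s [-> -> ->]] := char_poly0_divX R AB0.
rewrite -[RHS]mulrA [p * _]mulrCA.
do 2 move/(mulfI (negbT (polyX_eq0 _))).
by move=> ->; rewrite coef0M coef1M.
Qed.

Lemma conn_not_loop_coloop r E e : rank_fun r -> e \in E -> (1 < #|E|)%N ->
  ~~ separated r E -> r [set e] = 1%N /\ r (E :\ e) = r E.
Proof.
move=> R eE E2 /negP nsE.
have Ee0 : E :\ e != set0 by rewrite -card_gt0; move: E2; rewrite (cardsD1 e) eE; lia.
have e0 : [set e] != set0 by rewrite -cards_eq0 cards1.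
have d : [disjoint [set e] & E :\ e] by rewrite disjoints1 !inE eqxx.
have key : ~ (r [set e] + r (E :\ e) <= r E)%N.
  move=> le; apply: nsE; rewrite -(setD1K eE).
  by apply: separatedI => //; rewrite setD1K.
have := rankS R (subD1set E e); have := rank1_le e R.
split.
  have [|h] := eqVneq (r [set e]) 0%N; last by lia.
  by move=> h; case: key; lia.
by have [|h] := eqVneq (r (E :\ e)) (r E); lia.
Qed.

(** Beta is additive under deletion and contraction, and one of the two minors of a connected
    matroid is connected. *)
Lemma beta_ge0_ge1 r E : rank_fun r ->
  0 <= beta r E /\ (~~ separated r E -> (0 < r E)%N -> 1 <= beta r E).
Proof.
have [n] := ubnP #|E|; elim: n r E => // n IH r E ltE R.
have [->|/set0Pn [e eE]] := eqVneq E set0.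
  by rewrite (rank0 R) /beta (char_poly0_set0 R) coef1.
have [E1|E2] := leqP #|E| 1.
  have -> : E = [set e].
    by apply/eqP; rewrite eq_sym eqEcard sub1set eE cards1.
  have [e0|e1] := eqVneq (r [set e]) 0%N.
    by rewrite e0 /beta (char_poly0_loop R (set11 e)) // coef0.
  rewrite /beta (char_poly0_set1 R) ?coefX //.
  by have := rank1_le e R; lia.
have [sE|nsE] := boolP (separated r E).
  by rewrite (beta_separated R sE).
have [e1 rE] := conn_not_loop_coloop R eE E2 nsE.
have cE : (#|E :\ e| < n)%N by rewrite (cardsD1 e) eE in ltE; lia.
have [d0 d1] := IH _ _ cE R; have [c0 c1] := IH _ _ cE (contract_rank e R).
have -> : beta r E = beta r (E :\ e) + beta (contract r e) (E :\ e).
  by rewrite /beta (char_poly0_del_contract R eE e1 rE) coefD.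
split=> [|_ rE0]; first exact: addr_ge0.
have [ns|ns] := conn_del_or_contract R eE nsE.
  by have := d1 ns; rewrite rE => /(_ rE0); lia.
(* When the contraction has rank 0, every partition separates it; as it is not separated, the
   deletion has no separation either and supplies the bound. *)
have [h|h] := posnP (contract r e (E :\ e)); last by have := c1 ns h; lia.
have := d1; rewrite rE => /(_ _ rE0); suff -> : ~~ separated r (E :\ e) by move/(_ isT); lia.
apply: contra ns => /separatedP [A [B [A0 B0 dAB EE rAB]]].
apply/separatedP; exists A, B; split=> //.
have := rankS (contract_rank e R) (subsetUl A B); rewrite -EE h.
by have := rankS (contract_rank e R) (subsetUr A B); rewrite -EE h; lia.
Qed.

Lemma beta_ge0 r E : rank_fun r -> 0 <= beta r E.
Proof. by move=> R; case: (beta_ge0_ge1 E R). Qed.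

Lemma conn_beta r E : rank_fun r -> ~~ separated r E -> (0 < r E)%N -> 1 <= beta r E.
Proof. by move=> R; case: (beta_ge0_ge1 E R). Qed.

Lemma conn_rank_gt0 r E : rank_fun r -> ~~ separated r E -> (1 < #|E|)%N -> (0 < r E)%N.
Proof.
move=> R nsE E2; have /set0Pn [e eE] : E != set0 by rewrite -card_gt0; lia.
have [e1 _] := conn_not_loop_coloop R eE E2 nsE.
by rewrite -e1; apply: (rankS R); rewrite sub1set.
Qed.

(** Contracting g turns f into a loop, so the contraction contributes 0. *)
Lemma char_poly0_parallel_elt r E f g : rank_fun r -> f \in E -> g \in E -> f != g ->
  r [set f] = 1%N -> r [set g] = 1%N -> r [set f; g] = 1%N ->
  char_poly0 r E = char_poly0 r (E :\ g).
Proof.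
move=> R fE gE fg f1 g1 fg1.
have fEg : f \in E :\ g by rewrite !inE fg.
rewrite (char_poly0_del_contract R gE g1).
  rewrite (char_poly0_loop (contract_rank g R) fEg) ?addr0 //.
  by rewrite /contract setUC fg1 g1.
apply/eqP; rewrite eqn_leq (rankS R (subD1set _ _)) /=.
have := @rank_submod_sub _ r (E :\ g) [set f; g] E [set f] R.
have -> : E \subset (E :\ g) :|: [set f; g] by clear; finset.
have -> : [set f] \subset (E :\ g) :&: [set f; g].
  by rewrite subsetI !sub1set fEg !inE eqxx.
by rewrite f1 fg1 => /(_ isT isT); lia.
Qed.

End Beta.

(** * The inequality h_(s-1) >= h_1 and the case of equality *)

Section Extremal.

Variable T : finType.
Implicit Types (r : {set T} -> nat) (A B E N S X Y : {set T}) (e f g x : T).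

Lemma simple_rank1 r E x : simple_rank r E -> x \in E -> r [set x] = 1%N.
Proof. by move=> sE xE; have := sE x x xE xE; rewrite setUid eqxx. Qed.

Lemma simple_rank2 r E x y : simple_rank r E -> x \in E -> y \in E -> x != y ->
  r [set x; y] = 2%N.
Proof. by move=> sE xE yE xy; rewrite (sE x y xE yE) xy. Qed.

Lemma simple_rankS r A B : A \subset B -> simple_rank r B -> simple_rank r A.
Proof. by move=> /subsetP sAB sB x y xA yA; apply: sB; apply: sAB. Qed.

(** Adding e back raises each of the three contracted ranks by one, whence the total r(E) + 1. The
    bounds on sizes permit induction on both parts. *)
Lemma contract_separated_split r E e : rank_fun r -> e \in E -> r [set e] = 1%N ->
  separated (contract r e) (E :\ e) ->
  exists A B, [/\ A :&: B = [set e], A :|: B = E, r A + r B = (r E).+1,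
                  1 < #|A| < #|E| & 1 < #|B| < #|E|]%N.
Proof.
move=> R eE e1 /separatedP[A [B [A0 B0 dAB EAB rAB]]].
have eA : e \notin A by have := setD11 e E; rewrite EAB inE => /negbT; rewrite negb_or => /andP[].
have eB : e \notin B by have := setD11 e E; rewrite EAB inE => /negbT; rewrite negb_or => /andP[].
have cE : #|E| = (1 + (#|A| + #|B|))%N.
  by rewrite (cardsD1 e) eE EAB cardsU_disjoint.
rewrite -!card_gt0 in A0 B0.
exists (e |: A), (e |: B); split.
- by clear -eA eB dAB; finset.
- by rewrite -setUUr -EAB setD1K.
- have := contractE e A R; have := contractE e B R; have := contractE e (E :\ e) R.
  by rewrite setD1K // e1; rlia.
- by rewrite cardsU1 eA cE; rlia.
- by rewrite cardsU1 eB cE; rlia.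
Qed.

(** An element spanned by one side of a separation of its deletion can join that side. In a
    connected matroid this keeps e out of the span of either side. *)
Lemma spanned_separated r E e X Y : rank_fun r -> e \in E -> Y != set0 ->
  E :\ e = X :|: Y -> [disjoint X & Y] -> (r X + r Y <= r E)%N ->
  (r (e |: X) <= r X)%N -> separated r E.
Proof.
move=> R eE Y0 EXY dXY rXY rX; rewrite -(setD1K eE) EXY setUA.
apply: separatedI => //.
- by apply/set0Pn; exists e; rewrite setU11.
- have : e \notin Y by have := setD11 e E; rewrite EXY inE => /negbT; rewrite negb_or => /andP[].
  by clear -dXY; move=> eY; finset.
- by rewrite -setUA -EXY setD1K //; rlia.
Qed.

Section Triangle.

Variables (r : {set T} -> nat) (E : {set T}) (e : T) (A B : {set T}).
Hypotheses (R : rank_fun r) (sE : simple_rank r E) (eE : e \in E).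
Hypothesis nsE : ~~ separated r E.
Hypotheses (dAB : [disjoint A & B]) (EAB : E :\ e = A :|: B) (rAB : (r A + r B = r E)%N).
Hypothesis rE : r (E :\ e) = r E.

Let sAE : A \subset E.
Proof. by apply: subset_trans (subD1set E e); rewrite EAB subsetUl. Qed.

(** Otherwise the line through x and y would put e in the span of A. So a triangle through e has one
    further point on each side. *)
Lemma triangle_split x y : B != set0 -> x \in A -> y \in A -> x != y ->
  r (e |: [set x; y]) != 2%N.
Proof.
move=> B0 xA yA xy; apply/eqP => r2; case/negP: nsE.
apply: spanned_separated eE B0 EAB dAB _ _ => //; first by rewrite rAB.
have := @rank_submod_sub _ r A (e |: [set x; y]) (e |: A) [set x; y] R.
have -> : e |: A \subset A :|: (e |: [set x; y]) by clear; finset.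
have -> : [set x; y] \subset A :&: (e |: [set x; y]).
  by clear -xA yA; finset.
by rewrite r2 (simple_rank2 sE) ?(subsetP sAE) // => /(_ isT isT); rlia.
Qed.

(** If A split as A1 and A2 with f in A1, then A1 ∪ B would span e through f and g, and A2 would
    split off from E. *)
Lemma triangle_conn f g : f \in A -> g \in B -> r (e |: [set f; g]) = 2%N ->
  ~~ separated r A.
Proof.
move=> fA gB r2; apply: contra nsE => /separatedP [A1 [A2 [A10 A20 dA EA rA]]].
wlog fA1 : A1 A2 A10 A20 dA EA rA / f \in A1.
  move=> W; have := fA; rewrite EA inE => /orP[fA1|fA2].
    exact: (W A1 A2).
  by apply: (W A2 A1) => //; rewrite 1?disjoint_sym // 1?setUC // addnC.
have EE : E :\ e = (A1 :|: B) :|: A2 by rewrite EAB EA setUAC.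
have BE : B \subset E by apply: subset_trans (subD1set E e); rewrite EAB subsetUr.
have fE := subsetP sAE _ fA.
have gE := subsetP BE _ gB.
have fg : f != g by apply: contraTneq gB => <-; rewrite (disjointFr dAB).
apply: spanned_separated eE A20 EE _ _ _ => //.
- by have d := dAB; rewrite EA in d; clear -dA d; finset.
- by have := rankU_le A1 B R; rlia.
have := @rank_submod_sub _ r (A1 :|: B) (e |: [set f; g]) (e |: (A1 :|: B)) [set f; g] R.
have -> : e |: (A1 :|: B) \subset (A1 :|: B) :|: (e |: [set f; g]) by clear; finset.
have -> : [set f; g] \subset (A1 :|: B) :&: (e |: [set f; g]).
  by clear -fA1 gB; finset.
by rewrite r2 (simple_rank2 sE) // => /(_ isT isT); rlia.
Qed.

(** Two triangles through e span rank at most 3, or at most 2 if f = f', while directness gives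
    their points in A and B rank 4, respectively 3, when g and g' differ. *)
Lemma triangle_unique f g f' g' : f \in A -> g \in B -> f' \in A -> g' \in B ->
  r (e |: [set f; g]) = 2%N -> r (e |: [set f'; g']) = 2%N -> g' = g.
Proof.
move=> fA gB f'A g'B r2 r2'; apply/eqP; apply: contraT => gg'.
have BE : B \subset E by apply: subset_trans (subD1set E e); rewrite EAB subsetUr.
have [fE f'E] := (subsetP sAE _ fA, subsetP sAE _ f'A).
have [gE g'E] := (subsetP BE _ gB, subsetP BE _ g'B).
have le : (r A + r B <= r (A :|: B))%N.
  by rewrite -EAB rE rAB.
have hU X Y : X \subset A -> Y \subset B -> r (X :|: Y) = (r X + r Y)%N.
  exact: (rank_sepU R dAB le).
have := hU [set f; f'] [set g'; g]; rewrite !subUset !sub1set fA f'A gB g'B.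
move/(_ isT isT); rewrite (sE fE f'E) (sE g'E gE) gg'.
have ef : e != f.
  by apply: contraTneq fA => <-; have := setD11 e E; rewrite EAB inE => /negbT; rewrite negb_or => /andP[].
have := @rank_submod_sub _ r (e |: [set f; g]) (e |: [set f'; g'])
          ([set f; f'] :|: [set g'; g]) ([set e] :|: ([set f] :&: [set f'])) R.
have -> : [set f; f'] :|: [set g'; g] \subset (e |: [set f; g]) :|: (e |: [set f'; g']).
  by clear; finset.
have -> : [set e] :|: ([set f] :&: [set f']) \subset (e |: [set f; g]) :&: (e |: [set f'; g']).
  by clear; apply/subsetP => z; rewrite !inE; case: (z == e) => //= /andP[-> ->].
move/(_ isT isT); rewrite r2 r2'.
have [<-|ff'] := eqVneq f f'; first by rewrite setIid (simple_rank2 sE) //; rlia.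
by have := rankS R (subsetUl [set e] ([set f] :&: [set f'])); rewrite (simple_rank1 sE) //; rlia.
Qed.

End Triangle.
End Extremal.

Section ExtremalStep.

Variable T : finType.
Implicit Types (r : {set T} -> nat) (A B E N S X Y P Q : {set T}) (e f g x : T).

Lemma rank_le_card r A : rank_fun r -> (r A <= #|A|)%N.
Proof.
move=> R; have [n] := ubnP #|A|; elim: n A => // n IH A ltA.
have [->|/set0Pn[x xA]] := eqVneq A set0; first by rewrite (rank0 R).
have := rankU1_le R x (A :\ x); rewrite setD1K //.
have := IH (A :\ x); rewrite (cardsD1 x A) xA in ltA *.
by move/(_ ltA); rlia.
Qed.

Lemma mulz_eq1_ge0 (a b : int) : 0 <= a -> 0 <= b -> 1 = a * b -> a = 1.
Proof.
case: a b => [a|a] [b|b] // _ _; rewrite -PoszM => -[] /esym/eqP.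
by rewrite muln_eq1 => /andP[/eqP -> _].
Qed.

(* The separation of E :\ e contributes [beta r A * beta r B] to gamma, which makes
   up for the single parallel pair {f, g} that contracting e can create. *)
Lemma extremal_step r E e : rank_fun r -> simple_rank r E -> (1 < #|E|)%N -> e \in E ->
  beta r E = 1 -> ~~ separated (contract r e) (E :\ e) ->
  exists A B,
    [/\ [/\ A != set0, B != set0, [disjoint A & B], E :\ e = A :|: B & (r A + r B = r E)%N],
        r (E :\ e) = r E,
        gamma r E = beta r A * beta r B + gamma (contract r e) (E :\ e),
        beta (contract r e) (E :\ e) = 1
      & simple_rank (contract r e) (E :\ e) \/
        exists f g,
          [/\ [/\ f \in A, g \in B & r (e |: [set f; g]) = 2%N],
              simple_rank (contract r e) (E :\ e :\ g),
              char_poly0 (contract r e) (E :\ e) = char_poly0 (contract r e) (E :\ e :\ g),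
              contract r e (E :\ e :\ g) = contract r e (E :\ e)
            & ~~ separated r A /\ ~~ separated r B]].
Proof.
move=> R sE E2 eE bE nsC.
have nsE : ~~ separated r E by apply/negP => /(beta_separated R); rewrite bE.
have [e1 rE] := conn_not_loop_coloop R eE E2 nsE.
have Rc := contract_rank e R.
have qE := char_poly0_del_contract R eE e1 rE.
have cE := contractE e (E :\ e) R; rewrite setD1K // e1 in cE.
have cardE := cardsD1 e E; rewrite eE in cardE.
have /set0Pn [f0 f0E] : E :\ e != set0 by rewrite -card_gt0; rlia.
have rE2 : (1 < r E)%N.
  move: f0E; rewrite !inE => /andP[f0e f0E].
  rewrite -(simple_rank2 sE f0E eE f0e); apply: (rankS R).
  by rewrite subUset !sub1set f0E eE.
have bC1 : 1 <= beta (contract r e) (E :\ e) by apply: conn_beta => //; rlia.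
have bEE : beta r E = beta r (E :\ e) + beta (contract r e) (E :\ e).
  by rewrite /beta qE coefD.
have gEE : gamma r E = gamma r (E :\ e) + gamma (contract r e) (E :\ e).
  by rewrite /gamma qE coefD.
have bD0 := beta_ge0 (E :\ e) R.
(* The connected contraction already uses up the whole of [beta r E = 1]; a deletion with beta 0 is
   then separated. *)
have [bD bC] : beta r (E :\ e) = 0 /\ beta (contract r e) (E :\ e) = 1.
  by clear -bC1 bEE bD0 bE; lia.
have /separatedP [A [B [A0 B0 dAB EAB rAB]]] : separated r (E :\ e).
  apply: contraT => ns; have := conn_beta R ns; rewrite bD rE => /(_ (ltnW rE2)).
  by [].
have le : (r A + r B <= r (A :|: B))%N by rewrite -EAB rAB.
have [_ gD] := beta_gamma_dsum R A0 B0 dAB le.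
rewrite -EAB in gD; rewrite gD in gEE; rewrite rE in rAB.
have pairE x y : x \in E :\ e -> y \in E :\ e -> x != y ->
    (contract r e [set x; y] = 1 /\ r (e |: [set x; y]) = 2 \/ contract r e [set x; y] = 2)%N.
  move=> xE yE xy; have := contractE e [set x; y] R; rewrite e1.
  have := rankU1_le R e [set x; y]; have := rankS R (subsetUr [set e] [set x; y]).
  move: xE yE; rewrite !inE => /andP[_ xE] /andP[_ yE]; rewrite (simple_rank2 sE) //.
  by rlia.
have singE x : x \in E :\ e -> contract r e [set x] = 1%N.
  move=> xE; have := contractE e [set x] R; rewrite e1.
  move: xE; rewrite !inE => /andP[xe xE]; rewrite (simple_rank2 sE) // 1?eq_sym //; rlia.
have notAA := triangle_split R sE eE nsE dAB EAB rAB rE B0.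
have dBA : [disjoint B & A] by rewrite disjoint_sym.
have EBA : E :\ e = B :|: A by rewrite setUC.
have rBA : (r B + r A = r E)%N by rewrite addnC.
have notBB := triangle_split R sE eE nsE dBA EBA rBA rE A0.
have [tri|notri] := boolP [exists x in E :\ e, [exists y in E :\ e,
    (x != y) && (contract r e [set x; y] == 1%N)]]; last first.
  exists A, B; split=> //; left=> x y xE yE.
  have [<-|xy] := eqVneq x y; first by rewrite setUid singE.
  have [[h _]|//] := pairE x y xE yE xy.
  case/exists_inP: notri; exists x => //; apply/exists_inP; exists y => //.
  by rewrite xy h.
have [f [g [fA gB r2]]] : exists f g, [/\ f \in A, g \in B & r (e |: [set f; g]) = 2%N].
  have /exists_inP [x xE /exists_inP [y yE /andP[xy /eqP c1]]] := tri.
  have r2 : r (e |: [set x; y]) = 2%N by case: (pairE x y xE yE xy) => [[]//|]; rewrite c1.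
  move: xE yE; rewrite EAB !inE => /orP[xA|xB] /orP[yA|yB].
  - by have := notAA x y xA yA xy; rewrite r2.
  - by exists x, y.
  - by exists y, x; rewrite [[set y; x]]setUC.
  - by have := notBB x y xB yB xy; rewrite r2.
have fE : f \in E :\ e by rewrite EAB inE fA.
have gE : g \in E :\ e by rewrite EAB inE gB orbT.
have fg : f != g by apply: contraTneq gB => <-; rewrite (disjointFr dAB).
have c1 : contract r e [set f; g] = 1%N.
  by have := contractE e [set f; g] R; rewrite r2 e1; rlia.
exists A, B; split=> //; right; exists f, g; split=> //.
- move=> x y xE yE.
  move: xE yE; rewrite ![_ \in E :\ e :\ g]in_setD1 => /andP[xg xE] /andP[yg yE].
  have [<-|xy] := eqVneq x y; first by rewrite setUid singE.
  have [[_ h]|//] := pairE x y xE yE xy.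
  have uniq := triangle_unique R sE eE dAB EAB rAB rE fA gB.
  move: xE yE; rewrite EAB !inE => /orP[xA|xB] /orP[yA|yB].
  - by have := notAA x y xA yA xy; rewrite h.
  - by case/eqP: yg; apply: (uniq x y).
  - by case/eqP: xg; apply: (uniq y x) => //; rewrite [[set y; x]]setUC.
  - by have := notBB x y xB yB xy; rewrite h.
- by apply: (@char_poly0_parallel_elt _ _ _ f); rewrite ?singE.
- apply/eqP; rewrite eqn_leq (rankS Rc (subD1set _ _)) /=.
  have := @rank_submod_sub _ (contract r e) (E :\ e :\ g) [set f; g] (E :\ e) [set f] Rc.
  have -> : E :\ e \subset (E :\ e :\ g) :|: [set f; g] by clear; finset.
  have -> : [set f] \subset (E :\ e :\ g) :&: [set f; g].
    by rewrite sub1set !inE eqxx fg; move: fE; rewrite !inE => ->.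
  by rewrite c1 singE // => /(_ isT isT); rlia.
- split; first exact: (triangle_conn R sE eE nsE dAB EAB rAB rE fA gB).
  by apply: (triangle_conn R sE eE nsE dBA EBA rBA rE gB fA); rewrite [[set g; f]]setUC.
Qed.

(** As h_1 is |E| - r(E), this is h_(s-1) >= h_1. Contracting e lowers |E| and r(E) by one each; if
    g must be removed as well, the lost element is recovered from [beta r A * beta r B]. For a
    parallel connection the bounds of the two parts add up, sizes and ranks both overcounting by
    one. *)
Lemma gamma_ge r E : rank_fun r -> simple_rank r E -> beta r E = 1 ->
  (#|E|)%:Z <= gamma r E + (r E)%:Z.
Proof.
have [n] := ubnP #|E|; elim: n r E => // n IH r E ltE R sE bE.
have [E0|/set0Pn [e eE]] := eqVneq E set0.
  by move: bE; rewrite E0 /beta (char_poly0_set0 R) coef1.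
have [E1|E2] := leqP #|E| 1.
  have EE : E = [set e].
    by apply/eqP; rewrite eq_sym eqEcard sub1set eE cards1.
  have e1 : r [set e] = 1%N by apply: simple_rank1 sE eE.
  by rewrite EE e1 cards1 /gamma (char_poly0_set1 R e1) coefX.
have cardE := cardsD1 e E; rewrite eE in cardE.
have [|nsC] := boolP (separated (contract r e) (E :\ e)).
  case/(contract_separated_split R eE (simple_rank1 sE eE)) => A [B [AB EAB rAB /andP[_ cA] /andP[_ cB]]].
  have h := beta_gamma_parallel R AB (simple_rank1 sE eE).
  rewrite EAB rAB leqnn bE in h; case: (h isT) => hb hg.
  have bA := beta_ge0 A R; have bB := beta_ge0 B R.
  have bA1 := mulz_eq1_ge0 bA bB hb.
  have bB1 : beta r B = 1 by move: hb; rewrite bA1 mul1r.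
  have sA : A \subset E by rewrite -EAB subsetUl.
  have sB : B \subset E by rewrite -EAB subsetUr.
  have ltA : (#|A| < n)%N by rlia.
  have ltB : (#|B| < n)%N by rlia.
  have := IH r A ltA R (simple_rankS sA sE) bA1.
  have := IH r B ltB R (simple_rankS sB sE) bB1.
  have : (#|A| + #|B| = #|E| + 1)%N by rewrite -cardsUI EAB AB cards1.
  by rewrite hg bA1 bB1; clear -rAB; lia.
have Rc := contract_rank e R.
have [A [B [[A0 B0 dAB EAB rAB] rE gE bC cases]]] := extremal_step R sE E2 eE bE nsC.
have crE := contractE e (E :\ e) R; rewrite setD1K // (simple_rank1 sE eE) in crE.
case: cases => [sC|[f [g [[fA gB r2] sN qN rN [nsA nsB]]]]].
  have := IH _ (E :\ e) _ Rc sC bC; rewrite gE.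
  have := mulr_ge0 (beta_ge0 A R) (beta_ge0 B R).
  by move: (beta r A * beta r B) => z; clear -cardE ltE crE; lia.
have cardN := cardsD1 g (E :\ e).
have gE' : g \in E :\ e by rewrite EAB inE gB orbT.
rewrite gE' in cardN.
have bN : beta (contract r e) (E :\ e :\ g) = 1 by rewrite /beta -qN.
have gN : gamma (contract r e) (E :\ e) = gamma (contract r e) (E :\ e :\ g) by rewrite /gamma qN.
have pos X x : X \subset E -> ~~ separated r X -> x \in X -> 1 <= beta r X.
  move=> sX nsX xX; apply: conn_beta => //.
  by rewrite -(simple_rank1 sE (subsetP sX x xX)); apply: (rankS R); rewrite sub1set.
have sAE : A \subset E by apply: subset_trans (subD1set E e); rewrite EAB subsetUl.
have sBE : B \subset E by apply: subset_trans (subD1set E e); rewrite EAB subsetUr.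
have := pos A f sAE nsA fA; have := pos B g sBE nsB gB.
have := IH _ _ _ Rc sN bN; rewrite gE gN rN.
by move: (beta r A) (beta r B) => a b; clear -cardE ltE crE cardN; nia.
Qed.

(* A triangle {e, f, g} with e and f in series: contracting g makes {e, f} a
   connected component. *)
Lemma series_triangle_separated r E e f g B : rank_fun r -> e \in E ->
  E :\ e = f |: B -> f \notin B -> g \in B -> r [set g] = 1%N ->
  r (e |: [set f; g]) = 2%N -> (r B < r E)%N -> (3 < #|E|)%N ->
  separated (contract r g) (E :\ g).
Proof.
move=> R eE EfB fB gB g1 r2 rB cE.
have gE : g \in E :\ e by rewrite EfB inE gB orbT.
have eB : e \notin B by have := setD11 e E; rewrite EfB inE => /negbT; rewrite negb_or => /andP[].
have ge : g != e by move: gE; rewrite !inE => /andP[].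
have gf : g != f by apply: contraNneq fB => <-.
have gEE : g \in E by move: gE; rewrite !inE => /andP[].
have -> : E :\ g = [set e; f] :|: (B :\ g).
  rewrite -(setD1K eE) EfB setUA; apply/setP => z; rewrite !inE.
  by case: (z =P g) => [->|//]; rewrite (negPf ge) (negPf gf).
have cB : #|E| = #|B :\ g|.+3.
  by rewrite (cardsD1 e) eE EfB cardsU1 fB (cardsD1 g B) gB.
apply: separatedI.
- by apply/set0Pn; exists e; rewrite !inE eqxx.
- by rewrite -card_gt0; rlia.
- by clear -eB fB; finset.
- exact: contract_rank.
have := contractE g [set e; f] R; have := contractE g (B :\ g) R.
have := contractE g ([set e; f] :|: (B :\ g)) R.
have -> : g |: ([set e; f] :|: B :\ g) = E.
  by rewrite -(setD1K eE) EfB setUCA setD1K // -setUA.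
have -> : g |: [set e; f] = e |: [set f; g] by clear; finset.
by rewrite setD1K // r2 g1; rlia.
Qed.

(** An independent set is the direct sum of its singletons. *)
Lemma free_conn r A f : rank_fun r -> ~~ separated r A -> f \in A ->
  (#|A| <= r A)%N -> A = [set f].
Proof.
move=> R nsA fA le; apply/eqP; rewrite eqEsubset sub1set fA andbT.
rewrite -setD_eq0; apply: contraR nsA => A0; rewrite -(setD1K fA).
apply: separatedI => //.
- by apply/set0Pn; exists f; rewrite inE.
- by rewrite disjoints1 !inE eqxx.
have := rank_le_card (A :\ f) R; have := cardsD1 f A; rewrite fA setD1K //.
by have := rank1_le f R; rlia.
Qed.

(** Contracting x inside A leaves B as a summand, so nothing else of A may remain. *)
Lemma dsum_contract_conn r A B x : rank_fun r -> [disjoint A & B] -> B != set0 ->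
  (r A + r B <= r (A :|: B))%N -> x \in A ->
  ~~ separated (contract r x) ((A :|: B) :\ x) -> A = [set x].
Proof.
move=> R dAB B0 rAB xA ns; apply/eqP; rewrite eqEsubset sub1set xA andbT.
rewrite -setD_eq0; apply: contraR ns => A0.
have xB : x \notin B by rewrite (disjointFr dAB).
have -> : (A :|: B) :\ x = (A :\ x) :|: B by clear -xB; finset.
have d : [disjoint A :\ x & B] by clear -dAB; finset.
apply: (separatedI A0 B0 d (contract_rank x R)).
have := contractE x (A :\ x) R; have := contractE x B R; have := contractE x ((A :\ x) :|: B) R.
rewrite setUA !setD1K //; have := rankU_le [set x] B R.
by rlia.
Qed.

(** Suppose all contractions of E are connected. Equality is inherited by the contraction by e,
    simplified if necessary. Whatever the induction gives there, circuit or separated contraction,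
    either E is a circuit or one side of E \ e is shown to be a single point, which leads to a
    contradiction. *)
Lemma gamma_eq r E : rank_fun r -> simple_rank r E -> beta r E = 1 -> (1 < #|E|)%N ->
  gamma r E + (r E)%:Z = (#|E|)%:Z ->
  #|E| = (r E).+1 \/ exists2 e, e \in E & separated (contract r e) (E :\ e).
Proof.
have [n] := ubnP #|E|; elim: n r E => // n IH r E ltE R sE bE E2 eqE.
have [/exists_inP [e eE sepe]|H] := boolP [exists e in E, separated (contract r e) (E :\ e)].
  by right; exists e.
have {}H x : x \in E -> ~~ separated (contract r x) (E :\ x).
  by move=> xE; apply: contra H => sx; apply/exists_inP; exists x.
have /set0Pn [e eE] : E != set0 by rewrite -card_gt0; rlia.
have cardE := cardsD1 e E; rewrite eE in cardE.
have Rc := contract_rank e R.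
have [A [B [[A0 B0 dAB EAB rAB] rE gE bC cases]]] := extremal_step R sE E2 eE bE (H e eE).
have crE := contractE e (E :\ e) R; rewrite setD1K // (simple_rank1 sE eE) in crE.
have le : (r A + r B <= r (A :|: B))%N by rewrite -EAB rAB rE.
have dBA : [disjoint B & A] by rewrite disjoint_sym.
have EBA : E :\ e = B :|: A by rewrite setUC.
have le' : (r B + r A <= r (B :|: A))%N by rewrite addnC setUC.
have cardAB := cardsU_disjoint dAB; rewrite -EAB in cardAB.
have sAE : A \subset E by apply: subset_trans (subD1set E e); rewrite EAB subsetUl.
have sBE : B \subset E by apply: subset_trans (subD1set E e); rewrite EAB subsetUr.
have A1 := A0; rewrite -card_gt0 in A1; have B1 := B0; rewrite -card_gt0 in B1.
(* Tutte's theorem applied to e in E / x, which is connected by [H]: contracting e separates it, so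
   deleting e does not. *)
have delx x : x \in E :\ e ->
    separated (contract (contract r e) x) (E :\ e :\ x) -> 
    ~~ separated (contract r x) (E :\ e :\ x).
  rewrite !inE => /andP[xe xE] sepx.
  have eEx : e \in E :\ x by rewrite !inE eq_sym xe eE.
  have EE : E :\ x :\ e = E :\ e :\ x by clear; finset.
  have [|/negP[]] := conn_del_or_contract (contract_rank x R) eEx (H x xE); first by rewrite EE.
  rewrite EE; move/separatedP: sepx => [P [Q [P0 Q0 dPQ EPQ rPQ]]].
  by apply/separatedP; exists P, Q; split; rewrite -?EPQ -?(contractC e x _ R).
have single x : x \in E :\ e ->
    separated (contract (contract r e) x) (E :\ e :\ x) ->
    A = [set x] \/ B = [set x].
  move=> xE sepx; have := delx x xE sepx; move: (xE); rewrite {1 2}EAB inE => /orP[xA|xB].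
    by move/(dsum_contract_conn R dAB B0 le xA); left.
  by rewrite setUC; move/(dsum_contract_conn R dBA A0 le' xB); right.
have bA0 := beta_ge0 A R; have bB0 := beta_ge0 B R.
case: cases => [sC|[f [g [[fA gB r2] sN qN rN [nsA nsB]]]]].
  have ineq := gamma_ge Rc sC bC.
  have bb := mulr_ge0 bA0 bB0.
  (* When the contraction is simple, a positive product would make the inequality for E strict; if
     one side is a single point, both factors turn out positive. *)
  have [bb0 eqN] : beta r A * beta r B = 0 /\
      gamma (contract r e) (E :\ e) + (contract r e (E :\ e))%:Z = (#|E :\ e|)%:Z.
    by clear -ineq bb gE eqE cardE crE; move: bb gE; move: (_ * _) => z; lia.
  have [|||[x xE sepx]] := IH _ (E :\ e) _ Rc sC bC _ eqN.
  - by rlia.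
  - by rlia.
  - by left; rlia.
  have contra_single A' B' : [disjoint A' & B'] -> E :\ e = A' :|: B' -> B' != set0 ->
      B' \subset E ->
      (r A' + r B' <= r (A' :|: B'))%N -> A' = [set x] -> beta r A' * beta r B' = 0 -> False.
    move=> d EE B'0 sB' le2 EA bb0'.
    have x1 : r [set x] = 1%N by apply: simple_rank1 sE _; move: xE; rewrite !inE => /andP[].
    have xB' : x \notin B' by rewrite (disjointFr d) // EA inE.
    have nsx := delx x xE sepx.
    have EB' : E :\ e :\ x = B' by rewrite EE EA; clear -xB'; finset.
    rewrite EB' in nsx.
    have nsB' : ~~ separated r B'.
      apply: contra nsx => /separatedP [P [Q [P0 Q0 dPQ EPQ rPQ]]].
      rewrite EPQ; apply: separatedI => //; first exact: contract_rank.
      have := contractE x P R; have := contractE x Q R; have := contractE x (P :|: Q) R.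
      have := rankU_le [set x] P R; have := rankU_le [set x] Q R.
      by rewrite -EPQ; move: le2; rewrite EA; rlia.
    have /set0Pn [b bB'] := B'0.
    have : 1 <= beta r B'.
      apply: conn_beta => //.
      rewrite -(simple_rank1 sE (subsetP sB' b bB')).
      by apply: (rankS R); rewrite sub1set.
    move: bb0'; rewrite EA {1}/beta (char_poly0_set1 R x1) coefX /= mul1r => ->.
    by [].
  have [EA|EB] := single x xE sepx.
    by case: (contra_single A B).
  by case: (contra_single B A) => //; rewrite mulrC.
have gE' : g \in E :\ e by rewrite EAB inE gB orbT.
have fE' : f \in E :\ e by rewrite EAB inE fA.
have cardN := cardsD1 g (E :\ e); rewrite gE' in cardN.
have fE : f \in E by move: fE'; rewrite !inE => /andP[].
have gE'' : g \in E by move: gE'; rewrite !inE => /andP[].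
have fg : f != g by apply: contraTneq gB => <-; rewrite (disjointFr dAB).
have bN : beta (contract r e) (E :\ e :\ g) = 1 by rewrite /beta -qN.
have gN : gamma (contract r e) (E :\ e) = gamma (contract r e) (E :\ e :\ g) by rewrite /gamma qN.
have ineq := gamma_ge Rc sN bN.
have pos X x : X \subset E -> ~~ separated r X -> x \in X -> 1 <= beta r X.
  move=> sX nsX xX; apply: conn_beta => //.
  by rewrite -(simple_rank1 sE (subsetP sX x xX)); apply: (rankS R); rewrite sub1set.
have bA := pos A f sAE nsA fA; have bB := pos B g sBE nsB gB.
have eqN : gamma (contract r e) (E :\ e :\ g) + (contract r e (E :\ e :\ g))%:Z
    = (#|E :\ e :\ g|)%:Z.
  clear -ineq bA bB gE gN eqE cardE cardN crE rN; rewrite gN in gE; rewrite rN in ineq *.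
  by move: (beta r A) (beta r B) gE bA bB => a b; nia.
have fB : f \notin B by rewrite (disjointFr dAB).
have gA : g \notin A by rewrite (disjointFl dAB).
have rA1 : (0 < r A)%N by rewrite -(simple_rank1 sE fE); apply: (rankS R); rewrite sub1set.
have rB1 : (0 < r B)%N by rewrite -(simple_rank1 sE gE''); apply: (rankS R); rewrite sub1set.
have pinchA : A = [set f] -> (3 < #|E|)%N -> separated (contract r g) (E :\ g).
  move=> EA c3; apply: (@series_triangle_separated r E e f g B) => //.
  - by rewrite EAB EA.
  - exact: simple_rank1 sE _.
  - by rlia.
have pinchB : B = [set g] -> (3 < #|E|)%N -> separated (contract r f) (E :\ f).
  move=> EB c3; apply: (@series_triangle_separated r E e g f A) => //.
  - by rewrite EBA EB.
  - exact: simple_rank1 sE _.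
  - by rewrite [[set g; f]]setUC.
  - by rlia.
have fN : f \in E :\ e :\ g by rewrite in_setD1 fg fE'.
have rNf : (0 < contract r e (E :\ e :\ g))%N.
  by rewrite -(simple_rank1 sN fN); apply: (rankS Rc); rewrite sub1set.
have N0 : (0 < #|E :\ e :\ g|)%N by rewrite card_gt0; apply/set0Pn; exists f.
(* Only f remains: E is the triangle {e, f, g}, itself a circuit. *)
have [N1|N2] := leqP #|E :\ e :\ g| 1.
  have := rank_le_card (E :\ e :\ g) Rc; left; rlia.
have ltN : (#|E :\ e :\ g| < n)%N by rlia.
have [circ|[x xN sepx]] := IH _ (E :\ e :\ g) ltN Rc sN bN N2 eqN.
(* Here |A| + |B| = r(A) + r(B) + 1, so one side is independent; being connected, it is a single
   point of the triangle, in series with e. *)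
- have lA := rank_le_card A R; have lB := rank_le_card B R.
  have c3 : (3 < #|E|)%N by rlia.
  have [hA|hB] := leqP #|A| (r A).
    by case/negP: (H g gE''); apply: pinchA => //; apply: (free_conn R nsA fA hA).
  have lB' : (#|B| <= r B)%N by rlia.
  by case/negP: (H f fE); apply: pinchB => //; apply: (free_conn R nsB gB lB').
have Rcc := contract_rank x Rc.
have xg : x != g by move: xN; rewrite in_setD1 => /andP[].
have xE' : x \in E :\ e by move: xN; rewrite in_setD1 => /andP[].
have fg1 : contract r e [set f; g] = 1%N.
  by have := contractE e [set f; g] R; rewrite r2 (simple_rank1 sE eE); rlia.
(* After contracting e, the element g is parallel to f and adds no rank where f is present or
   contracted. *)
have absorb S : f \in x |: S ->
    (contract (contract r e) x (g |: S) <= contract (contract r e) x S)%N.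
  move=> fS; have := contractE x S Rc; have := contractE x (g |: S) Rc.
  have := @rank_submod_sub _ _ (x |: S) [set f; g] (x |: (g |: S)) [set f] Rc.
  have -> : x |: (g |: S) \subset (x |: S) :|: [set f; g] by clear; finset.
  have -> : [set f] \subset (x |: S) :&: [set f; g].
    by rewrite subsetI !sub1set fS !inE eqxx.
  by rewrite fg1 (simple_rank1 sN fN) => /(_ isT isT); rlia.
have /separatedP [P [Q [P0 Q0 dPQ EPQ rPQ]]] := sepx.
(* The separation extends to g, which joins the side of f; for f = x, g is a loop and may join
   either side. *)
have sepx' : separated (contract (contract r e) x) (E :\ e :\ x).
  wlog fP : P Q P0 Q0 dPQ EPQ rPQ / f \in x |: P.
    move=> W; have [fP|fP] := boolP (f \in x |: P); first exact: (W P Q).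
    apply: (W Q P) => //; rewrite 1?disjoint_sym // 1?setUC // 1?addnC //.
    have : f \in x |: (P :|: Q) by rewrite -EPQ setD1K.
    by move: fP; rewrite !inE; case: (f == x); case: (f \in P); case: (f \in Q).
  have -> : E :\ e :\ x = (g |: P) :|: Q.
    rewrite -setUA -EPQ; apply/setP => z; rewrite !inE.
    have [->|//] := eqVneq z g.
    by rewrite eq_sym xg; move: gE'; rewrite !inE => ->.
  have gQ : g \notin Q.
    have : Q \subset E :\ e :\ g :\ x by rewrite EPQ subsetUr.
    by move/subsetP/(_ g) => h; apply/negP => /h; rewrite !inE eqxx andbF.
  apply: separatedI => //.
  - by apply/set0Pn; exists g; rewrite setU11.
  - by clear -gQ dPQ; finset.
  have := absorb P fP; have := rankS Rcc (subsetUr [set g] (P :|: Q)).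
  by rewrite setUA -EPQ -rPQ; rlia.
have c3 : (3 < #|E|)%N.
  rewrite -card_gt0 in P0; rewrite -card_gt0 in Q0.
  have := cardsU_disjoint dPQ; rewrite -EPQ.
  by have := cardsD1 x (E :\ e :\ g); rewrite xN; rlia.
have [EA|EB] := single x xE' sepx'.
  have fx : f = x by apply/eqP; rewrite -in_set1 -EA.
  by case/negP: (H g gE''); apply: pinchA => //; rewrite fx.
(* B contains g, which is different from x. *)
by case/eqP: xg; apply/eqP; rewrite eq_sym -in_set1 -EB.
Qed.

End ExtremalStep.

(** * Parallel connections *)

Section ParallelTrees.

Variable T : finType.
Implicit Types (r : {set T} -> nat) (A B C E S : {set T}) (e f g x : T).

Definition rank_circuit r C : Prop :=
  [/\ 2 < #|C|, #|C| = (r C).+1 & {in C, forall x, r (C :\ x) = r C}]%N.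

(** When [r [set e] = 1], the last equation says that A and B form a modular pair, which is what a
    parallel connection at e means for ranks. *)
Definition rank_parallel r e A B E : Prop :=
  [/\ A :&: B = [set e], A :|: B = E & r A + r B = (r E).+1]%N.

(* A rank-level version of [iterated_parallel_connection]. *)
Inductive parallel_tree r : {set T} -> Prop :=
| pt_circuit C : rank_circuit r C -> parallel_tree r C
| pt_step e A C E : parallel_tree r A -> rank_circuit r C ->
    rank_parallel r e A C E -> parallel_tree r E.

Lemma parallel_mem r e A B E : rank_parallel r e A B E -> e \in A /\ e \in B.
Proof. by case=> AB _ _; move/setP/(_ e): AB; rewrite !inE eqxx => /andP. Qed.

Lemma parallelC r e A B E : rank_parallel r e A B E -> rank_parallel r e B A E.
Proof. by case=> AB EAB rAB; split; rewrite 1?setIC 1?setUC 1?addnC. Qed.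

(** Submodularity gives one inequality at e and one at f; their sum is an equality by hypothesis, so
    both are equalities. *)
Lemma rank_parallelA r e f A B B1 C E : rank_fun r -> simple_rank r E ->
  rank_parallel r e A B E -> rank_parallel r f B1 C B -> e \in B1 ->
  rank_parallel r e A B1 (A :|: B1) /\ rank_parallel r f (A :|: B1) C E.
Proof.
move=> R sE parE parB eB1; have [eA eB] := parallel_mem parE; have [fB1 fC] := parallel_mem parB.
case: parE parB => AB EAB rAB [B1C EB rB].
have AB1 : A :&: B1 = [set e].
  apply/setP=> z; move/setP/(_ z): AB; rewrite -EB !inE.
  by have [->|_] := eqVneq z e; [rewrite eA eB1 | case: (z \in A); case: (z \in B1)].
have ABC : (A :|: B1) :&: C = [set f].
  apply/setP=> z; move/setP/(_ z): AB; move/setP/(_ z): B1C; rewrite -EB !inE.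
  have [->|_] := eqVneq z f; first by rewrite fB1 fC /= orbT.
  have [->|_] := eqVneq z e; first by rewrite eB1 eA /= => ->.
  by case: (z \in A); case: (z \in B1); case: (z \in C).
have EABC : A :|: B1 :|: C = E by rewrite -setUA EB.
have fE : f \in E by rewrite -EABC !inE fB1 orbT.
have eE : e \in E by rewrite -EABC !inE eA.
have := rank_submod R A B1; rewrite AB1 (simple_rank1 sE eE).
have := rank_submod R (A :|: B1) C; rewrite ABC EABC (simple_rank1 sE fE) => h1 h2.
by do 2 split=> //; rlia.
Qed.

(** Let C be the circuit attached last in B, to B1 at f. If e is in B1, A is merged with B1 and C
    attached afterwards. If e is in C, then C is attached to A at e first, and the result is merged
    with B1 at f. *)
Lemma parallel_tree_merge r e A B E : rank_fun r -> simple_rank r E ->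
  parallel_tree r A -> parallel_tree r B -> rank_parallel r e A B E -> parallel_tree r E.
Proof.
move=> R + + tB; elim: tB e A E => {B} [C cC|f B1 C B _ IH cC parB] e A E sE tA parE.
  exact: pt_step tA cC parE.
have [eA eB] := parallel_mem parE.
have sAE : A \subset E by case: parE => _ <- _; apply: subsetUl.
have sBE : B \subset E by case: parE => _ <- _; apply: subsetUr.
have sB1 : B1 \subset E by apply: subset_trans sBE; case: parB => _ <- _; apply: subsetUl.
have sC : C \subset E by apply: subset_trans sBE; case: parB => _ <- _; apply: subsetUr.
have [eB1|eB1] := boolP (e \in B1).
  have [p1 p2] := rank_parallelA R sE parE parB eB1.
  apply: pt_step cC p2; apply: IH p1 => //.
  by apply: simple_rankS sE; rewrite subUset sAE sB1.
have eC : e \in C.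
  by case: parB eB => _ <- _; rewrite inE (negPf eB1).
have [p1 p2] := rank_parallelA R sE parE (parallelC parB) eC.
apply: IH p2 => //; exact: pt_step tA cC p1.
Qed.

(** The inequalities of the two parts of a parallel connection add up to that of E, so equality for
    E forces it for both parts. *)
Lemma parallel_tree_extremal r E : rank_fun r -> simple_rank r E -> beta r E = 1 ->
  (1 < #|E|)%N -> gamma r E + (r E)%:Z = (#|E|)%:Z -> parallel_tree r E.
Proof.
have [n] := ubnP #|E|; elim: n r E => // n IH r E ltE R sE bE E2 eqE.
have nsE : ~~ separated r E by apply/negP => /(beta_separated R); rewrite bE.
have [circ|[e eE sepe]] := gamma_eq R sE bE E2 eqE.
  apply: pt_circuit; split=> // [|x xE]; last first.
    by case: (conn_not_loop_coloop R xE E2 nsE).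
  (* A circuit with two elements would be a parallel pair. *)
  rewrite ltnNge; apply/negP => E2'; have {}E2' : #|E| = 2%N by rlia.
  have /cards2P [x [y [xy EE]]] : #|E| == 2 by rewrite E2'.
  by move: circ; rewrite EE (simple_rank2 sE) ?EE ?inE ?eqxx ?orbT // cards2 xy.
have [A [B [AB EAB rAB /andP[cA1 cA2] /andP[cB1 cB2]]]] :=
  contract_separated_split R eE (simple_rank1 sE eE) sepe.
have h := beta_gamma_parallel R AB (simple_rank1 sE eE).
rewrite EAB rAB leqnn bE in h; case: (h isT) => hb hg.
have bA := beta_ge0 A R; have bB := beta_ge0 B R.
have bA1 := mulz_eq1_ge0 bA bB hb.
have bB1 : beta r B = 1 by move: hb; rewrite bA1 mul1r.
have sA : A \subset E by rewrite -EAB subsetUl.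
have sB : B \subset E by rewrite -EAB subsetUr.
have gA := gamma_ge R (simple_rankS sA sE) bA1.
have gB := gamma_ge R (simple_rankS sB sE) bB1.
have cAB : (#|A| + #|B| = #|E| + 1)%N by rewrite -cardsUI EAB AB cards1.
rewrite bA1 bB1 mul1r mulr1 in hg.
apply: (@parallel_tree_merge r e A B) => //.
- apply: IH => //; [by rlia | exact: simple_rankS sE |].
  by clear -gA gB cAB rAB hg eqE; lia.
- apply: IH => //; [by rlia | exact: simple_rankS sE |].
  by clear -gA gB cAB rAB hg eqE; lia.
Qed.

Lemma rank_del_eq r A E x : rank_fun r -> A \subset E -> x \in A -> r (A :\ x) = r A ->
  r (E :\ x) = r E.
Proof.
move=> R sAE xA rA; apply/eqP; rewrite eqn_leq (rankS R (subD1set _ _)) /=.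
have := @rank_submod_sub _ r A (E :\ x) E (A :\ x) R.
have -> : E \subset A :|: E :\ x by clear -xA; finset.
have -> : A :\ x \subset A :&: (E :\ x) by clear -sAE; finset.
by rewrite rA => /(_ isT isT); rlia.
Qed.

(** Serves the clause of [parallel_connection] that the base point is not a coloop. *)
Lemma parallel_tree_coloopless r E : rank_fun r -> parallel_tree r E ->
  {in E, forall x, r (E :\ x) = r E}.
Proof.
move=> R; elim=> {E} [C [_ _ //]|f A C E _ IH [_ _ cC] [AC EAC _] x].
rewrite -{1}EAC inE => /orP[xA|xC].
  by apply: (rank_del_eq R _ xA (IH x xA)); rewrite -EAC subsetUl.
by apply: (rank_del_eq R _ xC (cC x xC)); rewrite -EAC subsetUr.
Qed.

(* For an arbitrary simple matroid, c is the number of connected components. *)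
Lemma char_poly0_low_coefs r E : rank_fun r -> simple_rank r E ->
  exists c p, [/\ char_poly0 r E = 'X ^+ c * p, 1 <= p`_0
    & p`_0 = 1 -> (#|E|)%:Z <= p`_1 + (r E)%:Z].
Proof.
have [n] := ubnP #|E|; elim: n r E => // n IH r E ltE R sE.
have [->|E0] := eqVneq E set0.
  by exists 0%N, 1; rewrite (char_poly0_set0 R) !coef1 cards0 (rank0 R) expr0 mulr1.
have [/separatedP [A [B [A0 B0 dAB EAB rAB]]]|nsE] := boolP (separated r E).
  have cAB := cardsU_disjoint dAB; rewrite -card_gt0 in A0; rewrite -card_gt0 in B0.
  have sAE : A \subset E by rewrite EAB subsetUl.
  have sBE : B \subset E by rewrite EAB subsetUr.
  have ltA : (#|A| < n)%N by move: cAB; rewrite -EAB; rlia.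
  have ltB : (#|B| < n)%N by move: cAB; rewrite -EAB; rlia.
  have [c1 [p1 [q1 l1 g1]]] := IH r A ltA R (simple_rankS sAE sE).
  have [c2 [p2 [q2 l2 g2]]] := IH r B ltB R (simple_rankS sBE sE).
  exists (c1 + c2)%N; exists (p1 * p2); split.
  - rewrite EAB (char_poly0_dsum R dAB) ?q1 ?q2 -?EAB ?rAB // exprD.
    by rewrite -!mulrA [p1 * _]mulrCA.
  - by rewrite coef0M; nia.
  rewrite coef0M coef1M => h.
  have p10 : p1`_0 = 1 by apply: (mulz_eq1_ge0 _ _ (esym h)); lia.
  have p20 : p2`_0 = 1 by move: h; rewrite p10 mul1r.
  have := g1 p10; have := g2 p20; rewrite p10 p20 EAB cAB -EAB -rAB; clear; lia.
have [e eE] := set0Pn _ E0.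
have [p [qE bE gE]] := char_poly0_divX R E0.
exists 1%N, p; rewrite expr1 -bE -gE; split=> //; last exact: gamma_ge.
apply: conn_beta => //; rewrite -(simple_rank1 sE eE); apply: (rankS R).
by rewrite sub1set.
Qed.

End ParallelTrees.

Local Open Scope nat_scope.

(** * Matroids and their rank functions *)

Section MatroidRank.

Variable T : finType.
Implicit Types (M N : matroid T) (A B C E I J S X : {set T}) (e f x : T).

Definition matroid_rank M A : nat := \max_(I in indep M | I \subset A) #|I|.

Lemma matroidP M : is_matroid (ground M, indep M).
Proof. by case: M => -[E I] P. Qed.

Lemma matroid_eq M N : ground M = ground N -> indep M = indep N -> M = N.
Proof.
move=> h1 h2; apply: val_inj; rewrite /= /ground /indep in h1 h2 *.
by case: (matroid_data M) (matroid_data N) h1 h2 => a b [c d] /= -> ->.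
Qed.

Lemma indep_ground M A : A \in indep M -> A \subset ground M.
Proof. by case/and4P: (matroidP M) => /forall_inP h _ _ _ /h. Qed.

Lemma indep0 M : set0 \in indep M.
Proof. by case/and4P: (matroidP M). Qed.

Lemma indepS M A B : B \subset A -> A \in indep M -> B \in indep M.
Proof.
by case/and4P: (matroidP M) => _ _ /forall_inP h _ sBA /h /forallP/(_ B)/implyP; apply.
Qed.

Lemma indep_aug M A B : A \in indep M -> B \in indep M -> #|A| < #|B| ->
  exists2 x, x \in B :\: A & x |: A \in indep M.
Proof.
case/and4P: (matroidP M) => _ _ _ /forall_inP h /h /forall_inP h' /h' /implyP h'' /h''.
by case/exists_inP=> x xB xA; exists x.
Qed.

Lemma matroid_rank_le M A I : I \in indep M -> I \subset A -> #|I| <= matroid_rank M A.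
Proof. by move=> iI sI; apply: (@leq_bigmax_cond _ _ (fun I => #|I|)); rewrite iI. Qed.

Lemma matroid_rank_wit M A :
  exists I, [/\ I \in indep M, I \subset A & #|I| = matroid_rank M A].
Proof.
have h0 : (set0 \in indep M) && (set0 \subset A) by rewrite indep0 sub0set.
have h : 0 < #|[pred I | (I \in indep M) && (I \subset A)]| by apply/card_gt0P; exists set0.
have [I] := @eq_bigmax_cond _ [pred I | (I \in indep M) && (I \subset A)] (fun I => #|I|) h.
by rewrite inE => /andP[iI sI] eI; exists I.
Qed.

Lemma indep_extend M I A : I \in indep M -> I \subset A ->
  exists J, [/\ J \in indep M, I \subset J, J \subset A & #|J| = matroid_rank M A].
Proof.
have [n] := ubnP (matroid_rank M A - #|I|); elim: n I => // n IH I ltI iI sI.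
have := matroid_rank_le iI sI; rewrite leq_eqVlt => /orP[/eqP eI|lt].
  by exists I.
have [K [iK sK eK]] := matroid_rank_wit M A.
rewrite -eK in lt; have [x xK iI'] := indep_aug iI iK lt.
move: xK; rewrite inE => /andP[xI xK].
have [|||J [iJ sJ sJA eJ]] := IH (x |: I).
- by rewrite cardsU1 xI; rlia.
- exact: iI'.
- by rewrite subUset sub1set (subsetP sK).
by exists J; split=> //; apply: subset_trans sJ; apply: subsetUr.
Qed.

Lemma matroid_rank_fun M : rank_fun (matroid_rank M).
Proof.
have mono A B : A \subset B -> matroid_rank M A <= matroid_rank M B.
  move=> sAB; have [I [iI sI <-]] := matroid_rank_wit M A.
  by apply: matroid_rank_le => //; apply: subset_trans sAB.
split=> //.
- by have [I [_ + <-]] := matroid_rank_wit M set0; rewrite subset0 => /eqP ->; rewrite cards0.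
- move=> x A; have [I [iI sI <-]] := matroid_rank_wit M (x |: A).
  have iIx : I :\ x \in indep M by apply: indepS iI; apply: subD1set.
  have sIx : I :\ x \subset A by clear -sI; finset.
  have := matroid_rank_le iIx sIx; have := cardsD1 x I.
  by case: (x \in I) => /=; rlia.
- move=> A B; have [I [iI sI eI]] := matroid_rank_wit M (A :&: B).
  have sIU : I \subset A :|: B by clear -sI; finset.
  have [J [iJ sIJ sJ eJ]] := indep_extend iI sIU.
  have hA := matroid_rank_le (indepS (subsetIl J A) iJ) (subsetIr J A).
  have hB := matroid_rank_le (indepS (subsetIl J B) iJ) (subsetIr J B).
  have := cardsUI (J :&: A) (J :&: B).
  have -> : (J :&: A) :|: (J :&: B) = J by clear -sJ; finset.
  have : I \subset (J :&: A) :&: (J :&: B) by clear -sI sIJ; finset.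
  by move/subset_leq_card; rlia.
Qed.

Lemma indep_rank M A : (A \in indep M) = (matroid_rank M A == #|A|).
Proof.
apply/idP/eqP => [iA|rA].
  apply/eqP; rewrite eqn_leq matroid_rank_le // andbT.
  exact: rank_le_card (matroid_rank_fun M).
have [I [iI sI eI]] := matroid_rank_wit M A.
by suff <- : I = A by []; apply/eqP; rewrite eqEcard sI eI rA leqnn.
Qed.

Lemma circuitP M C :
  reflect [/\ C \subset ground M, C \notin indep M & forall x, x \in C -> C :\ x \in indep M]
          (C \in circuits M).
Proof.
rewrite inE; apply: (iffP minsetP) => [[/andP[sC nC] minC]|[sC nC minC]].
  split=> // x xC; apply: contraT => nCx.
  have : C :\ x = C.
    apply: minC; last exact: subD1set.
    by rewrite nCx andbT (subset_trans (subD1set _ _)).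
  by move/setP/(_ x); rewrite !inE eqxx xC.
split; first by rewrite sC.
move=> B /andP[_ nB] sB; apply/eqP; rewrite eqEsubset sB /=.
apply/subsetP=> x xC; apply: contraT => xB; case/negP: nB.
by apply: indepS (minC x xC); rewrite subsetD1 sB.
Qed.

Lemma circuit_ground M C : C \in circuits M -> C \subset ground M.
Proof. by case/circuitP. Qed.

Lemma dependent_circuit M A : A \subset ground M -> A \notin indep M ->
  exists2 C, C \in circuits M & C \subset A.
Proof.
move=> sA nA.
have [|C minC sC] := @minset_exists _ (fun A => (A \subset ground M) && (A \notin indep M)) A.
  by rewrite sA.
by exists C; rewrite // inE.
Qed.

Lemma circuit_neq0 M C : C \in circuits M -> C != set0.
Proof. by case/circuitP => _ nC _; apply: contraNneq nC => ->; apply: indep0. Qed.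

Lemma rank_circuitE M C : C \in circuits M -> #|C| = (matroid_rank M C).+1.
Proof.
move=> cC; have /set0Pn[x xC] := circuit_neq0 cC.
case/circuitP: cC => sC nC /(_ x xC); rewrite indep_rank => /eqP rCx.
have := rank_le_card C (matroid_rank_fun M); have := rankS (matroid_rank_fun M) (subD1set C x).
by move: nC; rewrite indep_rank rCx (cardsD1 x C) xC; lia.
Qed.

Lemma simple_matroid_rank M : simple_matroid M ->
  simple_rank (matroid_rank M) (ground M).
Proof.
case=> noloop nopar x y xE yE.
have sxy : [set x; y] \subset ground M by rewrite subUset !sub1set xE.
suff /eqP -> : matroid_rank M [set x; y] == #|[set x; y]| by rewrite cards2.
rewrite -indep_rank; apply: contraT => /(dependent_circuit sxy) [C cC sC].
have := subset_leq_card sC; rewrite cards2.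
have := circuit_neq0 cC; rewrite -card_gt0; have := nopar C cC.
case: (#|C| =P 1) => [/eqP /cards1P [z EC]|]; last by case: (x != y) => /=; lia.
by have := noloop z; rewrite /loop -EC cC.
Qed.

Lemma restr_subproof M A : is_matroid (A, [set I in indep M | I \subset A]).
Proof.
apply/and4P; split=> /=.
- by apply/forall_inP => I; rewrite inE => /andP[].
- by rewrite inE indep0 sub0set.
- apply/forall_inP => I; rewrite inE => /andP[iI sI].
  apply/forallP => J; apply/implyP => sJ; rewrite inE (indepS sJ iI).
  exact: subset_trans sI.
apply/forall_inP => I; rewrite inE => /andP[iI sI].
apply/forall_inP => J; rewrite inE => /andP[iJ sJ]; apply/implyP => lt.
have [x xJ ixI] := indep_aug iI iJ lt; apply/exists_inP; exists x => //.
rewrite inE ixI subUset sub1set sI andbT; apply: (subsetP sJ).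
by move: xJ; rewrite inE => /andP[].
Qed.

(** Elements of A outside the ground set of M become loops, hence the hypothesis of
    [circuits_restr]. *)
Definition restr M A : matroid T := Matroid (restr_subproof M A).

Lemma ground_restr M A : ground (restr M A) = A.
Proof. by []. Qed.

Lemma indep_restr M A I : (I \in indep (restr M A)) = (I \in indep M) && (I \subset A).
Proof. by rewrite inE. Qed.

Lemma circuits_restr M A C : A \subset ground M ->
  (C \in circuits (restr M A)) = (C \in circuits M) && (C \subset A).
Proof.
move=> sA; apply/circuitP/andP => [[sC nC mC]|[/circuitP [sC nC mC] sCA]].
  rewrite ground_restr in sC; split=> //; apply/circuitP; split.
  - exact: subset_trans sA.
  - by move: nC; rewrite indep_restr sC andbT.
  - by move=> x /mC; rewrite indep_restr => /andP[].
split; rewrite ?ground_restr ?indep_restr ?sCA ?andbT // => x xC.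
by rewrite indep_restr mC // (subset_trans (subD1set _ _)).
Qed.

Lemma rank_restr M A B : matroid_rank (restr M A) B = matroid_rank M (A :&: B).
Proof.
apply: eq_bigl => I; rewrite indep_restr subsetI.
by case: (I \in indep M); case: (I \subset A).
Qed.

Lemma coloopE M e : e \in ground M ->
  coloop M e = (matroid_rank M (ground M :\ e) != matroid_rank M (ground M)).
Proof.
have R := matroid_rank_fun M.
move=> eE; rewrite /coloop eE /=; apply/forall_inP/idP => [h|ne B].
  apply/eqP => re; have [B [iB sB eB]] := matroid_rank_wit M (ground M :\ e).
  have : e \in B.
    apply: h; rewrite inE; apply/maxsetP; split=> // C iC sBC.
    apply/eqP; rewrite eq_sym eqEcard sBC eB re.
    exact: matroid_rank_le (indep_ground iC).
  by move/(subsetP sB); rewrite !inE eqxx.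
rewrite inE => /maxsetP [iB mB]; apply: contraT => eB.
have [J [iJ sJ _ cJ]] := indep_extend iB (indep_ground iB).
have EJ : J = B by apply: mB.
case/eqP: ne; apply/eqP; rewrite eqn_leq (rankS R (subD1set _ _)) /=.
rewrite -cJ EJ; apply: matroid_rank_le => //.
by rewrite subsetD1 eB indep_ground.
Qed.

Lemma loopE M e : e \in ground M -> loop M e = (matroid_rank M [set e] == 0).
Proof.
move=> eE; have := rank1_le e (matroid_rank_fun M); rewrite /loop => le.
apply/circuitP/eqP => [[_ + _]|r0].
  by rewrite indep_rank cards1; lia.
split; rewrite ?sub1set // ?indep_rank ?cards1 ?r0 // => x; rewrite inE => /eqP ->.
by rewrite setDv indep0.
Qed.

End MatroidRank.

(** * Circuits of a parallel connection *)

Section ParallelConnection.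

Variable T : finType.
Implicit Types (M N P Q : matroid T) (A B C E I J S X : {set T}) (e f x : T).

Lemma circuit_antichain M C D : C \in circuits M -> D \in circuits M ->
  C \subset D -> C = D.
Proof.
case/circuitP=> _ nC _ /circuitP [_ _ mD] sCD; apply/eqP; rewrite eqEsubset sCD /=.
apply/subsetP=> x xD; apply: contraT => xC; case/negP: nC.
by apply: indepS (mD x xD); rewrite subsetD1 sCD.
Qed.

(** A modular pair induces one on every subset through e: [h1] is submodularity on S, while [h2] and
    [h3] carry a defect on S over to E. *)
Lemma rank_parallelS r e A B E S : rank_fun r -> r [set e] = 1 ->
  rank_parallel r e A B E -> S \subset E ->
  r (e |: (S :&: A)) + r (e |: (S :&: B)) = (r (e |: S)).+1.
Proof.
move=> R e1 par sS; have [eA eB] := parallel_mem par; case: par => AB EAB rAB.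
have h1 := @rank_submod_sub _ r (e |: (S :&: A)) (e |: (S :&: B)) (e |: S) [set e] R.
have h2 := @rank_submod_sub _ r A (e |: S) (A :|: S) (e |: (S :&: A)) R.
have h3 := @rank_submod_sub _ r (A :|: S) B E (e |: (S :&: B)) R.
move: h1 h2 h3.
have -> : e |: S \subset (e |: S :&: A) :|: (e |: S :&: B).
  by rewrite -setUUr -setIUr EAB (setIidPl sS).
have -> : [set e] \subset (e |: S :&: A) :&: (e |: S :&: B) by rewrite sub1set !inE eqxx.
have -> : A :|: S \subset A :|: (e |: S) by clear; finset.
have -> : e |: S :&: A \subset A :&: (e |: S) by clear -eA; finset.
have -> : E \subset A :|: S :|: B by rewrite setUAC EAB subsetUl.
have -> : e |: S :&: B \subset (A :|: S) :&: B by clear -eA eB; finset.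
by move=> /(_ isT isT) h1 /(_ isT isT) h2 /(_ isT isT) h3; rewrite e1 in h1; rlia.
Qed.

Lemma rank_parallel_sub r e A B E A' B' : rank_fun r -> r [set e] = 1 ->
  rank_parallel r e A B E -> A' \subset A -> B' \subset B -> e \in A' -> e \in B' ->
  rank_parallel r e A' B' (A' :|: B').
Proof.
move=> R e1 par sA sB eA' eB'.
have sS : A' :|: B' \subset E by case: par => _ <- _; apply: setUSS.
have := rank_parallelS R e1 par sS; case: par => AB _ _.
have AB' : A' :&: B' = [set e].
  by apply/eqP; rewrite eqEsubset subsetI !sub1set eA' eB' !andbT -AB setISS.
have mA z : z \in A -> z \in B' -> z \in A'.
  move=> zA zB'; have : z \in A :&: B by rewrite inE zA (subsetP sB).
  by rewrite AB inE => /eqP ->.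
have mB z : z \in B -> z \in A' -> z \in B'.
  move=> zB zA'; have : z \in A :&: B by rewrite inE zB (subsetP sA).
  by rewrite AB inE => /eqP ->.
have -> : (A' :|: B') :&: A = A'.
  apply/setP=> z; rewrite !inE; apply/andP/idP => [[/orP[//|zB'] zA]|zA'].
    exact: mA.
  by rewrite zA' (subsetP sA).
have -> : (A' :|: B') :&: B = B'.
  apply/setP=> z; rewrite !inE; apply/andP/idP => [[/orP[zA'|//] zA]|zB'].
    exact: mB.
  by rewrite zB' orbT (subsetP sB).
have h S : e \in S -> e |: S = S by move=> eS; apply/setUidPr; rewrite sub1set.
by rewrite !h // inE eA'.
Qed.

Lemma circuit_del_rank M C x : C \in circuits M -> x \in C ->
  matroid_rank M (C :\ x) = matroid_rank M C.
Proof.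
move=> cC xC; have := rank_circuitE cC; have := cardsD1 x C; rewrite xC.
by case/circuitP: cC => _ _ /(_ x xC); rewrite indep_rank => /eqP ->; rlia.
Qed.

(** S has nullity two. Deleting e leaves a dependent set, and deleting any further x keeps the rank,
    because one of the two circuits loses only x and the other is still whole when e goes. *)
Lemma circuit_parallel M e C1 C2 S : S \subset ground M -> matroid_rank M [set e] = 1 ->
  C1 \in circuits M -> C2 \in circuits M ->
  rank_parallel (matroid_rank M) e C1 C2 S -> S :\ e \in circuits M.
Proof.
move=> sS e1 c1 c2 par; have [eC1 eC2] := parallel_mem par.
have R := matroid_rank_fun M.
have card_eq : #|S| = (matroid_rank M S).+2.
  case: par => I12 <- r12; have := cardsUI C1 C2; rewrite I12 cards1.
  by have := rank_circuitE c1; have := rank_circuitE c2; rlia.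
have eS : e \in S by case: par => _ <- _; rewrite inE eC1.
have cS := cardsD1 e S; rewrite eS in cS.
apply/circuitP; split.
- exact: subset_trans (subD1set _ _) sS.
- rewrite indep_rank; have := rankS R (subD1set S e); lia.
move=> x; rewrite inE => /andP[xe xS].
have {}xe : x != e by rewrite inE in xe.
wlog xC1 : C1 C2 c1 c2 par eC1 eC2 / x \in C1.
  move=> W; have : x \in C1 :|: C2 by case: par => _ -> _.
  rewrite inE => /orP[xC1|xC2].
    exact: (W C1 C2).
  by apply: (W C2 C1) => //; apply: parallelC.
have xC2 : x \notin C2.
  by apply: contra xe => xC2; case: par => I12 _ _; rewrite -in_set1 -I12 inE xC1.
have eC1' : e \in C1 :\ x by rewrite !inE eq_sym xe.
have [_ _] := rank_parallel_sub R e1 par (subD1set C1 x) (subxx C2) eC1' eC2.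
have -> : (C1 :\ x) :|: C2 = S :\ x.
  by case: par => _ <- _; clear -xC2; finset.
rewrite (circuit_del_rank c1 xC1).
have sC2 : C2 \subset S :\ x by case: par => _ <- _; rewrite subsetD1 subsetUr.
have := rank_del_eq R sC2 eC2 (circuit_del_rank c2 eC2).
have -> : S :\ x :\ e = S :\ e :\ x by clear; finset.
have := cardsD1 x (S :\ e); rewrite !inE xe xS /=.
have := rank_circuitE c1; have := rank_circuitE c2.
case: par => I12 ES r12; have := cardsUI C1 C2; rewrite I12 ES cards1.
by rewrite indep_rank; move=> *; apply/eqP; rlia.
Qed.

(** The traces of C on A and B are independent, but adjoining e to C ∩ A creates a dependency; a
    circuit inside it must use e. *)
Lemma parallel_circuit_half M e A B E C : matroid_rank M [set e] = 1 ->
  rank_parallel (matroid_rank M) e A B E -> C \in circuits M ->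
  C \subset E -> ~~ (C \subset A) -> ~~ (C \subset B) ->
  exists C1, [/\ C1 \in circuits M, e \in C1, C1 \subset A & C1 \subset e |: C].
Proof.
move=> e1 par cC sCE nCA nCB; have R := matroid_rank_fun M.
have [eA eB] := parallel_mem par.
have indep_part X : ~~ (C \subset X) -> C :&: X \in indep M.
  case/subsetPn => x xC xX; case/circuitP: cC => _ _ /(_ x xC); apply: indepS.
  by rewrite subsetD1 subsetIl !inE (negPf xX) andbF.
have iA := indep_part A nCA; have iB := indep_part B nCB.
have rC := rank_circuitE cC.
have rS := rank_parallelS R e1 par sCE.
have [AB EAB rAB] := par.
(* If e were in C, the two independent traces, overlapping in e, would have ranks forcing r(C) =
   |C|. *)
have eC : e \notin C.
  apply: contraT; rewrite negbK => eC.
  have h S : e \in S -> e |: S = S by move=> eS; apply/setUidPr; rewrite sub1set.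
  rewrite !h ?inE ?eC ?eA ?eB // in rS.
  move: iA iB rS; rewrite !indep_rank => /eqP -> /eqP ->.
  have := cardsUI (C :&: A) (C :&: B); rewrite -setIUr EAB (setIidPl sCE).
  have -> : (C :&: A) :&: (C :&: B) = [set e].
    by rewrite setIACA setIid AB; apply/setIidPr; rewrite sub1set.
  by rewrite cards1; rlia.
have cC2 : #|C| = #|C :&: A| + #|C :&: B|.
  rewrite -cardsUI -setIUr EAB (setIidPl sCE) setIACA setIid AB.
  have -> : C :&: [set e] = set0.
    by apply/setP => z; rewrite !inE; case: (z =P e) => [->|]; rewrite ?(negPf eC) ?andbF.
  by rewrite cards0 addn0.
have sA : e |: (C :&: A) \subset ground M.
  rewrite subUset sub1set (subset_trans (subsetIl _ _) (circuit_ground cC)) andbT.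
  have [I [iI sI cI]] := matroid_rank_wit M [set e].
  have EI : I = [set e] by apply/eqP; rewrite eqEcard sI cI e1 cards1.
  by have := indep_ground iI; rewrite EI sub1set.
have dep : e |: (C :&: A) \notin indep M.
  apply/negP; rewrite indep_rank cardsU1 !inE (negPf eC) /= => /eqP rA.
  move: iB; rewrite indep_rank => /eqP rB.
  have := rankU1_le R e (C :&: B); have := rankU1_le R e C.
  have := @rank_submod_sub _ _ C (e |: (C :&: B)) (e |: C) (C :&: B) R.
  have -> : e |: C \subset C :|: (e |: C :&: B) by clear; finset.
  have -> : C :&: B \subset C :&: (e |: C :&: B) by clear; finset.
  have := rankS R (subsetUr [set e] (C :&: B)).
  by move=> h1 /(_ isT isT); rlia.
have [C1 cC1 sC1] := dependent_circuit sA dep.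
have eC1 : e \in C1.
  apply: contraT => eC1; case/circuitP: cC1 => _ /negP[]; apply: indepS iA.
  apply/subsetP=> z zC1; have := subsetP sC1 z zC1; rewrite !inE.
  by case: (z =P e) => // ze; rewrite -ze zC1 in eC1.
exists C1; split=> //; apply: subset_trans sC1 _; last by clear; finset.
by clear -eA; finset.
Qed.

(** A circuit C contained in neither part yields circuits C1 and C2 through e; the circuit (C1 ∪ C2)
    \ e lies in C and therefore equals it. *)
Lemma parallel_connection_restr M e A B E : E \subset ground M ->
  matroid_rank M [set e] = 1 -> rank_parallel (matroid_rank M) e A B E ->
  matroid_rank M (A :\ e) = matroid_rank M A ->
  matroid_rank M (B :\ e) = matroid_rank M B ->
  parallel_connection e (restr M A) (restr M B) (restr M E).
Proof.
move=> sE e1 par rA rB; have [eA eB] := parallel_mem par.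
have R := matroid_rank_fun M.
have [AB EAB rAB] := par.
have sA : A \subset E by rewrite -EAB subsetUl.
have sB : B \subset E by rewrite -EAB subsetUr.
have sAM := subset_trans sA sE; have sBM := subset_trans sB sE.
split; rewrite ?ground_restr //.
  split; rewrite ?loopE ?coloopE ?ground_restr ?rank_restr //.
  - by rewrite (setIidPr _) ?sub1set // e1.
  - by rewrite setIid (setIidPr _) ?subD1set // rA eqxx.
  - by rewrite (setIidPr _) ?sub1set // e1.
  - by rewrite setIid (setIidPr _) ?subD1set // rB eqxx.
apply/setP=> C; rewrite !in_setU !circuits_restr //.
apply/idP/idP => [/andP[cC sCE]|].
  have [sCA|nCA] := boolP (C \subset A); first by rewrite cC.
  have [sCB|nCB] := boolP (C \subset B); first by rewrite cC orbT.
  rewrite !andbF /=.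
  have [C1 [cC1 eC1 sC1A sC1C]] := parallel_circuit_half e1 par cC sCE nCA nCB.
  have [C2 [cC2 eC2 sC2B sC2C]] := parallel_circuit_half e1 (parallelC par) cC sCE nCB nCA.
  apply/imset2P; exists C1 C2; first by rewrite circuits_restr // cC1.
    by rewrite in_set circuits_restr // cC2 sC2B eC1.
  have sS : C1 :|: C2 \subset ground M by rewrite subUset !circuit_ground.
  have cS := circuit_parallel sS e1 cC1 cC2 (rank_parallel_sub R e1 par sC1A sC2B eC1 eC2).
  apply: esym; apply: (circuit_antichain cS cC).
  by clear -sC1C sC2C; finset.
case/orP=> [/orP[/andP[-> h]|/andP[-> h]]|].
- exact: subset_trans sA.
- exact: subset_trans sB.
case/imset2P=> C1 C2; rewrite circuits_restr // => /andP[cC1 sC1].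
rewrite in_set circuits_restr // => /and3P[/andP[cC2 sC2] eC1 eC2] ->.
have sS : C1 :|: C2 \subset ground M by rewrite subUset !circuit_ground.
rewrite (circuit_parallel sS e1 cC1 cC2 (rank_parallel_sub R e1 par sC1 sC2 eC1 eC2)).
by rewrite (subset_trans (subD1set _ _)) // -EAB setUSS.
Qed.

Lemma uniform_restr M C : rank_circuit (matroid_rank M) C ->
  exists2 m, 2 <= m & is_uniform m m.+1 (restr M C).
Proof.
have R := matroid_rank_fun M.
case=> c2 cC dC; exists (matroid_rank M C); first by rlia.
split=> //; apply/setP=> I; rewrite indep_restr inE ground_restr andbC.
apply: andb_id2l => sI; apply/idP/idP => [iI|le]; first exact: matroid_rank_le.
have /subsetPn [x xC xI] : ~~ (C \subset I).
  by apply/negP => /subset_leq_card; rlia.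
apply: (@indepS _ _ (C :\ x)); first by rewrite subsetD1 sI.
by rewrite indep_rank dC //; have := cardsD1 x C; rewrite xC; lia.
Qed.

Lemma parallel_tree_ipc M E : simple_rank (matroid_rank M) (ground M) ->
  E \subset ground M -> parallel_tree (matroid_rank M) E ->
  exists Ns, {in Ns, forall Q, exists2 m, 2 <= m & is_uniform m m.+1 Q} /\
    iterated_parallel_connection Ns (restr M E).
Proof.
move=> sM sE tE; have R := matroid_rank_fun M.
elim: tE sE => {E} [C cC sC|e A C E tA IH cC par sE].
  exists [:: restr M C]; split; last exact: ipc_one.
  by move=> Q; rewrite inE => /eqP ->; apply: uniform_restr.
have [eA eC] := parallel_mem par.
have [AC EAC rAC] := par.
have sA : A \subset ground M by apply: subset_trans sE; rewrite -EAC subsetUl.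
have [Ns [uNs ipcNs]] := IH sA.
exists (rcons Ns (restr M C)); split.
  move=> Q; rewrite mem_rcons inE => /orP[/eqP ->|]; last exact: uNs.
  exact: uniform_restr.
apply: (ipc_step ipcNs (e := e)); apply: parallel_connection_restr => //.
- by apply: simple_rank1 sM _; apply: (subsetP sA).
- exact: (parallel_tree_coloopless R tA eA).
- by case: cC => _ _; apply.
Qed.

End ParallelConnection.

Local Open Scope ring_scope.

(** * Broken circuits and the h-vector *)

Section Whitney.

Variable T : finType.
Implicit Types (M : matroid T) (A B C E F S X : {set T}) (lt : rel T) (e x y : T).

Lemma linear_max lt E X : linear_order_on E lt -> X \subset E -> X != set0 ->
  exists2 x, x \in X & {in X, forall y, y != x -> lt y x}.
Proof.
case=> irr tr tot /subsetP sX /set0Pn [x0 x0X].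
have [x xX maxx] := arg_maxnP (fun x => #|[set y in X | lt y x]|) x0X.
have {}xX : x \in X := xX.
exists x => // y yX yx.
have [//|nyx] := boolP (lt y x).
have xy : lt x y by have := tot y x (sX y yX) (sX x xX) yx; rewrite (negPf nyx).
have : (#|[set z in X | lt z y]| <= #|[set z in X | lt z x]|)%N := maxx y yX.
rewrite leqNgt => /negP[]; apply: proper_card.
apply/properP; split.
  apply/subsetP=> z; rewrite !inE => /andP[zX zx]; rewrite zX.
  exact: (tr x z y (sX x xX) (sX z zX) (sX y yX)).
by exists x; rewrite !inE xX ?xy // irr ?sX.
Qed.

Lemma linear_order_flip lt E : linear_order_on E lt -> linear_order_on E (fun x y => lt y x).
Proof.
case=> irr tr tot; split=> // [x y z xE yE zE h1 h2|x y xE yE xy].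
  exact: (tr x z y).
by rewrite orbC; apply: tot.
Qed.

Lemma linear_min lt E X : linear_order_on E lt -> X \subset E -> X != set0 ->
  exists2 x, x \in X & {in X, forall y, y != x -> lt x y}.
Proof. by move/linear_order_flip; apply: linear_max. Qed.

Lemma linear_asym lt E x y : linear_order_on E lt -> x \in E -> y \in E ->
  lt x y -> lt y x = false.
Proof.
case=> irr tr _ xE yE xy; apply/negbTE/negP => yx.
by have := tr y x x yE xE xE xy yx; rewrite irr.
Qed.

(** Keeps track of the minimum x removed from the circuit, by which the nonfaces are classified;
    whether x itself is in A has no influence. *)
Definition broken_at M lt A x : bool :=
  [exists C in circuits M,
     [&& x \in C, [forall y in C, (y != x) ==> lt x y] & C :\ x \subset A]].

Lemma bcc_broken_at M lt A : 
  (A \in broken_circuit_complex M lt)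
    = (A \subset ground M) && [forall x, ~~ broken_at M lt A x].
Proof.
rewrite inE; apply: andb_id2l => sA; apply/forall_inP/forallP => [h x|h B].
  apply/negP => /exists_inP [C cC /and3P[xC mx sC]].
  suff /h : C :\ x \in broken_circuits M lt by rewrite sC.
  by apply/imset2P; exists C x; rewrite // inE xC.
case/imset2P=> C x cC; rewrite inE => /andP[xC mx] ->.
by apply: contra (h x) => sC; apply/exists_inP; exists C; rewrite // xC mx.
Qed.

Lemma bcc_indep M lt A : linear_order_on (ground M) lt ->
  A \in broken_circuit_complex M lt -> A \in indep M.
Proof.
move=> L; rewrite bcc_broken_at => /andP[sA /forallP nb].
apply: contraT => /(dependent_circuit sA) [C cC sC].
have [x xC mx] := linear_min L (circuit_ground cC) (circuit_neq0 cC).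
case/negP: (nb x); apply/exists_inP; exists C; rewrite // xC.
rewrite (subset_trans (subD1set _ _) sC) andbT.
by apply/forall_inP => y yC; apply/implyP => yx; apply: mx.
Qed.

Lemma broken_at_ground M lt A x : broken_at M lt A x -> x \in ground M.
Proof. by case/exists_inP=> C /circuit_ground/subsetP sC /and3P[/sC]. Qed.

Lemma broken_at_rank M lt S x : broken_at M lt S x ->
  matroid_rank M (x |: S) = matroid_rank M S.
Proof.
have R := matroid_rank_fun M.
case/exists_inP=> C cC /and3P[xC _ sC]; apply/eqP.
rewrite eqn_leq (rankS R (subsetUr _ _)) andbT.
have := @rank_submod_sub _ _ S C (x |: S) (C :\ x) R.
have -> : x |: S \subset S :|: C by clear -xC; finset.
have -> : C :\ x \subset S :&: C by clear -sC; finset.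
by rewrite (circuit_del_rank cC xC) => /(_ isT isT); rlia.
Qed.

Definition last_broken M lt A x : bool :=
  broken_at M lt A x && [forall y, lt x y ==> ~~ broken_at M lt A y].

(** A circuit tested at x enters without x, and a circuit whose minimum y is larger than x does not
    contain x. *)
Lemma last_broken_toggle M lt S x : linear_order_on (ground M) lt ->
  last_broken M lt (x |: S) x = last_broken M lt (S :\ x) x.
Proof.
move=> L; rewrite /last_broken; congr (_ && _).
  apply: eq_existsb => C; congr (_ && _); congr (_ && _); congr (_ && _).
  by apply/idP/idP => sC; clear -sC; finset.
have [xE|xE] := boolP (x \in ground M); last first.
  have h A y : ~~ broken_at M lt A y || (y \in ground M).
    by case: (boolP (broken_at _ _ _ _)) => // /broken_at_ground ->.
  apply: eq_forallb => y; case: (lt x y) => //=; congr (~~ _).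
  apply: eq_existsb => C; have [cC|//] := boolP (C \in circuits M).
  congr (_ && _); congr (_ && _); congr (_ && _).
  have xC : x \notin C by apply: contra xE; apply: (subsetP (circuit_ground cC)).
  by apply/idP/idP => sC; clear -sC xC; finset.
apply: eq_forallb => y; have [xy|//] := boolP (lt x y); congr (~~ _).
apply: eq_existsb => C; have [cC|//] := boolP (C \in circuits M).
congr (_ && _); have [yC|//] := boolP (y \in C).
have [/forall_inP my|//] := boolP [forall z in C, (z != y) ==> lt y z].
have xC : x \notin C.
  have yE := subsetP (circuit_ground cC) y yC.
  apply/negP => xC; have := my x xC; have [xy'|xy'] /= := eqVneq x y.
    by move: xy; rewrite xy'; case: L => irr _ _; rewrite irr.
  by rewrite (linear_asym L xE yE xy).
by rewrite /=; apply/idP/idP => sC; clear -sC xC; finset.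
Qed.

(* Whitney's broken circuit theorem: the sets containing a broken circuit cancel
   when one toggles the largest x that is the minimum of a circuit C with
   C :\ x inside the set. *)
Lemma char_poly0_bcc M lt : linear_order_on (ground M) lt ->
  char_poly0 (matroid_rank M) (ground M)
    = \sum_(F in broken_circuit_complex M lt)
        ('X - 1) ^+ (matroid_rank M (ground M) - #|F|).
Proof.
move=> L; set r := matroid_rank M; set E := ground M.
pose t (A : {set T}) : {poly int} := (-1) ^+ (#|A| + r A) * ('X - 1) ^+ (r E - r A).
have cancel x : x \in E -> \sum_(A : {set T} | (A \subset E) && last_broken M lt A x) t A = 0.
  move=> xE; rewrite big_mkcondr (sum_subsetsD1 _ xE) big1 // => S sS.
  have xS : x \notin S by move: sS; rewrite subsetD1 => /andP[].
  have := last_broken_toggle S x L; rewrite (_ : S :\ x = S); last by clear -xS; finset.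
  move=> ->; case: ifP => [/andP[bS _]|_]; last by rewrite addr0.
  by rewrite /t /r (broken_at_rank bS) cardsU1 xS add1n addSn exprS mulN1r mulNr subrr.
rewrite /char_poly0 (bigID (fun A => A \in broken_circuit_complex M lt)) /=.
rewrite [X in _ + X](_ : _ = 0) ?addr0.
  apply: eq_big => [A|A /andP[_ bA]].
    by rewrite inE; case: (A \subset E).
  have := bcc_indep L bA; rewrite indep_rank -/r => /eqP ->.
  by rewrite addnn -signr_odd odd_double expr0 mul1r.
(* A nonface is counted exactly once, at the largest element where it is broken, and a face not at
   all. *)
transitivity (\sum_(A : {set T} | A \subset E) \sum_(x in E | last_broken M lt A x) t A).
  rewrite big_mkcondr; apply: eq_bigr => A sA; case: ifPn => [|/negPn bA].
    rewrite bcc_broken_at sA /= => /forallPn [x0 /negPn b0].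
    have [||x] := @linear_max lt E [set x | broken_at M lt A x] L.
    - by apply/subsetP=> x; rewrite inE => /broken_at_ground.
    - by apply/set0Pn; exists x0; rewrite inE.
    rewrite inE => bx mx; rewrite (big_pred1 x) // => y /=.
    apply/andP/eqP => [[yE /andP[byy /forallP my]]|->].
      apply/eqP; apply: contraT => yx; have := mx y; rewrite inE => /(_ byy yx) lyx.
      by have := my x; rewrite lyx bx.
    rewrite (broken_at_ground bx); split=> //; rewrite /last_broken bx /=.
    apply/forallP => z; apply/implyP => lxy; apply/negP => byy.
    have yx : z != x.
      by apply: contraTneq lxy => ->; case: L => irr _ _; rewrite irr // (broken_at_ground bx).
    have := mx z; rewrite inE => /(_ byy yx).
    by rewrite (linear_asym L (broken_at_ground bx) (broken_at_ground byy) lxy).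
  rewrite big_pred0 // => x; apply/negP => /andP[_ /andP[bx _]].
  by move: bA; rewrite bcc_broken_at => /andP[_ /forallP/(_ x)]; rewrite bx.
rewrite (exchange_big_dep (fun x => x \in E)) /=; last by move=> A x _ /andP[].
rewrite big1 // => x xE; rewrite -[RHS](cancel x xE); apply: eq_bigl => A.
by rewrite xE.
Qed.

(** A contraction may contain loops, so only nonnegativity is available for it; the strict bound
    comes from the deletion. The value at 1 detects faces of size r(E) and orders of vanishing at
    1. *)
Lemma char_poly0_at1 r E : rank_fun r ->
  0 <= (char_poly0 r E).[1] /\ ({in E, forall x, r [set x] = 1%N} -> 1 <= (char_poly0 r E).[1]).
Proof.
have [n] := ubnP #|E|; elim: n r E => // n IH r E ltE R.
have [->|/set0Pn [e eE]] := eqVneq E set0.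
  by rewrite (char_poly0_set0 R) hornerC.
have cE : (#|E :\ e| < n)%N by rewrite (cardsD1 e) eE in ltE; lia.
have [e0|e1] := eqVneq (r [set e]) 0%N.
  by rewrite (char_poly0_loop R eE e0) horner0; split=> // /(_ e eE); rewrite e0.
have {}e1 : r [set e] = 1%N by have := rank1_le e R; lia.
have [d0 d1] := IH _ _ cE R; have [c0 _] := IH _ _ cE (contract_rank e R).
have [rE|rE] := eqVneq (r (E :\ e)) (r E).
  rewrite (char_poly0_del_contract R eE e1 rE) hornerD; split; first exact: addr_ge0.
  move=> h; have : 1 <= (char_poly0 r (E :\ e)).[1].
    by apply: d1 => x; rewrite inE => /andP[_ /h].
  by move=> h'; rewrite -[1]addr0; apply: lerD.
have -> : char_poly0 r E = 'X * char_poly0 r (E :\ e).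
  rewrite -{1}(setD1K eE) (char_poly0_dsum R) ?(char_poly0_set1 R) //.
    by rewrite disjoints1 !inE eqxx.
  by rewrite setD1K // e1; have := rankS R (subD1set E e); lia.
rewrite hornerM hornerX mul1r; split=> // h.
by apply: d1 => x; rewrite inE => /andP[_ /h].
Qed.

(** If all faces had fewer than r(E) elements, every term of Whitney's sum would be divisible by X -
    1, against T(1, 0) >= 1. *)
Lemma complex_rank_bcc M lt : simple_matroid M -> linear_order_on (ground M) lt ->
  complex_rank (broken_circuit_complex M lt) = matroid_rank M (ground M).
Proof.
move=> sM L; have sR := simple_matroid_rank sM; have R := matroid_rank_fun M.
apply/eqP; rewrite eqn_leq; apply/andP; split.
  apply/bigmax_leqP => F bF; have iF := bcc_indep L bF.
  by apply: matroid_rank_le iF (indep_ground iF).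
rewrite leqNgt; apply/negP => lt_r.
have [_ /(_ _)] := char_poly0_at1 (ground M) R.
have h x : x \in ground M -> matroid_rank M [set x] = 1%N by move/(simple_rank1 sR).
move/(_ h); rewrite (char_poly0_bcc L) horner_sum big1 // => F bF.
have : (#|F| <= complex_rank (broken_circuit_complex M lt))%N.
  exact: (leq_bigmax_cond _ bF).
move=> leF; rewrite horner_exp hornerD hornerN hornerC hornerX subrr expr0n.
by rewrite subn_eq0 leqNgt (leq_ltn_trans leF lt_r).
Qed.

Lemma coef_Xsub1_exp m k : (('X - 1 : {poly int}) ^+ m)`_k = (-1) ^+ (m - k) * 'C(m, k)%:R.
Proof.
have sC a : (-1 : {poly int}) ^+ a = ((-1) ^+ a)%:P by rewrite polyC_exp polyCN.
rewrite addrC exprDn coef_sum.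
have [le_km|lt_mk] := leqP k m; last first.
  rewrite bin_small // mulr0 big1 // => i _; rewrite coefMn sC coefCM coefXn.
  by rewrite (gtn_eqF (leq_trans (ltn_ord i) lt_mk)) mulr0 mul0rn.
have lt_km : (k < m.+1)%N by [].
rewrite (bigD1 (Ordinal lt_km)) //= big1 ?addr0.
  by rewrite coefMn sC coefCM coefXn eqxx mulr1 mulr_natr.
move=> i ne; rewrite coefMn sC coefCM coefXn.
case: eqP => [ki|_]; last by rewrite mulr0 mul0rn.
by case/eqP: ne; apply: val_inj.
Qed.

Lemma h_vector_bcc M lt (n : nat) : simple_matroid M -> linear_order_on (ground M) lt ->
  h_vector (broken_circuit_complex M lt) n%:Z
    = if (n <= matroid_rank M (ground M))%N
      then (char_poly0 (matroid_rank M) (ground M))`_(matroid_rank M (ground M) - n) else 0.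
Proof.
move=> sM L; rewrite /h_vector (complex_rank_bcc sM L).
set r := matroid_rank M (ground M); case: ifP => // le_nr.
rewrite (char_poly0_bcc L) coef_sum -/r.
under eq_bigr => j _.
  rewrite (_ : (f_vector _ j)%:R =
     \sum_(F in broken_circuit_complex M lt) (if #|F| == j then 1 else 0)); last first.
    rewrite -big_mkcondr /f_vector -[LHS]sumr_const; apply: eq_bigl => F.
    by rewrite inE.
  rewrite big_distrr /=; over.
rewrite exchange_big /=; apply: eq_bigr => F bF.
have iF := bcc_indep L bF.
have le_Fr : (#|F| <= r)%N by apply: matroid_rank_le iF (indep_ground iF).
rewrite coef_Xsub1_exp; have [le_Fn|lt_nF] := leqP #|F| n; last first.
  rewrite bin_small ?mulr0; last by lia.
  rewrite big1 // => j _; case: eqP => [Fj|_]; last by rewrite mulr0.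
  by have := ltn_ord j; lia.
have lt_Fn : (#|F| < n.+1)%N by [].
rewrite (bigD1 (Ordinal lt_Fn)) //= eqxx mulr1 big1 ?addr0.
  rewrite (_ : r - #|F| - (r - n) = n - #|F|)%N; last by lia.
  rewrite -[in RHS]bin_sub; last by lia.
  by rewrite (_ : r - #|F| - (r - n) = n - #|F|)%N; last by lia.
move=> j ne; case: eqP => [Fj|_]; last by rewrite mulr0.
by case/eqP: ne; apply: val_inj.
Qed.

End Whitney.

(** * Connected components and the two ends of the h-vector *)

Section Components.

Variable T : finType.
Implicit Types (M N : matroid T) (A B C E F S X : {set T}) (lt : rel T) (e x y : T).

(** Circuits of a simple matroid have at least three elements, so broken circuits have at least
    two. *)
Lemma bcc_small M lt A : simple_matroid M -> A \subset ground M -> (#|A| <= 1)%N ->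
  A \in broken_circuit_complex M lt.
Proof.
move=> [noloop nopar] sA cA; rewrite inE sA; apply/forall_inP => B.
case/imset2P=> C x cC; rewrite inE => /andP[xC _] ->.
apply/negP => /subset_leq_card; have := cardsD1 x C; rewrite xC => cE le.
have : (0 < #|C|)%N by rewrite cE.
have := nopar C cC; case: (#|C| =P 1)%N => [/eqP /cards1P [z EC]|n1 n2 n0]; last by lia.
by have := noloop z; rewrite /loop -EC cC.
Qed.

Lemma h_vector_bcc0 M lt : simple_matroid M ->
  h_vector (broken_circuit_complex M lt) 0 = 1.
Proof.
move=> sM; rewrite /h_vector /= big_ord1 subnn bin0 expr0 !mul1r /f_vector.
rewrite (_ : [set F in _ | _] = [set set0]) ?cards1 //.
apply/setP=> F; rewrite !inE cards_eq0; case: (F =P set0) => [->|]; last by rewrite andbF.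
by have := @bcc_small M lt set0 sM (sub0set _); rewrite cards0 inE => ->.
Qed.

Lemma h_vector_bcc1 M lt : simple_matroid M -> linear_order_on (ground M) lt ->
  h_vector (broken_circuit_complex M lt) 1
    = (#|ground M|)%:Z - (matroid_rank M (ground M))%:Z.
Proof.
move=> sM L; have := h_vector_bcc0 lt sM.
rewrite -[X in h_vector _ X = _ - _]/(Posz 1) /h_vector (complex_rank_bcc sM L) /=.
rewrite big_ord1 subnn bin0 expr0 !mul1r => f0.
(* In rank 0 the entry at 1 is 0 by convention; the ground set is then empty. *)
have [r0|r_gt0] := posnP (matroid_rank M (ground M)).
  have [->|/set0Pn [x xE]] := eqVneq (ground M) set0; first by rewrite cards0 (rank0 (matroid_rank_fun M)).
  have := simple_rank1 (simple_matroid_rank sM) xE.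
  have := rankS (matroid_rank_fun M) (_ : [set x] \subset ground M).
  by rewrite sub1set => /(_ xE); lia.
rewrite !big_ord_recl big_ord0 addr0 /= subn0 bin1 f0 mulr1 expr1 mulN1r.
rewrite /bump /= addn0 subnn bin0 expr0 !mul1r addrC; congr (_ - _); last by rewrite subn0 natz.
rewrite natz; congr Posz; rewrite -(card_imset (mem (ground M)) (@set1_inj T)).
apply: eq_card => F; rewrite !inE; apply/andP/imsetP => [[/andP[sF _] /cards1P [x Fx]]|[x xE ->]].
  by exists x => //; rewrite -sub1set -Fx.
have sx : [set x] \subset ground M by rewrite sub1set.
by have := @bcc_small M lt [set x] sM sx; rewrite cards1 inE => ->.
Qed.

Lemma char_poly0_coef_gt r E k : (r E < k)%N -> (char_poly0 r E)`_k = 0.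
Proof.
move=> lt; rewrite /char_poly0 coef_sum big1 // => S sS.
have -> : (-1 : {poly int}) ^+ (#|S| + r S) = ((-1) ^+ (#|S| + r S))%:P by rewrite polyC_exp polyCN.
by rewrite coefCM coef_Xsub1_exp bin_small ?mulr0 // (leq_ltn_trans (leq_subr _ _)).
Qed.

(** The exponents are recovered as orders of vanishing at 0. *)
Lemma Xn_mul_inj (a b : nat) (p q : {poly int}) : p`_0 != 0 -> q`_0 != 0 ->
  'X ^+ a * p = 'X ^+ b * q -> p = q.
Proof.
move=> p0 q0 E; suff ab : a = b.
  by move: E; rewrite ab; apply: mulfI; rewrite expf_neq0 // polyX_eq0.
have val (n m : nat) (u v : {poly int}) : u`_0 != 0 -> 'X ^+ n * u = 'X ^+ m * v -> (m <= n)%N.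
  move=> u0 /(congr1 (fun w : {poly int} => w`_n)); rewrite !coefXnM ltnn subnn.
  by case: leqP => // _ /eqP; rewrite (negPf u0).
by apply/eqP; rewrite eqn_leq (val _ _ _ _ p0 E) (val _ _ _ _ q0 (esym E)).
Qed.

Lemma direct_sum_restr D M N : direct_sum D M -> N \in D ->
  [/\ ground N \subset ground M, N = restr M (ground N)
    & (matroid_rank M (ground N) + matroid_rank M (ground M :\: ground N)
        <= matroid_rank M (ground M))%N].
Proof.
move=> [dD gD iD] ND.
have sN : ground N \subset ground M by rewrite gD (bigcup_sup N).
split=> //.
  apply: matroid_eq => //; apply/setP => I; rewrite indep_restr.
  apply/idP/andP => [iI|[iI sI]].
    have sI := indep_ground iI; split=> //; rewrite iD (subset_trans sI) //=.
    apply/forall_inP => N' N'D; have [->|NN'] := eqVneq N' N; first by rewrite (setIidPl sI).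
    have d := dD N' N N'D ND NN'.
    have -> : I :&: ground N' = set0 by clear -sI d; finset.
    exact: indep0.
  move: iI; rewrite iD => /andP[_ /forall_inP /(_ N ND)].
  by rewrite (setIidPl sI).
have [I [iI sI <-]] := matroid_rank_wit M (ground N).
have [J [iJ sJ <-]] := matroid_rank_wit M (ground M :\: ground N).
have d : [disjoint I & J] by clear -sI sJ; finset.
rewrite -(cardsU_disjoint d); apply: matroid_rank_le; last first.
  by rewrite subUset !indep_ground.
rewrite iD subUset !indep_ground //=; apply/forall_inP => N' N'D.
have [->|NN'] := eqVneq N' N.
  have -> : (I :|: J) :&: ground N = I :&: ground N by clear -sI sJ; finset.
  by move: iI; rewrite iD => /andP[_ /forall_inP]; apply.
have d' := dD N' N N'D ND NN'.
have -> : (I :|: J) :&: ground N' = J :&: ground N' by clear -sI sJ d'; finset.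
by move: iJ; rewrite iD => /andP[_ /forall_inP]; apply.
Qed.

Lemma conn_restr M A : A \subset ground M -> connected_matroid (restr M A) ->
  ~~ separated (matroid_rank M) A.
Proof.
move=> sA conA; apply/negP => /separatedP [A1 [A2 [A10 A20 dA EA rA]]]; apply: conA.
have R := matroid_rank_fun M.
exists (restr M A1), (restr M A2); rewrite !ground_restr; split=> //.
  apply: contraNneq A10 => /(congr1 (@ground T)); rewrite !ground_restr => A12.
  by move: dA; rewrite -A12 -setI_eq0 setIid.
have dA' : [disjoint A2 & A1] by rewrite disjoint_sym.
split.
- move=> N1 N2; rewrite !inE => /orP[] /eqP -> /orP[] /eqP -> //; rewrite ?eqxx // => _.
- by rewrite big_setU1 ?big_set1 //= inE; apply: contraNneq A10 => /(congr1 (@ground T));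
    rewrite !ground_restr => A12; move: dA; rewrite -A12 -setI_eq0 setIid.
move=> S; rewrite indep_restr andbC ground_restr; apply: andb_id2l => sS.
apply/idP/forall_inP => [iS N|h].
  rewrite !inE => /orP[] /eqP ->; rewrite ground_restr indep_restr subsetIr andbT;
    by apply: indepS iS; apply: subsetIl.
have := h (restr M A1); rewrite set21 ground_restr indep_restr subsetIr andbT => /(_ isT).
have := h (restr M A2); rewrite set22 ground_restr indep_restr subsetIr andbT => /(_ isT).
have rA' : (matroid_rank M A1 + matroid_rank M A2 <= matroid_rank M (A1 :|: A2))%N.
  by rewrite -EA rA.
have sS' : S \subset A1 :|: A2 by rewrite -EA.
rewrite !indep_rank (rank_sepS R dA rA' sS') => /eqP -> /eqP ->.
have d : [disjoint S :&: A1 & S :&: A2] by clear -dA; finset.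
by rewrite -(cardsU_disjoint d) -setIUr (setIidPl sS').
Qed.

(* The lowest coefficients of the two factors q_N and q_(M \ N) satisfy the
   inequality of [char_poly0_low_coefs], hence equality in both. *)
Lemma component_parallel_tree M N c (p : {poly int}) : simple_matroid M ->
  char_poly0 (matroid_rank M) (ground M) = 'X ^+ c * p -> p`_0 = 1 ->
  p`_1 = (#|ground M|)%:Z - (matroid_rank M (ground M))%:Z ->
  connected_component M N ->
  [/\ N = restr M (ground N), ground N \subset ground M, ground N != set0
    & (1 < #|ground N|)%N -> parallel_tree (matroid_rank M) (ground N)].
Proof.
move=> sM qM p0 p1 [D [dD cD ND]].
have [sN EN rN] := direct_sum_restr dD ND; have [N0 conN] := cD N ND.
split=> // N2; rewrite EN in conN; have nsN := conn_restr sN conN.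
have R := matroid_rank_fun M; have sR := simple_matroid_rank sM.
have sRN := simple_rankS sN sR.
have sC : ground M :\: ground N \subset ground M by apply: subsetDl.
have [c' [b [qb b0 b1]]] := char_poly0_low_coefs R (simple_rankS sC sR).
have [a [qa a0 a1]] := char_poly0_divX R N0.
have bN : 1 <= beta (matroid_rank M) (ground N).
  by apply: conn_beta => //; apply: conn_rank_gt0 nsN N2.
have d : [disjoint ground N & ground M :\: ground N] by clear; finset.
have EM : ground N :|: (ground M :\: ground N) = ground M by clear -sN; finset.
have := char_poly0_dsum R d; rewrite EM => /(_ rN).
have -> : char_poly0 (matroid_rank M) (ground N) * char_poly0 (matroid_rank M) (ground M :\: ground N)
    = 'X ^+ c'.+1 * (a * b) by rewrite qa qb exprS; ring.
rewrite qM => /Xn_mul_inj; rewrite p0 coef0M => /(_ isT) E.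
have {}E : p = a * b.
  by apply: E; rewrite mulf_neq0 -?a0 //; [move: bN | move: b0]; clear; lia.
have ab0 : 1 = a`_0 * b`_0 by rewrite -coef0M -E.
have a01 : a`_0 = 1 by apply: (mulz_eq1_ge0 _ _ ab0); [rewrite -a0; move: bN | move: b0]; clear; lia.
have b01 : b`_0 = 1 by move: ab0; rewrite a01 mul1r.
have := p1; rewrite E coef1M a01 b01 mul1r mulr1 -a1 => gE.
have bN1 : beta (matroid_rank M) (ground N) = 1 by rewrite a0.
apply: parallel_tree_extremal => //.
have := b1 b01; have := gamma_ge R sRN bN1.
have := cardsU_disjoint d; rewrite EM.
have := rankU_le (ground N) (ground M :\: ground N) R; rewrite EM.
by move: rN gE; clear; lia.
Qed.

(** Reading the h-vector from its end is reading T(X, 0) from its lowest nonzero coefficient, in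
    degree c, so s = r - c. *)
Lemma h_vector_ends M lt s : simple_matroid M -> linear_order_on (ground M) lt ->
  h_vector (broken_circuit_complex M lt) s%:Z != 0 ->
  (forall i : nat, (s < i)%N -> h_vector (broken_circuit_complex M lt) i%:Z = 0) ->
  exists c p, [/\ char_poly0 (matroid_rank M) (ground M) = 'X ^+ c * p,
    p`_0 = h_vector (broken_circuit_complex M lt) s%:Z
    & p`_1 = h_vector (broken_circuit_complex M lt) (s%:Z - 1)].
Proof.
move=> sM L hs hlast; have R := matroid_rank_fun M.
have [c [p [qM p0 _]]] := char_poly0_low_coefs R (simple_matroid_rank sM).
exists c, p; rewrite !h_vector_bcc // in hs *.
set r := matroid_rank M (ground M) in hs *.
have le_sr : (s <= r)%N by move: hs; case: leqP => //; rewrite eqxx.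
have q_coef k : (char_poly0 (matroid_rank M) (ground M))`_k = if (k < c)%N then 0 else p`_(k - c).
  by rewrite qM coefXnM.
have le_cr : (c <= r)%N.
  rewrite leqNgt; apply/negP => lt_rc; have := char_poly0_coef_gt lt_rc.
  by rewrite q_coef ltnn subnn => p00; rewrite p00 in p0.
have le_cs : (r - c <= s)%N.
  rewrite leqNgt; apply/negP => /hlast; rewrite h_vector_bcc // leq_subr q_coef.
  by rewrite subKn // ltnn subnn => p00; rewrite p00 in p0.
have sE : (s = r - c)%N.
  by move: hs; rewrite le_sr q_coef; case: ltnP; [rewrite eqxx | lia].
split=> //.
  by rewrite le_sr q_coef sE subKn // ltnn subnn.
case: s sE {hs hlast le_cs le_sr} => [|s] sE.
  (* For s = 0 the second entry is h_(-1) = 0, matched by the coefficient of degree r + 1. *)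
  have rc : r = c by lia.
  have lt_rc : (matroid_rank M (ground M) < c.+1)%N by rewrite -/r rc.
  have := char_poly0_coef_gt lt_rc; rewrite q_coef ltnNge leqnSn /= subSnn => ->.
  by [].
have -> : s.+1%:Z - 1 = s%:Z by rewrite -addn1 PoszD addrK.
have le_sr : (s <= r)%N by lia.
rewrite h_vector_bcc // -/r le_sr q_coef.
have -> : (r - s = c.+1)%N by lia.
by rewrite ltnNge leqnSn /= subSnn.
Qed.

End Components.

(** * Palindromic polynomials and the Dehn-Sommerville equations *)

(** For nonzero P, N is the sum of the lowest and the highest degree in P, not the degree, so that
    powers of X are included. *)
Definition palindromic (N : nat) (P : {poly int}) : Prop :=
  forall i, P`_i = if (i <= N)%N then P`_(N - i) else 0.

Definition avoiding (T : finType) (E : {set T}) (D : {set {set T}}) : {set {set T}} :=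
  [set F : {set T} | (F \subset E) && [forall A in D, ~~ (A \subset F)]].

Section Palindromic.

Variable T : finType.
Implicit Types (M : matroid T) (A B E F S X : {set T}) (lt : rel T) (D : {set {set T}}).

(** Both factors are expanded up to N and K, zero coefficients included, so that reversing both
    indices is visibly a symmetry of the product. *)
Lemma palindromic_coefM N P K Q k : palindromic N P -> palindromic K Q ->
  (P * Q)`_k = \sum_(i < N.+1) \sum_(j < K.+1) P`_i * Q`_j * ((i + j)%N == k)%:R.
Proof.
move=> hP hQ.
have expand m R : palindromic m R -> R = \sum_(i < m.+1) R`_i *: 'X^i.
  move=> hR; rewrite -poly_def; apply/polyP => i; rewrite coef_poly ltnS.
  by rewrite hR; case: leqP => // le; rewrite -hR.
rewrite {1}(expand _ _ hP) {1}(expand _ _ hQ) big_distrl /= coef_sum.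
apply: eq_bigr => i _; rewrite big_distrr /= coef_sum; apply: eq_bigr => j _.
by rewrite -scalerAl -scalerAr -exprD !coefZ coefXn mulrA [k == _]eq_sym.
Qed.

Lemma palindromicM N P K Q : palindromic N P -> palindromic K Q ->
  palindromic (N + K) (P * Q).
Proof.
move=> hP hQ k; rewrite !(palindromic_coefM _ hP hQ); case: leqP => [le_k|lt_k]; last first.
  rewrite big1 // => i _; rewrite big1 // => j _.
  have := ltn_ord i; have := ltn_ord j; rewrite !ltnS => le1 le2.
  by rewrite (_ : (i + j == k)%N = false) ?mulr0 //; apply/negbTE; lia.
rewrite (reindex_inj rev_ord_inj) /=; apply: eq_bigr => i _.
rewrite (reindex_inj rev_ord_inj) /=; apply: eq_bigr => j _.
have := ltn_ord i; have := ltn_ord j; rewrite !ltnS => le1 le2.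
rewrite [in RHS]hP le2 [in RHS]hQ le1 !subSS; congr (_ * _%:R).
by apply/eqP/eqP; lia.
Qed.

Lemma palindromicX : palindromic 2 'X.
Proof. by move=> [|[|[|i]]]; rewrite !coefX. Qed.

Lemma palindromic1 : palindromic 0 1.
Proof. by move=> [|i]; rewrite !coef1. Qed.

Lemma palindromicXn n : palindromic n.*2 'X^n.
Proof.
elim: n => [|n IH]; first by rewrite expr0; apply: palindromic1.
by rewrite exprS doubleS -add2n; apply: palindromicM palindromicX IH.
Qed.

Lemma palindromic_geom d : palindromic d (\sum_(i < d.+1) 'X^i).
Proof.
move=> k; have cE j : (\sum_(i < d.+1) 'X^i : {poly int})`_j = (j <= d)%N%:R.
  have -> : \sum_(i < d.+1) 'X^i = \poly_(i < d.+1) 1 :> {poly int}.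
    by rewrite poly_def; apply: eq_bigr => i _; rewrite scale1r.
  by rewrite coef_poly ltnS; case: leqP.
by rewrite !cE; case: leqP => // le; rewrite leq_subr.
Qed.

Lemma sum_subsets_pow E :
  \sum_(F : {set T} | F \subset E) ('X - 1) ^+ (#|E| - #|F|) = 'X ^+ #|E| :> {poly int}.
Proof.
have [n] := ubnP #|E|; elim: n E => // n IH E ltE.
have [->|/set0Pn [e eE]] := eqVneq E set0.
  rewrite (big_pred1 set0) ?cards0 ?subnn //.
  by move=> F; rewrite subset0.
have cE := cardsD1 e E; rewrite eE in cE.
rewrite (sum_subsetsD1 _ eE) cE add1n exprS -IH; last by rewrite cE in ltE.
rewrite mulr_sumr; apply: eq_bigr => S sS; have := subset_leq_card sS => le.
have eS : e \notin S by move: sS; rewrite subsetD1 => /andP[].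
by rewrite cardsU1 eS add1n subSS subSn // exprS; ring.
Qed.

Lemma sum_proper_subsets_pow A :
  \sum_(F : {set T} | (F \subset A) && (F != A)) ('X - 1) ^+ (#|A| - #|F|)
    = ('X - 1) * \sum_(i < #|A|) 'X^i :> {poly int}.
Proof.
rewrite -subrX1 -sum_subsets_pow [in RHS](bigD1 A) //= subnn expr0 addrAC subrr add0r.
by apply: eq_bigl.
Qed.

(** The complex is a join of a simplex and the boundaries of the simplices A in D. A boundary
    contributes X - 1 times 1 + X + ... + X^(|A| - 1), the simplex a power of X. *)
Lemma avoiding_sum E D : trivIset D -> set0 \notin D -> {in D, forall A, A \subset E} ->
  exists P N, [/\ \sum_(F in avoiding E D) ('X - 1) ^+ (#|E| - #|F|) = ('X - 1) ^+ #|D| * P,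
                  P.[1] != 0 & palindromic N P].
Proof.
have [n] := ubnP #|D|; elim: n D E => // n IH D E ltD tD D0 sD.
have [DE|/set0Pn [A AD]] := eqVneq D set0.
  exists ('X ^+ #|E|), #|E|.*2; rewrite DE cards0 expr0 mul1r -sum_subsets_pow.
  split; [|by rewrite sum_subsets_pow hornerXn expr1n|by rewrite sum_subsets_pow; apply: palindromicXn].
  apply: eq_bigl => F; rewrite inE; case: (F \subset E) => //=.
  by apply/forall_inP => A; rewrite inE.
have cD := cardsD1 A D; rewrite AD in cD.
have sAE := sD A AD.
have A0 : (0 < #|A|)%N by rewrite card_gt0; apply: contraNneq D0 => <-.
have dA B : B \in D :\ A -> [disjoint A & B].
  by rewrite !inE => /andP[BA BD]; move/trivIsetP: tD; apply; rewrite // eq_sym.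
have [|||B|P [N [hP P1 palP]]] := IH (D :\ A) (E :\: A).
- by rewrite cD in ltD.
- by apply: trivIsetS tD; apply: subD1set.
- by rewrite inE (negPf D0) andbF.
- move=> BDA; have := dA B BDA; move: BDA; rewrite inE => /andP[_ /sD sB] d.
  by clear -sB d; finset.
exists ((\sum_(i < #|A|) 'X^i) * P), (#|A|.-1 + N)%N; split; last 2 first.
- rewrite hornerM mulf_neq0 // horner_sum (eq_bigr (fun _ => 1)); last first.
    by move=> i _; rewrite hornerXn expr1n.
  by rewrite sumr_const card_ord pnatr_eq0 -lt0n.
- by apply: palindromicM palP; case: #|A| A0 => // d _; apply: palindromic_geom.
have EE : E = A :|: (E :\: A) by clear -sAE; finset.
have dE : [disjoint A & E :\: A] by clear; finset.
rewrite cD exprS mulrACA -sum_proper_subsets_pow -hP.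
transitivity (\sum_(F : {set T} | F \subset A :|: (E :\: A))
   if F \in avoiding E D then ('X - 1) ^+ (#|E| - #|F|) else 0 : {poly int}).
  rewrite -big_mkcondr -EE; apply: eq_bigl => F.
  by rewrite inE; case: (F \subset E).
rewrite (sum_subsetsU _ dE) big_mkcondr big_distrl /=; apply: eq_bigr => S1 s1.
rewrite [in X in _ = _ * X]big_mkcond /= big_distrr /= [in LHS]big_mkcond [in RHS]/=.
apply: eq_bigr => S2 _.
case: ifP => s2; last first.
  by rewrite inE s2 mulr0.
have -> : #|E| = (#|A| + #|E :\: A|)%N by rewrite {1}EE cardsU_disjoint.
have -> : (S1 :|: S2 \in avoiding E D) = (S1 != A) && (S2 \in avoiding (E :\: A) (D :\ A)).
  rewrite !inE s2 /= {1}EE setUSS //=.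
  apply/forall_inP/andP => [h|[S1A /forall_inP h] B BD].
    split; first by apply: contraNneq (h A AD) => ->; rewrite subsetUl.
    apply/forall_inP => B; rewrite inE => /andP[_ BD]; apply: contra (h B BD) => sB.
    by apply: subset_trans sB _; apply: subsetUr.
  have [->|BA] := eqVneq B A.
    apply: contra S1A => sA; rewrite eqEsubset s1 /=.
    by clear -sA s2; finset.
  have BDA : B \in D :\ A by rewrite in_setD1 BA BD.
  apply: contra (h B BDA) => sB; have d := dA B BDA.
  by clear -sB d s1; finset.
case: eqP => [|_] /=; first by rewrite mul0r.
case: ifP => _; last by rewrite mulr0.
rewrite -exprD cardsU_disjoint; last by clear -s1 s2; finset.
by congr (_ ^+ _); have := subset_leq_card s1; have := subset_leq_card s2; lia.
Qed.

Lemma Xsub1_mul_inj (a b : nat) (p q : {poly int}) : p.[1] != 0 -> q.[1] != 0 ->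
  ('X - 1) ^+ a * p = ('X - 1) ^+ b * q -> p = q.
Proof.
have nz n : ('X - 1 : {poly int}) ^+ n != 0 by rewrite expf_neq0 // -polyC1 polyXsubC_eq0.
move=> p0 q0 E; suff ab : a = b by move: E; rewrite ab; apply: mulfI.
have val (n m : nat) (u v : {poly int}) : u.[1] != 0 -> ('X - 1) ^+ n * u = ('X - 1) ^+ m * v -> (m <= n)%N.
  move=> u0 h; rewrite leqNgt; apply/negP => lt_nm; move: h.
  rewrite -(subnKC (ltnW lt_nm)) exprD -mulrA => /(mulfI (nz n)) /(congr1 (fun w : {poly int} => w.[1])).
  rewrite hornerM horner_exp hornerD hornerN hornerX hornerC subrr expr0n subn_eq0 leqNgt lt_nm mul0r.
  by move/eqP; rewrite (negPf u0).
by apply/eqP; rewrite eqn_leq (val _ _ _ _ p0 E) (val _ _ _ _ q0 (esym E)).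
Qed.

(** The sums over faces with exponents |E| - |F| and r(E) - |F| differ by the factor (X - 1)^(|E| -
    r(E)). Both cofactors are nonzero at 1, so the powers of X - 1 cancel. *)
Lemma char_poly0_palindromic M lt D : simple_matroid M -> linear_order_on (ground M) lt ->
  trivIset D -> set0 \notin D -> {in D, forall A, A \subset ground M} ->
  broken_circuit_complex M lt = avoiding (ground M) D ->
  exists N, palindromic N (char_poly0 (matroid_rank M) (ground M)).
Proof.
move=> sM L tD D0 sD eD; have [P [N [hP P1 palP]]] := avoiding_sum tD D0 sD.
have R := matroid_rank_fun M.
exists N; suff -> : char_poly0 (matroid_rank M) (ground M) = P by [].
apply: (@Xsub1_mul_inj (#|ground M| - matroid_rank M (ground M)) #|D|) => //.
  have [_ h] := char_poly0_at1 (ground M) R.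
  by rewrite gt_eqF // (lt_le_trans _ (h _)) // => x; apply: simple_rank1 (simple_matroid_rank sM).
rewrite -hP (char_poly0_bcc L) mulr_sumr eD; apply: eq_bigr => F; rewrite -eD => bF.
rewrite -exprD; congr (_ ^+ _).
have := matroid_rank_le (bcc_indep L bF) (indep_ground (bcc_indep L bF)).
by have := rank_le_card (ground M) R; lia.
Qed.

(** The coefficient h_0 = 1 in the top degree r is mirrored in degree N - r, which is therefore the
    lowest; hence s = 2r - N, and the symmetry of T(X, 0) becomes that of h. *)
Lemma dehn_sommerville M lt N s : simple_matroid M -> linear_order_on (ground M) lt ->
  palindromic N (char_poly0 (matroid_rank M) (ground M)) ->
  h_vector (broken_circuit_complex M lt) s%:Z != 0 ->
  (forall i : nat, (s < i)%N -> h_vector (broken_circuit_complex M lt) i%:Z = 0) ->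
  forall i : nat, (i <= s)%N ->
    h_vector (broken_circuit_complex M lt) i%:Z = h_vector (broken_circuit_complex M lt) (s%:Z - i%:Z).
Proof.
move=> sM L pal hs hlast i le_is.
have hE n := h_vector_bcc n sM L.
have h0 := h_vector_bcc0 lt sM.
rewrite subzn // !hE; rewrite hE in hs; rewrite (hE 0%N) leq0n subn0 in h0.
set r := matroid_rank M (ground M) in hE hs h0 *.
set q := char_poly0 _ _ in pal hE hs h0 *.
have le_sr : (s <= r)%N by move: hs; case: leqP => //; rewrite eqxx.
rewrite le_sr in hs.
have le_rN : (r <= N)%N by have := pal r; rewrite h0; case: leqP.
have qNr : q`_(N - r) = 1 by have := pal r; rewrite h0 le_rN => <-.
have le_Nr : (N - r <= r)%N.
  by rewrite leqNgt; apply/negP => /char_poly0_coef_gt; rewrite -/q qNr.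
have le1 : (r - (N - r) <= s)%N.
  by rewrite leqNgt; apply/negP => /hlast; rewrite hE leq_subr subKn // qNr.
have le2 : (s <= r - (N - r))%N.
  rewrite leqNgt; apply/negP => lt_s; move: hs; rewrite pal.
  case: leqP => [le|]; last by rewrite eqxx.
  by rewrite [q`__]char_poly0_coef_gt ?eqxx // -/r; lia.
rewrite (leq_trans le_is le_sr) (leq_trans (leq_subr _ _) le_sr) pal.
case: leqP => [le|lt']; last by lia.
by congr (q`_ _); lia.
Qed.

End Palindromic.

(** * Regular sequences of monomials *)

Section Ideals.

Variable R : comNzRingType.
Implicit Types (s : seq R) (p q : R).

Lemma in_idealP s p : in_ideal s p <-> exists c : nat -> R, p = \sum_(i < size s) c i * s`_i.
Proof.
split=> [[c ->]|[c ->]]; last by exists (fun i => c i).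
exists (fun i => if insub i is Some j then c j else 0); apply: eq_bigr => i _.
by rewrite valK.
Qed.

Lemma in_ideal0 s : in_ideal s 0.
Proof. by exists (fun=> 0); rewrite big1 // => i _; rewrite mul0r. Qed.

Lemma in_idealD s p q : in_ideal s p -> in_ideal s q -> in_ideal s (p + q).
Proof.
case=> c -> [d ->]; exists (fun i => c i + d i); rewrite -big_split /=.
by apply: eq_bigr => i _; rewrite mulrDl.
Qed.

Lemma in_idealMl s p q : in_ideal s q -> in_ideal s (p * q).
Proof.
case=> c ->; exists (fun i => p * c i); rewrite big_distrr /=.
by apply: eq_bigr => i _; rewrite mulrA.
Qed.

Lemma in_idealMr s p q : in_ideal s p -> in_ideal s (p * q).
Proof. by rewrite mulrC; apply: in_idealMl. Qed.

Lemma in_idealN s p : in_ideal s p -> in_ideal s (- p).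
Proof. by rewrite -mulN1r; apply: in_idealMl. Qed.

Lemma in_idealB s p q : in_ideal s p -> in_ideal s q -> in_ideal s (p - q).
Proof. by move=> hp /in_idealN; apply: in_idealD. Qed.

Lemma in_ideal_sum (I : Type) (r : seq I) (P : pred I) (F : I -> R) s :
  (forall i, P i -> in_ideal s (F i)) -> in_ideal s (\sum_(i <- r | P i) F i).
Proof.
by move=> h; apply: (big_ind (in_ideal s)) => //; [apply: in_ideal0 | move=> p q; apply: in_idealD].
Qed.

Lemma in_ideal_gen s p : p \in s -> in_ideal s p.
Proof.
move=> ps; have lt := ps; rewrite -index_mem in lt.
exists (fun i => (i == Ordinal lt)%:R); rewrite (bigD1 (Ordinal lt)) //= eqxx mul1r nth_index //.
by rewrite big1 ?addr0 // => i /negPf ->; rewrite mul0r.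
Qed.

Lemma in_ideal_sub s t p : {in s, forall q, in_ideal t q} -> in_ideal s p -> in_ideal t p.
Proof.
move=> sub [c ->]; apply: in_ideal_sum => i _; apply: in_idealMl.
by apply: sub; apply: mem_nth.
Qed.

Lemma in_ideal_takeP s n p : (n <= size s)%N ->
  in_ideal (take n s) p <-> exists c : nat -> R, p = \sum_(i < n) c i * s`_i.
Proof.
move=> le; split=> [/in_idealP [c ->]|[c ->]].
  by rewrite size_takel //; exists c; apply: eq_bigr => i _; rewrite nth_take.
apply/in_idealP; rewrite size_takel //; exists c; apply: eq_bigr => i _.
by rewrite nth_take.
Qed.

(* A relation among the members of a regular sequence has its coefficients in
   the ideal: I / I^2 is free over R / I. *)
Lemma regular_relation s : regular_sequence s ->
  forall c : nat -> R, \sum_(i < size s) c i * s`_i = 0 ->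
  forall i, (i < size s)%N -> in_ideal s (c i).
Proof.
case=> reg _.
suff key n : (n <= size s)%N -> forall c : nat -> R, \sum_(i < n) c i * s`_i = 0 ->
    forall i, (i < n)%N -> in_ideal (take n s) (c i).
  by move=> c c0 i lt; rewrite -(take_size s); apply: key.
elim: n => // n IH lt c; rewrite big_ord_recr /= => c0.
have le := ltnW lt.
have mono p : in_ideal (take n s) p -> in_ideal (take n.+1 s) p.
  apply: in_ideal_sub => q; rewrite (take_nth 0) // => qs; apply: in_ideal_gen.
  by rewrite mem_rcons inE qs orbT.
have hn : in_ideal (take n s) (c n).
  apply: reg => //; apply/(in_ideal_takeP _ le); exists (fun i => - c i).
  rewrite (eq_bigr (fun i : 'I_n => - (c i * s`_i))); last by move=> i _; rewrite mulNr.
  by rewrite sumrN; apply/eqP; rewrite -addr_eq0 addrC c0.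
have [d cd] := (in_ideal_takeP _ le).1 hn.
(* Substituting the expansion of the last coefficient gives a relation of length n; its coefficients
   differ from the given ones by multiples of the last member. *)
have rel : \sum_(i < n) (c i + d i * s`_n) * s`_i = 0.
  rewrite -[RHS]c0 cd mulr_suml -big_split /=; apply: eq_bigr => i _.
  by rewrite mulrDl mulrAC.
move=> i; rewrite ltnS leq_eqVlt => /orP[/eqP ->|lt_in]; first exact: mono.
have := mono _ (IH le (fun i => c i + d i * s`_n) rel i lt_in) => h.
rewrite -[c i](addrK (d i * s`_n)); apply: in_idealB h _.
by apply: in_idealMl; apply: in_ideal_gen; rewrite (take_nth 0) // mem_rcons mem_head.
Qed.

Lemma det_congr s n (A B : 'M[R]_n) :
  (forall i j, in_ideal s (A i j - B i j)) -> in_ideal s (\det A - \det B).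
Proof.
move=> h; rewrite /determinant -sumrB; apply: in_ideal_sum => /= g _.
rewrite -mulrBr; apply: in_idealMl.
apply: (big_ind2 (fun x y => in_ideal s (x - y))) => [|x1 x2 y1 y2 h1 h2|i _].
- by rewrite subrr; apply: in_ideal0.
- have -> : x1 * y1 - x2 * y2 = (x1 - x2) * y1 + x2 * (y1 - y2) by ring.
  by apply: in_idealD; [apply: in_idealMr | apply: in_idealMl].
- exact: h.
Qed.

(* The transition matrix A is invertible modulo the ideal, because det B * det A
   is congruent to 1. *)
Lemma regular_relation_transfer s m n (S : 'cV[R]_n) (U : 'cV[R]_m)
    (A : 'M[R]_(m, n)) (B : 'M[R]_(n, m)) : m = n ->
  (forall c : 'rV[R]_n, (c *m S) 0 0 = 0 -> forall i, in_ideal s (c 0 i)) ->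
  U = A *m S -> S = B *m U ->
  forall c : 'rV[R]_m, (c *m U) 0 0 = 0 -> forall i, in_ideal s (c 0 i).
Proof.
move=> mn; subst m => rel UA SB c cU i.
(* From S = B A S, the rows of B A - 1 are relations among the entries of S. *)
have BA j k : in_ideal s ((B *m A) j k - 1%:M j k).
  have z : (row j (B *m A - 1%:M) *m S) 0 0 = 0.
    by rewrite -row_mul mulmxBl mul1mx -mulmxA -UA -SB subrr !mxE.
  have <- : row j (B *m A - 1%:M) 0 k = (B *m A) j k - 1%:M j k.
    by rewrite mxE [LHS]mxE [X in _ + X = _]mxE.
  exact: rel.
have dBA := det_congr BA; rewrite det1 det_mulmx in dBA.
have cA : forall k, in_ideal s ((c *m A) 0 k).
  by apply: rel; rewrite -mulmxA -UA.
(* Since c A is a relation among the entries of S, its own entries are in the ideal; the adjugate of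
   A passes to det A times c. *)
have cdA : in_ideal s (\det A * c 0 i).
  have -> : \det A * c 0 i = (c *m A *m \adj A) 0 i.
    by rewrite -mulmxA mul_mx_adj mul_mx_scalar mxE.
  by rewrite mxE; apply: in_ideal_sum => k _; apply: in_idealMr.
have -> : c 0 i = \det B * (\det A * c 0 i) - (\det B * \det A - 1) * c 0 i by ring.
by apply: in_idealB; [apply: in_idealMl | apply: in_idealMr].
Qed.

End Ideals.

(** * Monomial ideals generated by a regular sequence *)

Section MonomialIdeals.

Variables (K : fieldType) (n : nat).
Local Notation R := {mpoly K[n]}.
Implicit Types (u v w : 'X_{1..n}) (l : seq 'X_{1..n}) (p q : R).

Definition monomials l : seq R := [seq 'X_[w] | w <- l].

Lemma mcoeff_monomialM p u w : (p * 'X_[u])@_w = if (u <= w)%MM then p@_(w - u) else 0.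
Proof.
case: ifP => [le|nle]; first by rewrite -{1}(submK le) addmC mcoeffMX.
rewrite {1}(mpolyE p) mulr_suml raddf_sum big1 //= => v _.
rewrite -scalerAl -mpolyXD mcoeffZ mcoeffX; case: eqP => [E|_]; last by rewrite mulr0.
by move: nle; rewrite -E addmC lem_addr.
Qed.

Lemma in_monomialsP l p :
  in_ideal (monomials l) p <-> {in msupp p, forall v, has (fun w => (w <= v)%MM) l}.
Proof.
split=> [[c ->] v|h].
  rewrite mcoeff_msupp; apply: contraR => nh; rewrite raddf_sum big1 //= => i _.
  have lti : (i < size l)%N by rewrite -(size_map (fun w => 'X_[w] : R) l).
  rewrite (nth_map 0%MM) // mcoeff_monomialM ifN //.
  by apply: contra nh => le; apply/hasP; exists (nth 0%MM l i) => //; apply: mem_nth.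
rewrite (mpolyE p) big_seq; apply: in_ideal_sum => v /h /hasP [w wl le].
rewrite -(submK le) mpolyXD scalerAl; apply: in_idealMl; apply: in_ideal_gen.
exact: map_f.
Qed.

Lemma monomial_in_ideal l v : in_ideal (monomials l) 'X_[v] -> has (fun w => (w <= v)%MM) l.
Proof. by move/in_monomialsP; apply; rewrite msuppX inE. Qed.

(** The transfer of relations needs square matrices. At the constant terms A B becomes 1, since no
    monomial of l divides another, and B A becomes 1, since it is 1 modulo an ideal without constant
    terms; the two bounds on sizes over K give equality. *)
Lemma monomials_relation l (s : seq R) : uniq l ->
  {in l &, forall u w, (u <= w)%MM -> u = w} ->
  regular_sequence s -> (forall p, in_ideal s p <-> in_ideal (monomials l) p) ->
  forall c : nat -> R, \sum_(i < size l) c i * 'X_[nth 0%MM l i] = 0 ->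
  forall i, (i < size l)%N -> in_ideal s (c i).
Proof.
move=> ul anti reg sl.
have n0l : 0%MM \notin l.
  apply/negP => l0; case: reg => _; apply; rewrite sl.
  by apply: in_ideal_gen; apply/mapP; exists 0%MM; rewrite // mpolyX0.
pose S : 'cV[R]_(size s) := \col_i s`_i.
pose U : 'cV[R]_(size l) := \col_i 'X_[nth 0%MM l i].
have size_m : size (monomials l) = size l by rewrite size_map.
have nth_m i : (i < size l)%N -> (monomials l)`_i = 'X_[nth 0%MM l i].
  by move=> lt; rewrite (nth_map 0%MM).
have [a aP] : exists a : 'I_(size l) -> nat -> R,
    forall i : 'I_(size l), 'X_[nth 0%MM l i] = \sum_(j < size s) a i j * s`_j.
  apply: (fin_all_exists (P := fun (i : 'I_(size l)) (c : nat -> R) =>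
    'X_[nth 0%MM l i] = \sum_(j < size s) c j * s`_j)) => i.
  apply/in_idealP; rewrite sl.
  by apply: in_ideal_gen; rewrite -nth_m //; apply: mem_nth; rewrite size_m.
have [b bP] : exists b : 'I_(size s) -> nat -> R,
    forall i : 'I_(size s), s`_i = \sum_(j < size l) b i j * 'X_[nth 0%MM l j].
  apply: (fin_all_exists (P := fun (i : 'I_(size s)) (c : nat -> R) =>
    s`_i = \sum_(j < size l) c j * 'X_[nth 0%MM l j])) => i.
  have /sl/in_idealP [c ->] : in_ideal s s`_i by apply: in_ideal_gen; apply: mem_nth.
  by exists c; rewrite size_m; apply: eq_bigr => j _; rewrite nth_m.
pose A : 'M[R]_(size l, size s) := \matrix_(i, j) a i j.
pose B : 'M[R]_(size s, size l) := \matrix_(i, j) b i j.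
have UA : U = A *m S.
  apply/matrixP => i j; rewrite !mxE aP; apply: eq_bigr => k _.
  by rewrite !mxE.
have SB : S = B *m U.
  apply/matrixP => i j; rewrite !mxE bP; apply: eq_bigr => k _.
  by rewrite !mxE.
have relS (c : 'rV[R]_(size s)) : (c *m S) 0 0 = 0 -> forall i, in_ideal s (c 0 i).
  move=> c0 i.
  have := regular_relation reg (c := fun j => if insub j is Some j' then c 0 j' else 0) _ (ltn_ord i).
  rewrite valK; apply; rewrite -[RHS]c0 mxE; apply: eq_bigr => j _.
  by rewrite valK !mxE.
pose e := @mcoeff n K 0%MM.
have e0 p : in_ideal s p -> e p = 0.
  move/sl/in_monomialsP => h; apply/eqP; rewrite mcoeff_eq0; apply/negP => /h /hasP [w wl].
  move=> le; suff w0 : w = 0%MM by rewrite -w0 wl in n0l.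
  apply/mnmP => i; apply/eqP; rewrite mnmE -leqn0.
  by have := mnm_lepP le i; rewrite mnmE.
have size_eq : size l = size s.
  apply/eqP; rewrite eqn_leq; apply/andP; split.
    apply: (@mulmx1_min K _ _ (map_mx e A) (map_mx e B)).
    rewrite -map_mxM; apply/matrixP => i j; rewrite [RHS]mxE [LHS]mxE.
    have /matrixP /(_ i 0) : U = A *m B *m U by rewrite -mulmxA -SB.
    move/(congr1 (mcoeff (nth 0%MM l j))); rewrite !mxE raddf_sum /= mcoeffX nth_uniq //.
    rewrite (bigD1 j) //= big1 ?addr0; last first.
      move=> k kj; rewrite [U k 0]mxE mcoeff_monomialM ifN //; apply: contra kj => le.
      have := anti _ _ (mem_nth _ (ltn_ord k)) (mem_nth _ (ltn_ord j)) le.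
      by move/eqP; rewrite nth_uniq.
    rewrite [U j 0]mxE mcoeff_monomialM lepm_refl (_ : _ - _ = 0)%MM; last first.
      by apply/mnmP => k; rewrite mnmBE subnn mnmE.
    by rewrite [(A *m B) i j]mxE /e => <-.
  apply: (@mulmx1_min K _ _ (map_mx e B) (map_mx e A)).
  rewrite -map_mxM; apply/matrixP => i j; rewrite [RHS]mxE [LHS]mxE.
  have z : (row i (B *m A - 1%:M) *m S) 0 0 = 0.
    by rewrite -row_mul mulmxBl mul1mx -mulmxA -UA -SB subrr !mxE.
  have /e0 : in_ideal s ((B *m A) i j - (i == j)%:R).
    have <- : row i (B *m A - 1%:M) 0 j = (B *m A) i j - (i == j)%:R.
      by rewrite mxE [LHS]mxE [X in _ + X = _]mxE [1%:M i j]mxE.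
    exact: relS.
  rewrite /e raddfB /= => /eqP; rewrite subr_eq0 => /eqP ->.
  by case: (i == j); rewrite ?mcoeff1 ?eqxx // mcoeff0.
move=> c c0 i lti.
have := @regular_relation_transfer _ s _ _ S U A B size_eq relS UA SB (\row_j c j) _ (Ordinal lti).
rewrite !mxE; apply; rewrite -[RHS]c0; apply: eq_bigr => j _.
by rewrite !mxE.
Qed.

End MonomialIdeals.

Section MonomialRegular.

Variables (K : fieldType) (n : nat).
Local Notation R := {mpoly K[n]}.
Implicit Types (u v w : 'X_{1..n}) (l : seq 'X_{1..n}) (p q : R).

(* With g = gcd(u, w), the relation X^(w-g) X^u = X^(u-g) X^w puts X^(w-g) in the
   ideal, against the minimality of w unless g = 1. *)
Lemma monomials_coprime l (s : seq R) : uniq l ->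
  {in l &, forall u w, (u <= w)%MM -> u = w} ->
  regular_sequence s -> (forall p, in_ideal s p <-> in_ideal (monomials K l) p) ->
  {in l &, forall u w, u != w -> forall i, minn (u i) (w i) = 0%N}.
Proof.
move=> ul anti reg sl u w ul' wl uw i.
pose g := [multinom minn (u i) (w i) | i < n].
have leu : (g <= u)%MM by apply/mnm_lepP => j; rewrite mnmE geq_minl.
have lew : (g <= w)%MM by apply/mnm_lepP => j; rewrite mnmE geq_minr.
have ltu : (index u l < size l)%N by rewrite index_mem.
have ltw : (index w l < size l)%N by rewrite index_mem.
have neq : (index u l == index w l) = false.
  by apply/negbTE; apply: contra uw => /eqP E; rewrite -(nth_index 0%MM ul') E nth_index.
pose c k : R := if k == index u l then 'X_[w - g] else if k == index w l then - 'X_[u - g] else 0.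
have rel : \sum_(k < size l) c k * 'X_[nth 0%MM l k] = 0.
  rewrite (bigD1 (Ordinal ltu)) //= (bigD1 (Ordinal ltw)) /=; last first.
    by rewrite -val_eqE /= eq_sym neq.
  rewrite big1 ?addr0.
    rewrite /c eqxx [index w l == _]eq_sym neq eqxx !nth_index // mulNr -!mpolyXD.
    apply/eqP; rewrite subr_eq0; apply/eqP; congr ('X_[_]).
    by rewrite -{2}(submK leu) -{1}(submK leu) -{2}(submK lew) !addmA;
       apply/mnmP => j; rewrite !mnmE; have := geq_minl (u j) (w j); have := geq_minr (u j) (w j); lia.
  move=> k /andP[k1 k2]; rewrite /c.
  by rewrite -val_eqE /= in k1; rewrite -val_eqE /= in k2; rewrite (negPf k1) (negPf k2) mul0r.
have := monomials_relation ul anti reg sl rel ltu; rewrite /c eqxx => /sl/monomial_in_ideal/hasP[v vl le].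
have vw : v = w by apply: anti vl wl _; apply: lepm_trans le (lem_subr _ _).
have := mnm_lepP le i; have := mnm_lepP lew i; rewrite vw !mnmE; lia.
Qed.

(** A monomial that is coprime to a later one and divides its product with v must divide v; for
    monomial ideals this test on supports is enough. *)
Lemma monomials_regular l : 0%MM \notin l ->
  (forall i j, (i < j < size l)%N -> forall k, minn (nth 0%MM l i k) (nth 0%MM l j k) = 0%N) ->
  regular_sequence (monomials K l).
Proof.
move=> l0 cop; split; last first.
  move/in_monomialsP => /(_ 0%MM); rewrite msupp1 mem_head => /(_ isT) /hasP [w wl le].
  suff w0 : w = 0%MM by rewrite -w0 wl in l0.
  apply/mnmP => i; apply/eqP; rewrite mnmE -leqn0.
  by have := mnm_lepP le i; rewrite mnmE.
move=> i; rewrite size_map => lti p.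
rewrite (nth_map 0%MM) // -map_take => /in_monomialsP h; apply/in_monomialsP => v vp.
have : (v + nth 0%MM l i)%MM \in msupp (p * 'X_[nth 0%MM l i]).
  by rewrite mcoeff_msupp addmC mcoeffMX -mcoeff_msupp.
move/h => /hasP [w wl le]; apply/hasP; exists w => //.
have /(nthP 0%MM) [j ltj wE] := wl.
rewrite size_takel ?(ltnW lti) // in ltj; rewrite nth_take // in wE.
apply/mnm_lepP => k; have := mnm_lepP le k; have := cop j i _ k.
by rewrite ltj lti wE mnmE => /(_ isT); lia.
Qed.

End MonomialRegular.

(** * Stanley-Reisner ideals and disjoint minimal nonfaces *)

Section StanleyReisner.

Variables (K : fieldType) (T : finType).
Implicit Types (Delta D : {set {set T}}) (A B V : {set T}).

Definition minimal_nonfaces Delta : {set {set T}} :=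
  [set A | minset (fun A => (A \subset vertices Delta) && (A \notin Delta)) A].

Definition set_mnm Delta A : 'X_{1..#|vertices Delta|} :=
  [multinom (enum_val i \in A : nat) | i < #|vertices Delta|].

Lemma vertex_monomialE Delta A : vertex_monomial K Delta A = 'X_[set_mnm Delta A].
Proof.
rewrite mpolyXE_id /vertex_monomial big_mkcond; apply: eq_bigr => i _.
by rewrite mnmE; case: (_ \in A); rewrite ?expr1 ?expr0.
Qed.

Lemma set_mnm_le Delta A B : A \subset vertices Delta ->
  (set_mnm Delta A <= set_mnm Delta B)%MM = (A \subset B).
Proof.
move=> /subsetP sA; apply/mnm_lepP/subsetP => [h x xA|h i].
  have := h (enum_rank_in (sA x xA) x); rewrite !mnmE enum_rankK_in ?sA // xA.
  by case: (x \in B).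
by rewrite !mnmE; have := h (enum_val i); case: (_ \in A) => // /(_ isT) ->.
Qed.

Lemma set_mnm_inj Delta : {in [pred A : {set T} | A \subset vertices Delta] &, injective (set_mnm Delta)}.
Proof.
move=> A B sA sB E; apply/eqP; rewrite eqEsubset.
by rewrite -(set_mnm_le _ sA) -(set_mnm_le _ sB) E lepm_refl.
Qed.

Lemma set_mnm0 Delta A : A \subset vertices Delta -> set_mnm Delta A = 0%MM -> A = set0.
Proof.
move=> sA A0; apply/eqP; rewrite -subset0 -(set_mnm_le _ sA) A0.
by apply/mnm_lepP => i; rewrite mnmE.
Qed.

Lemma stanley_reisner_ideal Delta D : 
  {in D, forall A, (A \subset vertices Delta) && (A \notin Delta)} ->
  (forall A, A \subset vertices Delta -> A \notin Delta -> exists2 B, B \in D & B \subset A) ->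
  forall p, in_ideal (monomials K [seq set_mnm Delta A | A <- enum D]) p <->
            in_ideal (stanley_reisner_generators K Delta) p.
Proof.
move=> sD gD p; split; apply: in_ideal_sub => q.
  case/mapP=> u /mapP [A]; rewrite mem_enum => AD -> ->.
  apply: in_ideal_gen; rewrite -vertex_monomialE; apply: map_f.
  by rewrite mem_enum inE; apply: sD.
case/mapP=> A; rewrite mem_enum inE => /andP[sA nA] ->.
have [B BD sBA] := gD A sA nA; have /andP[sB _] := sD B BD.
have le : (set_mnm Delta B <= set_mnm Delta A)%MM by rewrite set_mnm_le.
rewrite vertex_monomialE -(submK le) mpolyXD; apply: in_idealMl; apply: in_ideal_gen.
by apply: map_f; apply: map_f; rewrite mem_enum.
Qed.

Lemma minimal_nonfacesP Delta : 
  {in minimal_nonfaces Delta, forall A, (A \subset vertices Delta) && (A \notin Delta)}.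
Proof. by move=> A; rewrite inE => /minsetP []. Qed.

Lemma minimal_nonfaces_gen Delta A : A \subset vertices Delta -> A \notin Delta ->
  exists2 B, B \in minimal_nonfaces Delta & B \subset A.
Proof.
move=> sA nA.
have [|B minB sB] := @minset_exists _ (fun A => (A \subset vertices Delta) && (A \notin Delta)) A.
  by rewrite sA.
by exists B; rewrite // inE.
Qed.

Lemma complete_intersection_disjoint Delta : complete_intersection K Delta ->
  trivIset (minimal_nonfaces Delta).
Proof.
case=> s reg ideal_s; set D := minimal_nonfaces Delta.
have sl p : in_ideal s p <-> in_ideal (monomials K [seq set_mnm Delta A | A <- enum D]) p.
  rewrite ideal_s (stanley_reisner_ideal (D := D)) //; first exact: minimal_nonfacesP.
  exact: minimal_nonfaces_gen.
have sub A : A \in D -> A \subset vertices Delta by move/minimal_nonfacesP => /andP[].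
have inj : {in D &, injective (set_mnm Delta)}.
  by move=> A B /sub sA /sub sB; apply: set_mnm_inj.
have ul : uniq [seq set_mnm Delta A | A <- enum D].
  rewrite map_inj_in_uniq ?enum_uniq // => A B; rewrite !mem_enum; exact: inj.
have anti : {in [seq set_mnm Delta A | A <- enum D] &, forall u w, (u <= w)%MM -> u = w}.
  move=> u w /mapP [A + ->] /mapP [B + ->]; rewrite !mem_enum => AD BD.
  rewrite set_mnm_le ?sub // => sAB; congr (set_mnm _ _).
  move: BD; rewrite inE => /minsetP [_ minB]; apply: minB => //.
  exact: minimal_nonfacesP.
apply/trivIsetP => A B AD BD AB.
rewrite disjoint_subset; apply/subsetP => x xA; rewrite inE; apply/negP => xB.
have xV := subsetP (sub A AD) x xA.
have mA C : C \in D -> set_mnm Delta C \in [seq set_mnm Delta A | A <- enum D].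
  by move=> CD; apply: map_f; rewrite mem_enum.
have neq : set_mnm Delta A != set_mnm Delta B by apply: contra_neq AB; apply: inj.
have := monomials_coprime ul anti reg sl (mA A AD) (mA B BD) neq (enum_rank_in xV x).
by rewrite !mnmE enum_rankK_in // xA xB.
Qed.

Lemma disjoint_complete_intersection Delta D : trivIset D -> set0 \notin D ->
  {in D, forall A, A \subset vertices Delta} ->
  Delta = avoiding (vertices Delta) D -> complete_intersection K Delta.
Proof.
move=> tD D0 sD eD.
exists (monomials K [seq set_mnm Delta A | A <- enum D]); last first.
  apply: stanley_reisner_ideal => [A AD|A sA].
    rewrite sD //=; rewrite eD inE negb_and negb_forall; apply/orP; right.
    by apply/existsP; exists A; rewrite AD /= negbK subxx.
  rewrite {1}eD inE sA /= negb_forall => /existsP [B]; rewrite negb_imply negbK => /andP[BD sB].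
  by exists B.
apply: monomials_regular.
  apply/negP => /mapP [A]; rewrite mem_enum => AD /esym /(set_mnm0 (sD A AD)) A0.
  by rewrite -A0 AD in D0.
move=> i j /andP[ltij]; rewrite size_map => ltj k.
have lti := ltn_trans ltij ltj.
rewrite !(nth_map set0) // !mnmE.
have d : [disjoint nth set0 (enum D) i & nth set0 (enum D) j].
  have mD m : (m < size (enum D))%N -> nth set0 (enum D) m \in D.
    by move=> ltm; rewrite -mem_enum mem_nth.
  move/trivIsetP: tD => /(_ _ _ (mD i lti) (mD j ltj)); apply.
  by rewrite nth_uniq ?enum_uniq // neq_ltn ltij.
have := disjointFr d (x := enum_val k).
by case: (enum_val k \in nth set0 (enum D) i) => [/(_ isT) ->|_]; rewrite ?minn0 ?min0n.
Qed.

End StanleyReisner.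

Local Open Scope nat_scope.

(** * Orders with disjoint minimal broken circuits *)

(* D is the set of minimal broken circuits. *)
Definition ci_order (T : finType) (M : matroid T) (lt : rel T) (D : {set {set T}}) : Prop :=
  [/\ linear_order_on (ground M) lt, trivIset D, D \subset broken_circuits M lt
    & {in broken_circuits M lt, forall B : {set T}, exists2 A : {set T}, A \in D & A \subset B}].

Section CompleteIntersectionOrders.

Implicit Types (T U : finType).

Lemma broken_circuitP T (M : matroid T) (lt : rel T) B :
  reflect (exists C x, [/\ C \in circuits M, x \in C, {in C, forall y, y != x -> lt x y} & B = C :\ x])
          (B \in broken_circuits M lt).
Proof.
apply: (iffP imset2P) => [[C x cC]|[C [x [cC xC mx ->]]]].
  rewrite inE => /andP[xC /forall_inP mx] ->; exists C, x; split=> // y yC.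
  by apply/implyP; apply: mx.
exists C x => //; rewrite inE xC; apply/forall_inP => y yC; apply/implyP; exact: mx.
Qed.

Lemma broken_circuit_ground T (M : matroid T) lt B : B \in broken_circuits M lt -> B \subset ground M.
Proof.
case/broken_circuitP=> C [x [cC _ _ ->]].
exact: subset_trans (subD1set _ _) (circuit_ground cC).
Qed.

Lemma exists_linear_order T (E : {set T}) : exists lt : rel T, linear_order_on E lt.
Proof.
exists (fun x y => enum_rank x < enum_rank y); split=> [x _|x y z _ _ _|x y _ _ xy].
- exact: ltnn.
- exact: ltn_trans.
- by rewrite -neq_ltn (inj_eq val_inj) (inj_eq enum_rank_inj).
Qed.

Lemma uniform_circuits T (M : matroid T) m : is_uniform m m.+1 M ->
  circuits M = [set ground M].
Proof.
case=> cM iM; have iE A : A \in indep M = (A \subset ground M) && (#|A| <= m) by rewrite iM inE.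
apply/setP=> C; rewrite in_set1; apply/circuitP/eqP => [[sC + _]|->].
  rewrite iE sC -ltnNge => ltC; apply/eqP; rewrite eqEcard sC cM; exact: ltC.
split; rewrite ?iE ?subxx ?cM ?ltnn // => x xE.
by rewrite iE subD1set /=; have := cardsD1 x (ground M); rewrite xE cM; lia.
Qed.

Lemma ci_order_uniform T (M : matroid T) m : is_uniform m m.+1 M ->
  exists lt D, ci_order M lt D.
Proof.
move=> uM; have [lt L] := exists_linear_order (ground M); have cM := uniform_circuits uM.
have [|x xE mx] := linear_min L (subxx _); first by case: uM => cE _; rewrite -card_gt0 cE.
have bx : ground M :\ x \in broken_circuits M lt.
  by apply/broken_circuitP; exists (ground M), x; rewrite cM set11.
exists lt, [set ground M :\ x]; split; rewrite ?sub1set //.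
  by apply/trivIsetP => A B; rewrite !inE => /eqP -> /eqP ->; rewrite eqxx.
move=> B /broken_circuitP [C [y [cC yC my ->]]]; exists (ground M :\ x); rewrite ?set11 //.
move: cC yC my; rewrite cM inE => /eqP -> yC my.
have [->//|yx] := eqVneq x y.
have := linear_asym L yC xE (my x xE yx); rewrite mx // eq_sym.
exact: yx.
Qed.

Lemma ci_order_coloop T (M : matroid T) : single_coloop M -> exists lt D, ci_order M lt D.
Proof.
case=> e gE; have eE : e \in ground M by rewrite gE inE.
rewrite coloopE // gE => ce.
have [lt L] := exists_linear_order (ground M); exists lt, set0; split=> //.
- by apply/trivIsetP => A B; rewrite inE.
- exact: sub0set.
move=> B /broken_circuitP [C [x [cC _ _ _]]].
have C1 : C = [set e].
  apply/eqP; rewrite eqEcard -gE circuit_ground // gE cards1 card_gt0.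
  exact: circuit_neq0 cC.
have := loopE eE; rewrite /loop -C1 cC C1 => /esym/eqP e0.
by rewrite e0 setDv (rank0 (matroid_rank_fun M)) in ce.
Qed.

(** The one new member of D is N \ e, disjoint from P. A circuit meeting both parts outside e has
    its minimum in P, so its broken circuit contains N \ e. *)
Lemma ci_order_parallel T (P N Q : matroid T) e m lt D : ci_order P lt D ->
  is_uniform m m.+1 N -> parallel_connection e P N Q -> exists lt' D', ci_order Q lt' D'.
Proof.
case=> L tD sD gD uN [PN [nloop _ _ _] gQ cQ].
have [lt1 L1] := exists_linear_order (ground Q).
have cN := uniform_circuits uN.
have eP : e \in ground P by move/setP/(_ e): PN; rewrite !inE eqxx => /andP[].
have eN : e \in ground N by move/setP/(_ e): PN; rewrite !inE eqxx => /andP[].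
have onlye x : x \in ground P -> x \in ground N -> x = e.
  by move=> xP xN; apply/eqP; rewrite -in_set1 -PN inE xP.
(* The elements of P keep their order and precede the rest, which is ordered arbitrarily. *)
pose lt' x y := if x \in ground P then if y \in ground P then lt x y else true
                else if y \in ground P then false else lt1 x y.
have ltP x y : x \in ground P -> y \in ground P -> lt' x y = lt x y.
  by rewrite /lt' => -> ->.
have L' : linear_order_on (ground Q) lt'.
  case: L L1 => irr tr tot [irr1 tr1 tot1]; rewrite /lt'; split=> [x xQ|x y z xQ yQ zQ|x y xQ yQ xy].
  - by case xP: (x \in ground P); [apply: irr | apply: irr1].
  - case xP: (x \in ground P); case yP: (y \in ground P); case zP: (z \in ground P) => //.
      exact: tr.
    exact: tr1.
  - case xP: (x \in ground P); case yP: (y \in ground P) => //; first exact: tot.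
    exact: tot1.
have cPQ C : C \in circuits P -> C \in circuits Q by rewrite cQ !in_setU => ->.
have cNQ : ground N \in circuits Q by rewrite cQ !in_setU cN set11 orbT.
have broken_P C x : C \in circuits P -> x \in C ->
    {in C, forall y, y != x -> lt' x y} <-> {in C, forall y, y != x -> lt x y}.
  move=> /circuit_ground /subsetP sC xC.
  by split=> h y yC yx; have := h y yC yx; rewrite ltP ?sC.
exists lt', (ground N :\ e |: D); split=> //.
- have dN A : A \in D -> [disjoint A & ground N :\ e].
    move/(subsetP sD)/broken_circuit_ground => sA.
    rewrite disjoint_subset; apply/subsetP => x /(subsetP sA) xP.
    by rewrite !inE negb_and negbK; case: eqP => //= xe; apply/negP => /(onlye x xP).
  apply/trivIsetP => A B; rewrite !in_setU1 => /orP[/eqP ->|AD] /orP[/eqP ->|BD] AB.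
  + by rewrite eqxx in AB.
  + by rewrite disjoint_sym; apply: dN.
  + exact: dN.
  + by move/trivIsetP: tD; apply.
- apply/subsetP => B; rewrite in_setU1 => /orP[/eqP ->|/(subsetP sD)/broken_circuitP].
    apply/broken_circuitP; exists (ground N), e; split=> // y yN ye.
    by rewrite /lt' eP; case: ifP => // yP; rewrite (onlye y yP yN) eqxx in ye.
  case=> C [x [cC xC mx ->]]; apply/broken_circuitP; exists C, x; split=> //; first exact: cPQ.
  exact/broken_P.
move=> B /broken_circuitP [C [x [cC xC mx ->]]].
move: cC; rewrite cQ !in_setU => /orP[/orP[cC|]|].
- have [|A AD sA] := gD (C :\ x); last by exists A; rewrite // in_setU1 AD orbT.
  by apply/broken_circuitP; exists C, x; split=> //; apply/broken_P.
- rewrite cN inE => /eqP EC; exists (ground N :\ e); first exact: setU11.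
  suff -> : x = e by rewrite EC.
  apply/eqP; apply: contraT => xe; have := mx e; rewrite EC eq_sym xe => /(_ eN isT).
  rewrite /lt' eP; case: ifP => // xP.
  by move: xC; rewrite EC => xN; rewrite (onlye x xP xN) eqxx in xe.
case/imset2P => C1 C2 cC1; rewrite in_set cN in_set1 => /and3P[/eqP -> eC1 _] EC.
exists (ground N :\ e); first exact: setU11.
(* As e is not a loop of P, the mixed circuit has an element of P, which forces its minimum into
   P. *)
have [z zC1 ze] : exists2 z, z \in C1 & z != e.
  have : C1 != [set e] by apply: contraNneq nloop => E; rewrite /loop -E.
  move=> ne; have /subsetPn [z zC1 zn] : ~~ (C1 \subset [set e]).
    by apply: contra ne => s1; rewrite eqEsubset s1 sub1set.
  by exists z => //; rewrite inE in zn.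
have zP := subsetP (circuit_ground cC1) z zC1.
have zC : z \in C by rewrite EC !inE ze zC1.
have xe : x != e by move: xC; rewrite EC !inE => /andP[].
have xP : x \in ground P.
  have [<-//|zx] := eqVneq z x.
  by have := mx z zC zx; rewrite /lt' zP; case: ifP.
rewrite EC; apply/subsetP => y; rewrite !inE => /andP[ye yN].
rewrite ye yN orbT !andbT; apply/negP => /eqP yx.
by case/eqP: xe; apply: (onlye x xP); rewrite -yx.
Qed.

Lemma ci_order_ipc T (Ns : seq (matroid T)) (P : matroid T) :
  iterated_parallel_connection Ns P ->
  {in Ns, forall Q, exists2 m, 2 <= m & is_uniform m m.+1 Q} ->
  exists lt D, ci_order P lt D.
Proof.
elim=> {Ns P} [N|s P N Q e _ IH par] uNs.
  by have [|m _ uN] := uNs N; [rewrite inE | exact: ci_order_uniform uN].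
have [Q' Q's|lt [D ciP]] := IH; first by apply: uNs; rewrite mem_rcons inE Q's orbT.
have [|m _ uN] := uNs N; first by rewrite mem_rcons mem_head.
exact: ci_order_parallel ciP uN par.
Qed.

Lemma ci_order_iso T U (N : matroid T) (P : matroid U) lt D : isomorphic N P ->
  ci_order P lt D -> exists lt' D', ci_order N lt' D'.
Proof.
case=> f [injf gf indf] [L tD sD gD].
have fE x : x \in ground N -> f x \in ground P by move=> xN; rewrite -gf imset_f.
have imD1 (A : {set T}) x : A \subset ground N -> x \in A -> f @: (A :\ x) = (f @: A) :\ f x.
  move=> /subsetP sA xA; apply/setP => z; apply/imsetP/setD1P => [[y]|[zx /imsetP [y yA ez]]].
    rewrite !inE => /andP[yx yA] ->; rewrite imset_f //; split=> //.
    by apply: contra yx => /eqP /injf -> //; apply: sA.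
  by exists y => //; rewrite !inE yA andbT; apply: contra zx => /eqP <-; rewrite ez.
have circ (A : {set T}) : A \subset ground N -> (A \in circuits N) = (f @: A \in circuits P).
  move=> sA; apply/circuitP/circuitP => [[_ nA mA]|[_ nA mA]].
    split; first by rewrite -gf imsetS.
      by rewrite -indf.
    move=> y /imsetP [x xA ->]; rewrite -imD1 // -indf ?mA //.
    exact: subset_trans (subD1set _ _) sA.
  split=> //; first by rewrite indf.
  move=> x xA; rewrite indf; last exact: subset_trans (subD1set _ _) sA.
  by rewrite imD1 // mA // imset_f.
(* f is injective on the ground set only, so preimages are cut down to it. *)
pose g (B : {set U}) := ground N :&: f @^-1: B.
have fg (B : {set U}) : B \subset ground P -> f @: g B = B.
  move=> sB; apply/setP => z; apply/imsetP/idP => [[x]|zB].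
    by rewrite !inE => /andP[_ xB] ->.
  have : z \in f @: ground N by rewrite gf (subsetP sB).
  by case/imsetP=> x xN ez; exists x => //; rewrite !inE xN -ez.
have gf' (A : {set T}) : A \subset ground N -> g (f @: A) = A.
  move=> sA; apply/setP => x; rewrite !inE; apply/andP/idP => [[xN /imsetP [y yA]]|xA].
    by move/injf => -> //; apply: (subsetP sA).
  by rewrite (subsetP sA) // imset_f.
have broken (A : {set T}) : A \subset ground N ->
    A \in broken_circuits N (fun x y => lt (f x) (f y)) <-> f @: A \in broken_circuits P lt.
  move=> sA; split=> [/broken_circuitP [C [x [cC xC mx EA]]]|/broken_circuitP [C [y [cC yC my EA]]]].
    have sC := circuit_ground cC.
    apply/broken_circuitP; exists (f @: C), (f x); split.
    - by rewrite -circ.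
    - exact: imset_f.
    - by move=> y /imsetP [z zC ->] zx; apply: mx => //; apply: contra zx => /eqP ->.
    - by rewrite EA imD1.
  have sC := circuit_ground cC; have fgC := fg C sC.
  have : y \in f @: g C by rewrite fgC.
  case/imsetP=> x xg ey; have sg : g C \subset ground N by apply: subsetIl.
  apply/broken_circuitP; exists (g C), x; split=> //.
  - by rewrite circ // fgC.
  - move=> z zg zx; have := zg; rewrite !inE => /andP[zN zC].
    rewrite -ey; apply: my => //; rewrite ey; apply: contra zx => /eqP /injf -> //.
    by move: xg; rewrite !inE => /andP[].
  - rewrite -(gf' _ sA) EA -{1}fgC ey -imD1 // gf' //.
    exact: subset_trans (subD1set _ _) sg.
exists (fun x y => lt (f x) (f y)), [set g B | B in D]; split.
- case: L => irr tr tot; split=> [x xN|x y z xN yN zN|x y xN yN xy]; first exact: irr (fE _ _).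
    by apply: tr; apply: fE.
  by apply: tot; rewrite ?fE //; apply: contra xy => /eqP /injf ->.
- apply/trivIsetP => A' B' /imsetP [A AD ->] /imsetP [B BD ->] AB.
  have /(trivIsetP tD A B AD BD) d : A != B by apply: contraNneq AB => ->.
  rewrite -setI_eq0; apply/eqP/setP => x; rewrite !inE.
  have := disjointFr d (x := f x); case: (f x \in A) => [/(_ isT) ->|_]; rewrite ?andbF //.
- apply/subsetP => A' /imsetP [A AD ->]; have bA := subsetP sD A AD.
  by apply/broken; [apply: subsetIl | rewrite fg // (broken_circuit_ground bA)].
- move=> B bB; have sB := broken_circuit_ground bB.
  have [|A AD sA] := gD (f @: B); first exact/broken.
  exists (g A); first exact: imset_f.
  by rewrite -(gf' B sB) /g setIS // preimsetS.
Qed.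

Lemma direct_sum_circuits T (M : matroid T) D C : direct_sum D M ->
  C \in circuits M <-> exists2 N, N \in D & C \in circuits N.
Proof.
move=> dD; have [dis gD iD] := dD.
split=> [cC|[N ND]]; last first.
  have [sN EN _] := direct_sum_restr dD ND.
  by rewrite EN circuits_restr // => /andP[].
have [sC nC mC] := circuitP _ _ cC.
move: (nC); rewrite iD sC /= => /forall_inPn [N ND nCN].
have [sN EN _] := direct_sum_restr dD ND.
exists N => //; rewrite EN circuits_restr // cC /=.
(* If C had an element x outside N, its trace on N would lie in the independent set C \ x. *)
apply: contraR nCN => /subsetPn [x xC xN].
rewrite EN indep_restr ground_restr subsetIr andbT.
apply: indepS (mC x xC); apply/subsetP => z; rewrite !inE => /andP[zC zN].
by rewrite zC andbT; apply: contraNneq xN => <-.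
Qed.

Lemma ci_order_direct_sum T (M : matroid T) (D : {set matroid T}) : direct_sum D M ->
  {in D, forall N, exists lt S, ci_order N lt S} -> exists lt S, ci_order M lt S.
Proof.
move=> dD ciD; have [dis gD _] := dD.
have [F FP] : exists F : matroid T -> rel T * {set {set T}},
    forall N, N \in D -> ci_order N (F N).1 (F N).2.
  apply: (fin_all_exists (P := fun N (p : rel T * {set {set T}}) => N \in D -> ci_order N p.1 p.2)) => N.
  have [/ciD [lt [S ci]]|nN] := boolP (N \in D); first by exists (lt, S).
  by exists (fun _ _ => true, set0).
pose comp x := [pick N in D | x \in ground N].
have compE N x : N \in D -> x \in ground N -> comp x = Some N.
  move=> ND xN; rewrite /comp; case: pickP => [N' /andP[N'D xN']|/(_ N)]; last by rewrite ND xN.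
  congr Some; apply/eqP; apply: contraT => NN'.
  by have := disjointFr (dis N' N N'D ND NN') xN'; rewrite xN.
have comp_ex x : x \in ground M -> exists2 N, N \in D & x \in ground N.
  by rewrite gD => /bigcupP.
(* Between components any order will do, since no circuit meets two of them. *)
pose lt x y := if comp x == comp y
  then (if comp x is Some N then (F N).1 x y else false)
  else enum_rank (comp x) < enum_rank (comp y).
have ltN N x y : N \in D -> x \in ground N -> y \in ground N -> lt x y = (F N).1 x y.
  by move=> ND xN yN; rewrite /lt !(compE N) // eqxx.
have broken B : B \in broken_circuits M lt <-> exists2 N, N \in D & B \in broken_circuits N (F N).1.
  split=> [/broken_circuitP [C [x [cC xC mx ->]]]|[N ND /broken_circuitP [C [x [cC xC mx ->]]]]].
    have [N ND cN] := (direct_sum_circuits C dD).1 cC; exists N => //.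
    have sC := subsetP (circuit_ground cN).
    apply/broken_circuitP; exists C, x; split=> // y yC yx.
    by rewrite -ltN ?sC //; apply: mx.
  have sC := subsetP (circuit_ground cC).
  apply/broken_circuitP; exists C, x; split=> //.
    by apply/(direct_sum_circuits C dD); exists N.
  by move=> y yC yx; rewrite (ltN N) ?sC //; apply: mx.
exists lt, (\bigcup_(N in D) (F N).2); split.
- split.
  + move=> x /comp_ex [N ND xN]; rewrite (ltN N) //.
    by have [[irr _ _] _ _ _] := FP N ND; apply: irr.
  + move=> y x z /comp_ex [Ny NyD yN] /comp_ex [Nx NxD xN] /comp_ex [Nz NzD zN].
    rewrite /lt (compE _ _ NxD xN) (compE _ _ NyD yN) (compE _ _ NzD zN).
    case: (eqVneq Nx Ny) => [exy|nxy]; case: (eqVneq Ny Nz) => [eyz|nyz].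
    * rewrite -eyz -exy !eqxx; subst Ny Nz.
      by have [[_ tr _] _ _ _] := FP Nx NxD; apply: tr.
    * rewrite -exy !(inj_eq Some_inj) in nyz *; rewrite eqxx (negPf nyz).
      by move=> _.
    * rewrite -eyz !(inj_eq Some_inj) (negPf nxy).
      by move=> h _.
    * rewrite !(inj_eq Some_inj) (negPf nxy) (negPf nyz) => h1 h2.
      have h3 := ltn_trans h1 h2; case: eqP => [exz|//].
      by rewrite exz ltnn in h3.
  + move=> x y /comp_ex [Nx NxD xN] /comp_ex [Ny NyD yN] xy.
    rewrite /lt (compE _ _ NxD xN) (compE _ _ NyD yN) [Some Ny == _]eq_sym.
    have [exy|nxy] := eqVneq (Some Nx) (Some Ny).
      case: exy => exy; subst Ny; have [[_ _ tot] _ _ _] := FP Nx NxD; exact: tot.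
    by rewrite -neq_ltn (inj_eq val_inj) (inj_eq enum_rank_inj).
- apply/trivIsetP => A B /bigcupP [N ND AN] /bigcupP [N' N'D BN'] AB.
  have [_ tN sN _] := FP N ND; have [_ tN' sN' _] := FP N' N'D.
  have [NN'|NN'] := eqVneq N N'.
    by subst N'; move/trivIsetP: tN; apply.
  have sA := broken_circuit_ground (subsetP sN A AN).
  have sB := broken_circuit_ground (subsetP sN' B BN').
  by have d := dis N N' ND N'D NN'; clear -sA sB d; finset.
- apply/subsetP => A /bigcupP [N ND AN]; apply/broken; exists N => //.
  by have [_ _ sN _] := FP N ND; apply: (subsetP sN).
- move=> B /broken [N ND bB]; have [_ _ _ gN] := FP N ND.
  have [A AN sA] := gN B bB; exists A => //.
  by apply/bigcupP; exists N.
Qed.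

(** Condition (iv) speaks of summands of decompositions; one must exist for it to yield an order on
    M. *)
Lemma connected_decomposition T (M : matroid T) :
  exists2 D, direct_sum D M & {in D, forall Q, ground Q != set0 /\ connected_matroid Q}.
Proof.
have [n] := ubnP #|ground M|; elim: n M => // n IH M ltM.
have [M0|M0] := eqVneq (ground M) set0.
  exists set0; last by move=> Q; rewrite inE.
  split.
  - by move=> N1 N2; rewrite inE.
  - by rewrite big_set0.
  move=> A; rewrite M0 subset0; apply/idP/andP => [/indep_ground|[/eqP -> _]].
    by rewrite M0 subset0 => ->; split=> //; apply/forall_inP => N; rewrite inE.
  exact: indep0.
(* Connectedness is a negated existential in [Prop], so this distinction is made classically. *)
have [[N1 [N2 [N10 N20 N12 dN]]]|conM] := classic (exists N1 N2 : matroid T,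
      [/\ ground N1 != set0, ground N2 != set0, N1 != N2 & direct_sum [set N1; N2] M]); last first.
  exists [set M]; last by move=> Q; rewrite inE => /eqP ->.
  split.
  - by move=> N1 N2; rewrite !inE => /eqP -> /eqP ->; rewrite eqxx.
  - by rewrite big_set1.
  move=> A; apply/idP/andP => [iA|[sA /forall_inP /(_ M (set11 M))]]; last by rewrite (setIidPl sA).
  split; first exact: indep_ground.
  by apply/forall_inP => N; rewrite inE => /eqP ->; rewrite (setIidPl (indep_ground iA)).
have [dis gM iM] := dN.
have d12 : [disjoint ground N1 & ground N2] by apply: dis; rewrite ?set21 ?set22.
have gM' : ground M = ground N1 :|: ground N2.
  by rewrite gM big_setU1 ?big_set1 //= inE.
have cM := cardsU_disjoint d12; rewrite -gM' in cM.
rewrite -card_gt0 in N10; rewrite -card_gt0 in N20.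
have [|D1 dD1 cD1] := IH N1; first by lia.
have [|D2 dD2 cD2] := IH N2; first by lia.
have [dis1 g1 i1] := dD1; have [dis2 g2 i2] := dD2.
exists (D1 :|: D2); last by move=> Q; rewrite inE => /orP[/cD1|/cD2].
have s1 Q : Q \in D1 -> ground Q \subset ground N1 by move=> QD; rewrite g1 (bigcup_sup Q).
have s2 Q : Q \in D2 -> ground Q \subset ground N2 by move=> QD; rewrite g2 (bigcup_sup Q).
split.
- move=> Q1 Q2; rewrite !inE => /orP[Q11|Q12] /orP[Q21|Q22] neq.
  + exact: dis1.
  + by have := s1 _ Q11; have := s2 _ Q22; clear -d12 => sa sb; finset.
  + by have := s2 _ Q12; have := s1 _ Q21; clear -d12 => sa sb; finset.
  + exact: dis2.
- by rewrite bigcup_setU -g1 -g2.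
move=> A; rewrite iM; apply: andb_id2l => sA.
apply/forall_inP/forall_inP => [h Q|h N].
  rewrite inE => /orP[QD|QD].
    have := h N1; rewrite set21 i1 => /(_ isT) /andP[_ /forall_inP /(_ Q QD)].
    by rewrite -setIA (setIidPr (s1 Q QD)).
  have := h N2; rewrite set22 i2 => /(_ isT) /andP[_ /forall_inP /(_ Q QD)].
  by rewrite -setIA (setIidPr (s2 Q QD)).
rewrite !inE => /orP[] /eqP ->.
  rewrite i1 subsetIr; apply/forall_inP => Q QD.
  by rewrite -setIA (setIidPr (s1 Q QD)); apply: h; rewrite inE QD.
rewrite i2 subsetIr; apply/forall_inP => Q QD.
by rewrite -setIA (setIidPr (s2 Q QD)); apply: h; rewrite inE QD orbT.
Qed.

Lemma ci_order_avoiding T (M : matroid T) lt D : simple_matroid M -> ci_order M lt D ->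
  [/\ broken_circuit_complex M lt = avoiding (ground M) D, set0 \notin D
    & {in D, forall A : {set T}, A \subset ground M}].
Proof.
move=> [noloop _] [L tD /subsetP sD gD]; split.
- apply/setP => F; rewrite !inE; apply: andb_id2l => sF.
  apply/forall_inP/forall_inP => h A AD; first by apply: h; apply: sD.
  by have [B BD sB] := gD A AD; apply: contra (h B BD); apply: subset_trans.
- apply/negP => /sD /broken_circuitP [C [x [cC xC _ /esym/eqP]]].
  rewrite setD_eq0 => sC; have := noloop x; rewrite /loop.
  suff <- : C = [set x] by rewrite cC.
  by apply/eqP; rewrite eqEsubset sC sub1set.
- by move=> A /sD /broken_circuit_ground.
Qed.

Lemma vertices_bcc T (M : matroid T) lt : simple_matroid M ->
  vertices (broken_circuit_complex M lt) = ground M.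
Proof.
move=> sM; apply/setP => x; rewrite in_set; apply/idP/idP => [|xE].
  by rewrite inE sub1set => /andP[].
by apply: bcc_small => //; rewrite ?sub1set ?cards1.
Qed.

End CompleteIntersectionOrders.

Local Open Scope ring_scope.

(** * The equivalences *)

Lemma bcc_avoiding_minimal (T : finType) (M : matroid T) (lt : rel T) : simple_matroid M ->
  let D := minimal_nonfaces (broken_circuit_complex M lt) in
  [/\ broken_circuit_complex M lt = avoiding (ground M) D, set0 \notin D
    & {in D, forall A : {set T}, A \subset ground M}].
Proof.
move=> sM D; have V := vertices_bcc lt sM.
have memD A : A \in D -> (A \subset ground M) && (A \notin broken_circuit_complex M lt).
  by move/minimal_nonfacesP; rewrite V.
split; last by move=> A /memD /andP[].
  apply/setP => F; rewrite [in RHS]inE; apply/idP/andP => [bF|[sF /forall_inP av]].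
    have sF : F \subset ground M by move: bF; rewrite inE => /andP[].
    split=> //; apply/forall_inP => A /memD /andP[sA nA]; apply: contra nA => sAF.
    move: bF; rewrite !inE sF sA /= => /forall_inP h; apply/forall_inP => B bB.
    by apply: contra (h B bB) => sB; apply: subset_trans sAF.
  apply: contraT => nF; rewrite -V in sF.
  by have [B BD sB] := minimal_nonfaces_gen sF nF; have := av B BD; rewrite sB.
apply/negP => /memD /andP[_ /negP[]].
by apply: bcc_small; rewrite ?sub0set ?cards0.
Qed.

Lemma isomorphic_refl (T : finType) (M : matroid T) : isomorphic M M.
Proof.
by exists id; split=> [x y|| A _]; rewrite ?imset_id.
Qed.

Theorem theorem1p2 (K : fieldType) (T : finType) (M : matroid T)
    (simpleM : simple_matroid M)
    (lt0 : rel T) (lt0_linear : linear_order_on (ground M) lt0)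
    (h : int -> int) (hE : h = h_vector (broken_circuit_complex M lt0))
    (s : nat) (hs_neq0 : h s%:Z != 0)
    (hs_last : forall i : nat, (s < i)%N -> h i%:Z = 0) :
  [<-> exists2 lt : rel T, linear_order_on (ground M) lt
         & complete_intersection K (broken_circuit_complex M lt);
       forall i : nat, (i <= s)%N -> h i%:Z = h (s%:Z - i%:Z);
       h 0 = h s%:Z /\ h 1 = h (s%:Z - 1);
       forall N : matroid T, connected_component M N ->
         single_coloop N \/
         exists (U : finType) (Ns : seq (matroid U)) (P : matroid U),
           [/\ {in Ns, forall Q, exists2 m : nat, (2 <= m)%N
                                   & is_uniform m m.+1 Q},
               iterated_parallel_connection Ns P
             & isomorphic N P]].
Proof.
subst h; tfae.
- move=> [lt L /complete_intersection_disjoint tD].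
  have [eD D0 sD] := bcc_avoiding_minimal lt simpleM.
  have [N pal] := char_poly0_palindromic simpleM L tD D0 sD eD.
  exact: dehn_sommerville simpleM lt0_linear pal hs_neq0 hs_last.
- move=> ds; split; first by have := ds 0%N (leq0n s); rewrite subr0.
  (* For s = 0 the index 1 is out of range; both entries vanish, one lying beyond s and the other
     having a negative index. *)
  have [s0|s_gt0] := posnP s; last exact: (ds 1%N s_gt0).
  by rewrite (hs_last 1%N) s0.
- move=> [h0 h1] N compN.
  have [c [p [qM p0 p1]]] := h_vector_ends simpleM lt0_linear hs_neq0 hs_last.
  (* By (iii) the two lowest coefficients of p are h_0 = 1 and h_1 = |E| - r(E), the case of
     equality. *)
  rewrite -h0 h_vector_bcc0 // in p0; rewrite -h1 h_vector_bcc1 // in p1.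
  have [EN sN N0 tN] := component_parallel_tree simpleM qM p0 p1 compN.
  have sR := simple_matroid_rank simpleM.
  have [N1|N2] := leqP #|ground N| 1; [left|right].
    (* Simplicity gives the only element rank 1, so it is a coloop and not a loop. *)
    have /cards1P [e gN] : #|ground N| == 1%N by rewrite eqn_leq N1 card_gt0.
    exists e => //; rewrite coloopE ?gN ?set11 // EN rank_restr gN setDv setI0.
    rewrite (rank0 (matroid_rank_fun M)) rank_restr setIid (simple_rank1 sR) //.
    by rewrite -sub1set -gN.
  have [Ns [uNs ipcN]] := parallel_tree_ipc sR sN (tN N2).
  exists T, Ns, N; split=> //; last exact: isomorphic_refl.
  by rewrite EN.
- move=> comps; have [D dD cD] := connected_decomposition M.
  have [N ND|lt [S ciS]] := ci_order_direct_sum dD.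
    have [|[U [Ns [P [uNs ipcP iso]]]]] : single_coloop N \/ _ := comps N (ex_intro _ D (And3 dD cD ND)).
      exact: ci_order_coloop.
    have [lt [S ciP]] := ci_order_ipc ipcP uNs.
    exact: ci_order_iso iso ciP.
  have [L tS _ _] := ciS; have [eS S0 sS] := ci_order_avoiding simpleM ciS.
  exists lt => //; apply: (disjoint_complete_intersection K tS S0);
    by rewrite (vertices_bcc lt simpleM).
Qed.
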